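(* Let $0<a\le\infty$ and let $k(t)$ be in $\mathcal{K}_a$, with strip of analyticity $d<\operatorname{Re}(\lambda)<1$ of its Mellin transform. The finite part of the Mellin-type (possibly divergent) integral is the regularized analytic continuation of the corresponding Mellin transform; that is, for all non-negative integers $n$ and all $\lambda$ with $\operatorname{Re}(\lambda)>d$, $$\mathrm{f.p.}\!\int_0^a \frac{k(t)\ln^n t}{t^{\lambda}}\,dt=\overset{\times}{\mathcal{M}_a^*}[k(t)\ln^n t;1-\lambda].$$
   Context: Class $\mathcal{K}_a$ ($0<a\le\infty$): functions $k(t)$ of a real variable such that (1) $k(0)\ne 0$; (2) $k(t)$ is the restriction to $[0,a)$ of a complex function $k(z)$ (the complex extension) that is analytic at every point of $[0,a)$; (3) the Mellin transform $\mathcal{M}_a[k(t);1-\lambda]=\int_0^a k(t)t^{-\lambda}\,dt$ exists for $d<\operatorname{Re}(\lambda)<1$ for some $d<1$ (the strip of analyticity; $d=-\infty$ if $a<\infty$, while $d$ may be finite or $-\infty$ if $a=\infty$). $\mathcal{M}_a[k(t)\ln^n t;1-\lambda]=\int_0^a k(t)\ln^n t\;t^{-\lambda}\,dt$ for $d<\operatorname{Re}(\lambda)<1$, and $\mathcal{M}_a^*[k(t)\ln^n t;1-\lambda]$ denotes its analytic continuation (in $\lambda$) to the half-plane $\operatorname{Re}(\lambda)>d$, isolated singularities excepted. Regularized limit: if $w$ is analytic in a punctured disk around $\lambda_0$ with Laurent expansion $\sum_{k\in\mathbb{Z}}a_k(\lambda-\lambda_0)^k$ there, and $w_P(\lambda|\lambda_0)=\sum_{k\ge1}a_{-k}(\lambda-\lambda_0)^{-k}$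 is its principal part, then $\operatorname{reglim}_{\lambda\to\lambda_0}w(\lambda)=\lim_{\lambda\to\lambda_0}[w(\lambda)-w_P(\lambda|\lambda_0)]$. For $w$ analytic in a domain except perhaps at isolated points, the regularized function is $\overset{\times}{w}(\lambda)=\operatorname{reglim}_{\lambda'\to\lambda}w(\lambda')$ for all $\lambda$ in the domain. $\overset{\times}{\mathcal{M}_a^*}$ is the regularized version of $\mathcal{M}_a^*$ as a function of $\lambda$. Finite-part integral: for finite $a$ write, for small $\epsilon>0$, $\int_\epsilon^a k(t)\ln^n t\;t^{-\lambda}\,dt=C_\epsilon+D_\epsilon$, where $C_\epsilon$ is the group of terms that converge as $\epsilon\to0^+$ and $D_\epsilon$ is the group of terms that have no finite limit, consisting only of such terms in powers of $\epsilon$ (possibly with complex exponents) and $\ln\epsilon$, with no constant term. Then $\mathrm{f.p.}\!\int_0^a k(t)\ln^n t\;t^{-\lambda}\,dt=\lim_{\epsilon\to0}C_\epsilon$. For $a=\infty$, $\mathrm{f.p.}\!\int_0^\infty=\lim_{a\to\infty}\mathrm{f.p.}\!\int_0^a$. When the integral converges ($d<\operatorname{Re}(\lambda)<1$), $D_\epsilon=0$ and the same definition is applied. *)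

(* Defs.v *)
From Stdlib Require Import Reals List ZArith.
From Coquelicot Require Import Coquelicot.

Open Scope R_scope.

Definition Cexp (z : C) : C := (exp (Re z) * cos (Im z), exp (Re z) * sin (Im z)).

(* t^z on the principal branch; meaningful for t > 0 only. *)
Definition cpower (t : R) (z : C) : C := Cexp (z * RtoC (ln t))%C.

Definition analytic_at (f : C -> C) (z0 : C) : Prop :=
  exists (c : nat -> C) (r : R), 0 < r /\
    forall z : C, Cmod (z - z0)%C < r ->
      is_pseries (K := C_AbsRing) (V := C_NormedModule) c (z - z0)%C (f z).

Definition analytic_on_punctured_disk (f : C -> C) (z0 : C) (r : R) : Prop :=
  forall z : C, 0 < Cmod (z - z0)%C < r -> analytic_at f z.

(* The points of the domain D where f fails to be analytic are isolated. As the
   set of these points is closed in D, this means that every point of D, singular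
   or not, has a punctured disk around it on which f is analytic. *)
Definition analytic_except_isolated (D : C -> Prop) (f : C -> C) : Prop :=
  forall z0 : C, D z0 -> exists r : R, 0 < r /\ analytic_on_punctured_disk f z0 r.

(* w(z) = sum_{j in Z} c_j (z - z0)^j for 0 < |z - z0| < r, with principal part wP. *)
Definition laurent_expansion (w : C -> C) (z0 : C) (r : R) (c : Z -> C) (wP : C -> C)
  : Prop :=
  forall z : C, 0 < Cmod (z - z0)%C < r ->
    is_series (K := C_AbsRing) (V := C_NormedModule)
      (fun j : nat => (c (- Z.of_nat (S j))%Z * / (z - z0) ^ S j)%C) (wP z) /\
    is_series (K := C_AbsRing) (V := C_NormedModule)
      (fun j : nat => (c (Z.of_nat j) * (z - z0) ^ j)%C) (w z - wP z)%C.

Definition is_reglim (w : C -> C) (z0 v : C) : Prop :=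
  exists (r : R) (c : Z -> C) (wP : C -> C),
    0 < r /\
    analytic_on_punctured_disk w z0 r /\
    laurent_expansion w z0 r c wP /\
    filterlim (fun z : C => (w z - wP z)%C)
      (locally' (T := C_UniformSpace) z0) (locally (T := C_UniformSpace) v).

Definition is_regularized (D : C -> Prop) (w wx : C -> C) : Prop :=
  forall z : C, D z -> is_reglim w z (wx z).

Definition at_end (a : Rbar) : (R -> Prop) -> Prop :=
  match a with
  | Finite x => at_left x
  | _ => Rbar_locally a
  end.

(* M_a[f; s] = int_0^a f(t) t^(s-1) dt, as an improper Riemann integral at both ends. *)
Definition is_mellin (a : Rbar) (f : R -> C) (s v : C) : Prop :=
  is_RInt_gen (V := C_R_NormedModule)
    (fun t : R => (f t * cpower t (s - 1))%C) (at_right 0) (at_end a) v.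

Definition mellin_strip (a : Rbar) (k : R -> C) (d : Rbar) : Prop :=
  Rbar_lt d 1 /\
  (is_finite a -> d = m_infty) /\
  forall l : C, Rbar_lt d (Re l) -> Re l < 1 -> exists v : C, is_mellin a k (1 - l)%C v.

Definition class_K (a : Rbar) (k : R -> C) : Prop :=
  k 0 <> RtoC 0 /\
  (exists kz : C -> C, forall t : R, 0 <= t -> Rbar_lt t a ->
     kz (RtoC t) = k t /\ analytic_at kz (RtoC t)) /\
  exists d : Rbar, mellin_strip a k d.

Definition right_half_plane (d : Rbar) (l : C) : Prop := Rbar_lt d (Re l).

(* W continues l |-> M_a[f; 1 - l] from the strip d < Re l < 1 to Re l > d. The
   value of W at an isolated singularity is arbitrary. *)
Definition is_mellin_continuation (a : Rbar) (f : R -> C) (d : Rbar) (W : C -> C)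
  : Prop :=
  analytic_except_isolated (right_half_plane d) W /\
  forall l : C, Rbar_lt d (Re l) -> Re l < 1 -> is_mellin a f (1 - l)%C (W l).

Definition eps_monomial (p : C) (m : nat) (eps : R) : C :=
  (cpower eps p * RtoC (ln eps ^ m))%C.

(* No finite limit as eps -> 0+; in particular this excludes constants. *)
Definition divergent_monomial (p : C) (m : nat) : Prop :=
  ~ exists v : C,
      filterlim (eps_monomial p m) (at_right 0) (locally (T := C_UniformSpace) v).

(* The entry (c, (p, m)) of the list stands for the term c eps^p ln^m eps. *)
Definition divergent_sum (L : list (C * (C * nat))) (eps : R) : C :=
  fold_right (fun e s => (fst e * eps_monomial (fst (snd e)) (snd (snd e)) eps + s)%C)
    (RtoC 0) L.

Definition is_fp_int_finite (f : R -> C) (b : R) (v : C) : Prop :=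
  exists (Ceps : R -> C) (L : list (C * (C * nat))),
    List.Forall (fun e => divergent_monomial (fst (snd e)) (snd (snd e))) L /\
    at_right 0 (fun eps : R =>
      is_RInt_gen (V := C_R_NormedModule) f (at_point eps) (at_left b)
        (Ceps eps + divergent_sum L eps)%C) /\
    filterlim Ceps (at_right 0) (locally (T := C_UniformSpace) v).

Definition is_fp_int (a : Rbar) (f : R -> C) (v : C) : Prop :=
  match a with
  | Finite b => is_fp_int_finite f b v
  | p_infty => exists F : R -> C,
      (forall b : R, 0 < b -> is_fp_int_finite f b (F b)) /\
      filterlim F (Rbar_locally p_infty) (locally (T := C_UniformSpace) v)
  | m_infty => False
  end.

Definition times_ln_pow (k : R -> C) (n : nat) (t : R) : C := (k t * RtoC (ln t ^ n))%C.

(* Main.v *)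
Require Import Defs.
From Stdlib Require Import Reals List ZArith Lra Lia Psatz Classical ClassicalEpsilon FunctionalExtensionality.
From Coquelicot Require Import Coquelicot.

(* Near 0 expand k(t) = sum_m c_m t^m. Each power contributes a primitive
   E_s(t) of t^(s-1) ln^n t, s = m + 1 - l, without constant term; E_s(eps) is a combination of
   monomials eps^s ln^j eps, which tend to 0 when Re s > 0 and diverge otherwise. Adding
   sum_(m<N) c_m E_(m+1-l)(eps) to the integral from eps to b therefore gives the finite part, as a
   limit that does not depend on N > Re l - 1. As E_s(1) = (-1)^n n! / s^(n+1) for s <> 0 and
   E_0(1) = 0, this finite part is, around each point, a single pole term (absent from the value at
   the pole itself) plus an analytic function: it is its own regularization. The part of the
   integral above b is analytic by Abel's integration by parts and absolute convergence. Any other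
   continuation agrees with this one off isolated points by the identity theorem. *)

(** The hypothesis grants only that the integral of [k t] against [t^(-l)] converges in the strip,
    perhaps conditionally at the upper end; nothing is granted about factors [ln^n t]. Domination at
    that end therefore cannot start from [k]: it starts from the bounded primitive of [k t] times
    [t^(-l0)], for one real [l0] in the strip, and convergence with logarithms is a consequence.
    Analyticity is always obtained by writing down a power series. With [l = l1 + w] one expands
    [t^(-w) = exp (- w ln t)]; the remainder is geometrically small uniformly in [t], at the price
    of factors [t^e] and [t^(-e)], which are harmless because the exponents giving absolute
    convergence form an open set. The Taylor coefficients are the same integrals with further powers
    of [ln t], so all [n] are treated together. Division by 0 gives 0, so [A / (l - p)^(n+1)]
    contributes nothing at [p], as regularization requires: one function serves both as continuation
    and as regularization. *)

(** * Limits of complex-valued functions along a filter *)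

Definition Clim {T : Type} (F : (T -> Prop) -> Prop) (f : T -> C) (v : C) : Prop :=
  filterlim f F (locally (T := C_UniformSpace) v).

Lemma Clim_Cmod {T : Type} (F : (T -> Prop) -> Prop) {FF : Filter F} (f : T -> C) (v : C) :
  Clim F f v <-> forall eps : R, 0 < eps -> F (fun x => Cmod (f x - v)%C < eps).
Proof.
  unfold Clim; rewrite filterlim_locally; split; intros H eps.
  - intros Heps.
    assert (Hs : 0 < sqrt 2) by (apply sqrt_lt_R0; lra).
    (* Balls of the product uniform structure are squares; one of half side [eps / sqrt 2] lies
       inside the disc of radius [eps]. *)
    assert (He : 0 < eps / sqrt 2) by (apply Rdiv_lt_0_compat; lra).
    generalize (H (mkposreal _ He)); apply filter_imp; intros x Hx.
    apply C_NormedModule_mixin_compat2 in Hx; simpl in Hx.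
    replace (sqrt 2 * (eps / sqrt 2)) with eps in Hx by (field; lra). exact Hx.
  - generalize (H eps (cond_pos eps)); apply filter_imp; intros x Hx.
    apply C_NormedModule_mixin_compat1; exact Hx.
Qed.

(* [Filter] premises of a lemma are left as goals by [apply]. *)
Tactic Notation "clim" uconstr(L) :=
  apply L; try lazymatch goal with
               | |- Filter _ => typeclasses eauto
               | |- ProperFilter _ => typeclasses eauto
               end.

Lemma Clim_const {T : Type} (F : (T -> Prop) -> Prop) {FF : Filter F} (v : C) :
  Clim F (fun _ => v) v.
Proof. apply filterlim_const. Qed.

Lemma Clim_ext_loc {T : Type} (F : (T -> Prop) -> Prop) {FF : Filter F} (f g : T -> C) (v : C) :
  F (fun x => f x = g x) -> Clim F f v -> Clim F g v.
Proof. intros H; apply filterlim_ext_loc; exact H. Qed.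

Lemma Clim_ext {T : Type} (F : (T -> Prop) -> Prop) {FF : Filter F} (f g : T -> C) (v : C) :
  (forall x, f x = g x) -> Clim F f v -> Clim F g v.
Proof. intros H; apply filterlim_ext; exact H. Qed.

Lemma Clim_unique {T : Type} (F : (T -> Prop) -> Prop) {FF : ProperFilter F}
  (f : T -> C) (u v : C) : Clim F f u -> Clim F f v -> u = v.
Proof. apply (filterlim_locally_unique (K := C_AbsRing) (V := C_NormedModule)). Qed.

Lemma Clim_plus {T : Type} (F : (T -> Prop) -> Prop) {FF : Filter F} (f g : T -> C) (u v : C) :
  Clim F f u -> Clim F g v -> Clim F (fun x => f x + g x)%C (u + v)%C.
Proof.
  intros Hf Hg. eapply filterlim_comp_2; [exact Hf | exact Hg |].
  apply (filterlim_plus (K := C_AbsRing) (V := C_NormedModule)).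
Qed.

Lemma Clim_mult {T : Type} (F : (T -> Prop) -> Prop) {FF : Filter F} (f g : T -> C) (u v : C) :
  Clim F f u -> Clim F g v -> Clim F (fun x => f x * g x)%C (u * v)%C.
Proof.
  rewrite !Clim_Cmod by typeclasses eauto. intros Hf Hg eps Heps.
  pose proof (Cmod_ge_0 u) as Hu; pose proof (Cmod_ge_0 v) as Hv.
  (* The error is at most [e (e + |u| + |v|)], hence at most [e K <= eps / 2] since [e <= 1]. *)
  set (K := 1 + Cmod u + Cmod v).
  assert (HK : 1 <= K) by (unfold K; lra).
  set (e := Rmin 1 (eps / (2 * K))).
  assert (He : 0 < e) by (apply Rmin_pos; [lra | apply Rdiv_lt_0_compat; lra]).
  assert (He1 : e <= 1) by apply Rmin_l.
  assert (He2 : e * (2 * K) <= eps).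
  { apply Rle_trans with (eps / (2 * K) * (2 * K)).
    - apply Rmult_le_compat_r; [lra | apply Rmin_r].
    - right; field; lra. }
  generalize (filter_and _ _ (Hf e He) (Hg e He)); apply filter_imp; intros x [H1 H2].
  replace (f x * g x - u * v)%C with ((f x - u) * (g x - v) + ((f x - u) * v + u * (g x - v)))%C
    by ring.
  eapply Rle_lt_trans; [apply Cmod_triangle |].
  eapply Rle_lt_trans; [apply Rplus_le_compat_l, Cmod_triangle |].
  rewrite !Cmod_mult.
  pose proof (Cmod_ge_0 (f x - u)%C); pose proof (Cmod_ge_0 (g x - v)%C).
  unfold K in *. nra.
Qed.

Lemma Clim_minus {T : Type} (F : (T -> Prop) -> Prop) {FF : Filter F} (f g : T -> C) (u v : C) :
  Clim F f u -> Clim F g v -> Clim F (fun x => f x - g x)%C (u - v)%C.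
Proof.
  intros Hf Hg.
  clim (Clim_ext F (fun x => f x + - RtoC 1 * g x)%C).
  - intros x; ring.
  - replace (u - v)%C with (u + - RtoC 1 * v)%C by ring.
    clim Clim_plus; [exact Hf |]. clim Clim_mult; [clim Clim_const | exact Hg].
Qed.

Lemma Clim_zero_le {T : Type} (F : (T -> Prop) -> Prop) {FF : Filter F} (f : T -> C) (g : T -> R) :
  F (fun x => Cmod (f x) <= g x) -> filterlim g F (locally 0) -> Clim F f 0.
Proof.
  intros Hle Hg. clim Clim_Cmod; intros eps Heps.
  assert (Hg' := proj1 (filterlim_locally g 0) Hg (mkposreal _ Heps)).
  generalize (filter_and _ _ Hle Hg'); apply filter_imp; intros x [H1 H2].
  replace (f x - 0)%C with (f x) by ring.
  change (Rabs (minus (g x) 0) < eps) in H2. unfold minus, plus, opp in H2; simpl in H2.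
  rewrite Ropp_0, Rplus_0_r in H2. apply Rle_lt_trans with (2 := H2).
  apply Rle_trans with (1 := H1), Rle_abs.
Qed.

Lemma Clim_Cmod_le {T : Type} (F : (T -> Prop) -> Prop) {FF : ProperFilter F}
  (f : T -> C) (v : C) (B : R) :
  F (fun x => Cmod (f x) <= B) -> Clim F f v -> Cmod v <= B.
Proof.
  intros HB Hf. apply Rnot_lt_le; intros Hlt.
  assert (Hp : 0 < Cmod v - B) by lra.
  destruct (filter_ex _ (filter_and _ _ HB (proj1 (Clim_Cmod F f v) Hf _ Hp))) as [x [H1 H2]].
  assert (Cmod v <= Cmod (f x) + Cmod (f x - v)%C).
  { replace v with (f x + - (f x - v))%C at 1 by ring.
    eapply Rle_trans; [apply Cmod_triangle |]. rewrite Cmod_opp; lra. }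
  lra.
Qed.

Lemma Clim_cauchy {T : Type} (F : (T -> Prop) -> Prop) {FF : ProperFilter F} (f : T -> C) :
  (forall eps, 0 < eps -> exists P : T -> Prop, F P /\
     forall x y, P x -> P y -> Cmod (f y - f x)%C < eps) ->
  exists v, Clim F f v.
Proof.
  intros H. apply (proj1 (filterlim_locally_cauchy (U := C_CompleteNormedModule) f)).
  intros eps. destruct (H eps (cond_pos eps)) as [P [HP HP']].
  exists P; split; [exact HP |]. intros x y Hx Hy.
  apply C_NormedModule_mixin_compat1. apply HP'; assumption.
Qed.

Lemma Clim_bounded {T : Type} (F : (T -> Prop) -> Prop) {FF : Filter F} (f : T -> C) (v : C) :
  Clim F f v -> F (fun x => Cmod (f x) <= Cmod v + 1).
Proof.
  rewrite Clim_Cmod by typeclasses eauto; intros H. generalize (H 1 Rlt_0_1); apply filter_imp; intros x Hx.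
  replace (f x) with (v + (f x - v))%C by ring.
  eapply Rle_trans; [apply Cmod_triangle |]. lra.
Qed.

Lemma RtoC_lim {T : Type} (F : (T -> Prop) -> Prop) {FF : Filter F} (g : T -> R) (x : R) :
  filterlim g F (locally x) -> Clim F (fun t => RtoC (g t)) (RtoC x).
Proof.
  intros Hg. clim Clim_Cmod; intros eps Heps.
  generalize (proj1 (filterlim_locally g x) Hg (mkposreal _ Heps)).
  apply filter_imp; intros t Ht. rewrite <- RtoC_minus, Cmod_R. exact Ht.
Qed.

(** * Continuity and derivatives of complex functions of a real variable *)

Definition Ccont (f : R -> C) (t : R) : Prop :=
  continuous (U := C_UniformSpace) f t.

Definition Cder (f : R -> C) (t : R) (v : C) : Prop :=
  is_derive (K := R_AbsRing) (V := C_R_NormedModule) f t v.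

Lemma Ccont_lim (f : R -> C) (t : R) : Ccont f t <-> Clim (locally t) f (f t).
Proof. reflexivity. Qed.

Lemma Ccont_mult (f g : R -> C) (t : R) :
  Ccont f t -> Ccont g t -> Ccont (fun x => f x * g x)%C t.
Proof. rewrite !Ccont_lim. clim Clim_mult. Qed.

Lemma Ccont_plus (f g : R -> C) (t : R) :
  Ccont f t -> Ccont g t -> Ccont (fun x => f x + g x)%C t.
Proof. rewrite !Ccont_lim. clim Clim_plus. Qed.

Lemma Ccont_minus (f g : R -> C) (t : R) :
  Ccont f t -> Ccont g t -> Ccont (fun x => f x - g x)%C t.
Proof. rewrite !Ccont_lim. clim Clim_minus. Qed.

Lemma Ccont_const (c : C) (t : R) : Ccont (fun _ => c) t.
Proof. apply Ccont_lim; clim Clim_const. Qed.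

Lemma Ccont_RtoC (g : R -> R) (t : R) : continuous g t -> Ccont (fun x => RtoC (g x)) t.
Proof. intros H; apply Ccont_lim; clim RtoC_lim; exact H. Qed.

Lemma Cder_pair (u v : R -> R) (t u' v' : R) :
  is_derive u t u' -> is_derive v t v' -> Cder (fun x => (u x, v x)) t (u', v').
Proof.
  intros Hu Hv.
  apply (is_derive_ext (V := C_R_NormedModule)
           (fun x => plus (scal (u x) ((1, 0) : C_R_NormedModule))
                          (scal (v x) ((0, 1) : C_R_NormedModule)))).
  - intros x; apply injective_projections; unfold plus, scal; simpl;
      unfold scal, plus, mult; simpl; unfold mult; simpl; ring.
  - replace ((u', v') : C_R_NormedModule)
      with (plus (scal u' ((1, 0) : C_R_NormedModule)) (scal v' ((0, 1) : C_R_NormedModule))).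
    + apply (is_derive_plus (V := C_R_NormedModule)).
      * exact (is_derive_scal_l (K := R_AbsRing) (V := C_R_NormedModule) u t u' _ Hu).
      * exact (is_derive_scal_l (K := R_AbsRing) (V := C_R_NormedModule) v t v' _ Hv).
    + apply injective_projections; unfold plus, scal; simpl;
        unfold scal, plus, mult; simpl; unfold mult; simpl; ring.
Qed.

Lemma Cder_components (f : R -> C) (t : R) (v : C) :
  Cder f t v -> is_derive (fun x => fst (f x)) t (fst v) /\ is_derive (fun x => snd (f x)) t (snd v).
Proof.
  intros H; split.
  - apply (filterdiff_comp f (fun z : R * R => fst z) (fun y => scal y v) (fun z : R * R => fst z) H).
    apply filterdiff_linear, is_linear_fst.
  - apply (filterdiff_comp f (fun z : R * R => snd z) (fun y => scal y v) (fun z : R * R => snd z) H).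
    apply filterdiff_linear, is_linear_snd.
Qed.

Lemma Cder_ext (f g : R -> C) (t : R) (v : C) :
  (forall x, f x = g x) -> Cder f t v -> Cder g t v.
Proof. intros H; apply is_derive_ext; exact H. Qed.

Lemma Cder_plus (f g : R -> C) (t : R) (u v : C) :
  Cder f t u -> Cder g t v -> Cder (fun x => f x + g x)%C t (u + v)%C.
Proof. intros Hf Hg; apply (is_derive_plus (V := C_R_NormedModule) f g); assumption. Qed.

(** Complex multiplication is not the scalar action of the real module in which [Cder] lives, so the
    real product rule is applied to the components. *)
Lemma Cder_mult (f g : R -> C) (t : R) (u v : C) :
  Cder f t u -> Cder g t v -> Cder (fun x => f x * g x)%C t (u * g t + f t * v)%C.
Proof.
  intros Hf Hg. apply Cder_components in Hf; apply Cder_components in Hg.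
  destruct Hf as [Hf1 Hf2]; destruct Hg as [Hg1 Hg2].
  apply Cder_ext with (fun x => (fst (f x) * fst (g x) - snd (f x) * snd (g x),
                                 fst (f x) * snd (g x) + snd (f x) * fst (g x))).
  { intros x; reflexivity. }
  replace (u * g t + f t * v)%C with
    ((fst u * fst (g t) + fst (f t) * fst v) - (snd u * snd (g t) + snd (f t) * snd v),
     (fst u * snd (g t) + fst (f t) * snd v) + (snd u * fst (g t) + snd (f t) * fst v)).
  - apply Cder_pair.
    + apply (is_derive_minus (V := R_NormedModule));
        apply (is_derive_mult (K := R_AbsRing)); auto; intros; apply Rmult_comm.
    + apply (is_derive_plus (V := R_NormedModule));
        apply (is_derive_mult (K := R_AbsRing)); auto; intros; apply Rmult_comm.
  - apply injective_projections; simpl; ring.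
Qed.

Lemma Cder_const (c : C) (t : R) : Cder (fun _ => c) t 0.
Proof. apply (is_derive_const (V := C_R_NormedModule)). Qed.

Lemma Cder_scal (c : C) (f : R -> C) (t : R) (u : C) :
  Cder f t u -> Cder (fun x => c * f x)%C t (c * u)%C.
Proof.
  intros Hf. replace (c * u)%C with (0 * f t + c * u)%C by ring.
  apply (Cder_mult (fun _ => c) f); [apply Cder_const | exact Hf].
Qed.

Lemma Cder_RtoC (g : R -> R) (t g' : R) :
  is_derive g t g' -> Cder (fun x => RtoC (g x)) t (RtoC g').
Proof. intros H; apply Cder_pair; [exact H | apply (is_derive_const (V := R_NormedModule))]. Qed.

Lemma Cder_Ccont (f : R -> C) (t : R) (v : C) : Cder f t v -> Ccont f t.
Proof.
  intros H. apply (ex_derive_continuous (V := C_R_NormedModule)). exists v; exact H.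
Qed.

(** * Integrals of complex functions of a real variable *)

Definition CRInt (f : R -> C) (x y : R) : C := RInt (V := C_R_CompleteNormedModule) f x y.

(** Unordered end points: the base point [b] of later integrals is joined to points tending to 0 as
    well as to points tending to the upper end. *)
Definition Rbetween (x y t : R) : Prop := Rmin x y <= t <= Rmax x y.

Lemma norm_C_R (z : C) : norm (K := R_AbsRing) (V := C_R_NormedModule) z = Cmod z.
Proof.
  unfold Cmod, norm; simpl; unfold prod_norm, norm; simpl; unfold abs; simpl.
  f_equal. rewrite !Rmult_1_r, <- !Rabs_mult, !Rabs_pos_eq; [reflexivity | |]; apply Rle_0_sqr.
Qed.

Lemma CRInt_correct (f : R -> C) (x y : R) :
  (forall t, Rbetween x y t -> Ccont f t) ->
  is_RInt (V := C_R_NormedModule) f x y (CRInt f x y).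
Proof.
  intros H. apply (RInt_correct (V := C_R_CompleteNormedModule)).
  apply (ex_RInt_continuous (V := C_R_CompleteNormedModule)). exact H.
Qed.

Lemma CRInt_unique (f : R -> C) (x y : R) (v : C) :
  is_RInt (V := C_R_NormedModule) f x y v -> CRInt f x y = v.
Proof. apply (is_RInt_unique (V := C_R_CompleteNormedModule)). Qed.

Lemma CRInt_Chasles (f : R -> C) (x y z : R) :
  (forall t, Rbetween x y t -> Ccont f t) -> (forall t, Rbetween y z t -> Ccont f t) ->
  (CRInt f x y + CRInt f y z)%C = CRInt f x z.
Proof.
  intros H1 H2. apply (RInt_Chasles (V := C_R_CompleteNormedModule));
    apply (ex_RInt_continuous (V := C_R_CompleteNormedModule)); assumption.
Qed.

Lemma CRInt_point (f : R -> C) (x : R) : CRInt f x x = 0.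
Proof. apply (RInt_point (V := C_R_CompleteNormedModule)). Qed.

Lemma CRInt_swap (f : R -> C) (x y : R) :
  (forall t, Rbetween x y t -> Ccont f t) -> CRInt f x y = (- CRInt f y x)%C.
Proof.
  intros H.
  assert (E := CRInt_Chasles f y x y). rewrite CRInt_point in E.
  replace (CRInt f x y) with (CRInt f y x + CRInt f x y - CRInt f y x)%C by ring.
  rewrite E; [ring | | exact H].
  intros t Ht; apply H; unfold Rbetween in *; rewrite Rmin_comm, Rmax_comm; exact Ht.
Qed.

Lemma CRInt_ext (f g : R -> C) (x y : R) :
  (forall t, Rmin x y < t < Rmax x y -> f t = g t) -> CRInt f x y = CRInt g x y.
Proof. apply (RInt_ext (V := C_R_CompleteNormedModule)). Qed.

Lemma CRInt_plus (f g : R -> C) (x y : R) :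
  (forall t, Rbetween x y t -> Ccont f t) -> (forall t, Rbetween x y t -> Ccont g t) ->
  CRInt (fun t => f t + g t)%C x y = (CRInt f x y + CRInt g x y)%C.
Proof.
  intros Hf Hg. apply CRInt_unique.
  apply (is_RInt_plus (V := C_R_NormedModule)); apply CRInt_correct; assumption.
Qed.

(** The constant is complex while integration is over a real module, so the integrals of the two
    components are recombined. *)
Lemma CRInt_scal (c : C) (f : R -> C) (x y : R) :
  (forall t, Rbetween x y t -> Ccont f t) ->
  CRInt (fun t => c * f t)%C x y = (c * CRInt f x y)%C.
Proof.
  intros Hf. apply CRInt_unique.
  assert (H := CRInt_correct f x y Hf). set (I := CRInt f x y) in *.
  pose proof (is_RInt_fct_extend_fst f x y I H) as H1.
  pose proof (is_RInt_fct_extend_snd f x y I H) as H2.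
  apply (is_RInt_fct_extend_pair (U := R_NormedModule) (V := R_NormedModule)); simpl.
  - apply (is_RInt_minus (V := R_NormedModule));
      apply (is_RInt_scal (V := R_NormedModule)); assumption.
  - apply (is_RInt_plus (V := R_NormedModule));
      apply (is_RInt_scal (V := R_NormedModule)); assumption.
Qed.

Lemma CRInt_derive (f f' : R -> C) (x y : R) :
  (forall t, Rbetween x y t -> Cder f t (f' t)) -> (forall t, Rbetween x y t -> Ccont f' t) ->
  CRInt f' x y = (f y - f x)%C.
Proof.
  intros H1 H2. apply CRInt_unique.
  apply (is_RInt_derive (V := C_R_CompleteNormedModule)); assumption.
Qed.

Lemma CRInt_is_derive (f : R -> C) (b x : R) :
  (forall t, Rbetween b x t -> Ccont f t) -> locally x (Ccont f) ->
  Cder (CRInt f b) x (f x).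
Proof.
  intros H1 [e He].
  apply (is_derive_RInt (V := C_R_NormedModule) f (CRInt f b) b x).
  - exists e. intros y Hy. apply CRInt_correct. intros t Ht.
    change (Rabs (y - x) < e) in Hy.
    (* A point between [b] and [y] lies between [b] and [x], or else within [e] of [x]. *)
    destruct (Rle_dec (Rmin b x) t) as [A | A]; [destruct (Rle_dec t (Rmax b x)) as [B | B] |].
    + apply H1; split; assumption.
    + apply He. change (Rabs (t - x) < e). unfold Rbetween, Rmin, Rmax in *.
      apply Rabs_def2 in Hy. apply Rabs_def1; repeat destruct Rle_dec; lra.
    + apply He. change (Rabs (t - x) < e). unfold Rbetween, Rmin, Rmax in *.
      apply Rabs_def2 in Hy. apply Rabs_def1; repeat destruct Rle_dec; lra.
  - apply He, ball_center.
Qed.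

(** The absolute value on the right makes the estimate insensitive to orientation; the case [y < x]
    is reduced to [x <= y] by swapping both integrals. *)
Lemma CRInt_Cmod_le (f : R -> C) (g : R -> R) (x y : R) :
  (forall t, Rbetween x y t -> Ccont f t) -> (forall t, Rbetween x y t -> continuous g t) ->
  (forall t, Rbetween x y t -> Cmod (f t) <= g t) ->
  Cmod (CRInt f x y) <= Rabs (RInt g x y).
Proof.
  assert (Main : forall x y, x <= y ->
    (forall t, Rbetween x y t -> Ccont f t) -> (forall t, Rbetween x y t -> continuous g t) ->
    (forall t, Rbetween x y t -> Cmod (f t) <= g t) ->
    Cmod (CRInt f x y) <= Rabs (RInt g x y)).
  { clear x y; intros x y Hxy Hf Hg Hle.
    apply Rle_trans with (2 := Rle_abs _). rewrite <- norm_C_R.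
    apply (norm_RInt_le (V := C_R_NormedModule) f g x y); [exact Hxy | | |].
    - intros t Ht. rewrite norm_C_R. apply Hle. unfold Rbetween.
      rewrite Rmin_left, Rmax_right; assumption.
    - apply CRInt_correct, Hf.
    - apply (RInt_correct (V := R_CompleteNormedModule)), ex_RInt_continuous, Hg. }
  intros Hf Hg Hle. destruct (Rle_dec x y) as [H | H]; [apply Main; assumption |].
  assert (E : forall t, Rbetween y x t -> Rbetween x y t).
  { intros t; unfold Rbetween; rewrite Rmin_comm, Rmax_comm; trivial. }
  rewrite CRInt_swap by exact Hf. rewrite Cmod_opp.
  rewrite <- (opp_RInt_swap (V := R_CompleteNormedModule)).
  2: { apply ex_RInt_continuous; intros; apply Hg, E; assumption. }
  change (opp (RInt g y x)) with (- RInt g y x). rewrite Rabs_Ropp.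
  apply Main; [lra | | |]; intros; [apply Hf | apply Hg | apply Hle]; apply E; assumption.
Qed.

(** * Complex power series *)

(** The bound [n] is exclusive: the sum has [n] terms and degree below [n], so that the Taylor
    remainder after [Cpsum c w n] is of order [|w|^n]. *)
Fixpoint Cpsum (c : nat -> C) (w : C) (n : nat) : C :=
  match n with
  | O => 0
  | S m => (Cpsum c w m + c m * w ^ m)%C
  end.

Definition Cpseries (c : nat -> C) (w S : C) : Prop := Clim eventually (Cpsum c w) S.

Lemma eventually_le (N : nat) : eventually (fun n => (N <= n)%nat).
Proof. exists N; trivial. Qed.

Lemma Clim_shift (u : nat -> C) (v : C) :
  Clim eventually u v <-> Clim eventually (fun n => u (S n)) v.
Proof.
  rewrite !Clim_Cmod by typeclasses eauto. split; intros H eps Heps; destruct (H eps Heps) as [N HN].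
  - exists N; intros n Hn; apply HN; lia.
  - exists (S N); intros [|n] Hn; [lia |]. apply HN; lia.
Qed.

Lemma Cpsum_sum_n (c : nat -> C) (w : C) (n : nat) :
  sum_n (G := C_AbelianMonoid) (fun j => (c j * w ^ j)%C) n = Cpsum c w (S n).
Proof.
  induction n as [|n IH].
  - rewrite sum_O; simpl; ring.
  - rewrite sum_Sn, IH. reflexivity.
Qed.

Lemma is_series_Cpseries (c : nat -> C) (w S : C) :
  is_series (K := C_AbsRing) (V := C_NormedModule) (fun j => (c j * w ^ j)%C) S
  <-> Cpseries c w S.
Proof.
  unfold Cpseries; rewrite Clim_shift. unfold is_series, Clim.
  split; apply filterlim_ext; intros n; [| symmetry]; apply Cpsum_sum_n.
Qed.

Lemma pow_n_Cpow (w : C) (n : nat) : pow_n (K := C_Ring) w n = (w ^ n)%C.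
Proof. induction n as [|n IH]; [reflexivity |]. simpl; rewrite IH; reflexivity. Qed.

Lemma is_pseries_Cpseries (c : nat -> C) (w S : C) :
  is_pseries (K := C_AbsRing) (V := C_NormedModule) c w S <-> Cpseries c w S.
Proof.
  rewrite <- is_series_Cpseries. unfold is_pseries.
  split; apply is_series_ext; intros n; rewrite <- (pow_n_Cpow w n); apply Cmult_comm.
Qed.

Lemma Cpsum_ext (c c' : nat -> C) (w : C) (n : nat) :
  (forall j, (j < n)%nat -> c j = c' j) -> Cpsum c w n = Cpsum c' w n.
Proof.
  induction n as [|n IH]; intros H; [reflexivity |].
  simpl; rewrite IH, H by (intros; try apply H; lia); reflexivity.
Qed.

Lemma Cpsum_decr (c : nat -> C) (w : C) (n : nat) :
  Cpsum c w (S n) = (c O + w * Cpsum (fun j => c (S j)) w n)%C.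
Proof.
  induction n as [|n IH]; [cbn [Cpsum Cpow]; ring |].
  change (Cpsum c w (S (S n))) with (Cpsum c w (S n) + c (S n) * w ^ (S n))%C.
  rewrite IH; cbn [Cpsum Cpow]; ring.
Qed.

Lemma Ccont_Cpsum (c : nat -> C) (f : R -> C) (N : nat) (t : R) :
  Ccont f t -> Ccont (fun x => Cpsum c (f x) N) t.
Proof.
  intros Hf. induction N as [|N IH]; [apply Ccont_const |]. cbn [Cpsum].
  apply Ccont_plus; [exact IH |]. apply Ccont_mult; [apply Ccont_const |].
  clear IH; induction N as [|N IH]; [apply Ccont_const |]. cbn [Cpow].
  apply Ccont_mult; assumption.
Qed.

Lemma Cpseries_unique (c : nat -> C) (w S S' : C) :
  Cpseries c w S -> Cpseries c w S' -> S = S'.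
Proof. clim Clim_unique. Qed.

Lemma Cpseries_plus (c c' : nat -> C) (w S S' : C) :
  Cpseries c w S -> Cpseries c' w S' -> Cpseries (fun j => c j + c' j)%C w (S + S')%C.
Proof.
  intros H H'. apply (Clim_ext eventually (fun n => Cpsum c w n + Cpsum c' w n)%C).
  - intros n; induction n as [|n IH]; cbn [Cpsum]; [ring | rewrite <- IH; ring].
  - clim Clim_plus; assumption.
Qed.

Lemma Cpseries_scal (a : C) (c : nat -> C) (w S : C) :
  Cpseries c w S -> Cpseries (fun j => a * c j)%C w (a * S)%C.
Proof.
  intros H. apply (Clim_ext eventually (fun n => a * Cpsum c w n)%C).
  - intros n; induction n as [|n IH]; cbn [Cpsum]; [ring | rewrite <- IH; ring].
  - clim Clim_mult; [clim Clim_const | exact H].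
Qed.

Lemma Cpseries_incr (c : nat -> C) (w S : C) :
  Cpseries c w S ->
  Cpseries (fun j => match j with O => RtoC 0 | S i => c i end) w (w * S)%C.
Proof.
  intros H. unfold Cpseries; rewrite Clim_shift.
  apply (Clim_ext eventually (fun n => w * Cpsum c w n)%C).
  - intros n; rewrite Cpsum_decr; change (w * Cpsum c w n = 0 + w * Cpsum c w n)%C; ring.
  - clim Clim_mult; [clim Clim_const | exact H].
Qed.

Lemma Cpseries_decr (c : nat -> C) (w S : C) :
  w <> 0 -> Cpseries c w S -> Cpseries (fun j => c (Datatypes.S j)) w (/ w * (S - c O))%C.
Proof.
  intros Hw H. unfold Cpseries in H; rewrite Clim_shift in H.
  apply (Clim_ext eventually (fun n => / w * (Cpsum c w (Datatypes.S n) - c O))%C).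
  - intros n; rewrite Cpsum_decr; field; exact Hw.
  - clim Clim_mult; [clim Clim_const |]. clim Clim_minus; [exact H | clim Clim_const].
Qed.

Lemma Cpseries_zero (c : nat -> C) : Cpseries c 0 (c O).
Proof.
  unfold Cpseries; rewrite Clim_shift.
  apply (Clim_ext eventually (fun _ => c O)); [| clim Clim_const].
  intros n; rewrite Cpsum_decr; ring.
Qed.

(** Keeping the exact geometric sum on the right lets the induction on [k] close with an
    equality. *)
Lemma Cpsum_bound (c : nat -> C) (w : C) (M q : R) (m k : nat) :
  0 <= q < 1 -> (forall j, Cmod (c j * w ^ j)%C <= M * q ^ j) ->
  Cmod (Cpsum c w (m + k) - Cpsum c w m)%C <= M * (q ^ m - q ^ (m + k)) / (1 - q).
Proof.
  intros Hq H. induction k as [|k IH].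
  - rewrite Nat.add_0_r. replace (Cpsum c w m - Cpsum c w m)%C with (RtoC 0) by ring.
    rewrite Cmod_0. right; field; lra.
  - rewrite Nat.add_succ_r; simpl.
    replace (Cpsum c w (m + k) + c (m + k)%nat * w ^ (m + k) - Cpsum c w m)%C
      with ((Cpsum c w (m + k) - Cpsum c w m) + c (m + k)%nat * w ^ (m + k))%C by ring.
    eapply Rle_trans; [apply Cmod_triangle |].
    eapply Rle_trans; [apply Rplus_le_compat; [exact IH | apply H] |].
    right; field; lra.
Qed.

Lemma Cpseries_ex (c : nat -> C) (w : C) (M q : R) :
  0 <= q < 1 -> (forall j, Cmod (c j * w ^ j)%C <= M * q ^ j) ->
  exists S, Cpseries c w S /\ Cmod S <= M / (1 - q).
Proof.
  intros Hq H.
  assert (HM : 0 <= M).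
  { generalize (H O); simpl. pose proof (Cmod_ge_0 (c O * 1)%C). lra. }
  assert (Hq1 : 0 < 1 - q) by lra.
  assert (Hb : forall m n, (m <= n)%nat ->
             Cmod (Cpsum c w n - Cpsum c w m)%C <= M / (1 - q) * q ^ m).
  { intros m n Hmn. replace n with (m + (n - m))%nat by lia.
    eapply Rle_trans; [apply Cpsum_bound; eassumption |].
    replace (M / (1 - q) * q ^ m) with (M * q ^ m / (1 - q)) by (field; lra).
    apply Rmult_le_compat_r; [apply Rlt_le, Rinv_0_lt_compat, Hq1 |].
    apply Rmult_le_compat_l; [exact HM |].
    pose proof (pow_le q (m + (n - m)) (proj1 Hq)); lra. }
  destruct (Clim_cauchy eventually (Cpsum c w)) as [S HS].
  - intros eps Heps.
    set (B := M / (1 - q)) in *.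
    assert (HB : 0 <= B) by (apply Rdiv_le_0_compat; lra).
    (* The added 1 keeps the denominator positive when [B = 0]. *)
    destruct (pow_lt_1_zero q) with (y := eps / (2 * (B + 1))) as [N HN].
    { rewrite Rabs_pos_eq; lra. }
    { apply Rdiv_lt_0_compat; lra. }
    exists (fun n => (N <= n)%nat); split; [apply eventually_le |].
    specialize (HN N (Nat.le_refl N)). rewrite Rabs_pos_eq in HN by (apply pow_le; lra).
    assert (HN' : B * q ^ N < eps / 2).
    { apply Rle_lt_trans with ((B + 1) * q ^ N).
      - apply Rmult_le_compat_r; [apply pow_le; lra | lra].
      - replace (eps / 2) with ((B + 1) * (eps / (2 * (B + 1)))) by (field; lra).
        apply Rmult_lt_compat_l; lra. }
    intros x y Hx Hy.
    replace (Cpsum c w y - Cpsum c w x)%C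
      with ((Cpsum c w y - Cpsum c w N) + - (Cpsum c w x - Cpsum c w N))%C by ring.
    eapply Rle_lt_trans; [apply Cmod_triangle |]. rewrite Cmod_opp.
    pose proof (Hb N x Hx); pose proof (Hb N y Hy); lra.
  - exists S; split; [exact HS |].
    apply (Clim_Cmod_le eventually (Cpsum c w)); [| exact HS].
    exists O; intros n _. generalize (Hb O n (Nat.le_0_l n)); simpl.
    replace (Cpsum c w n - 0)%C with (Cpsum c w n) by ring. lra.
Qed.

Lemma Cpseries_terms_bounded (c : nat -> C) (w S : C) :
  Cpseries c w S -> exists M, forall j, Cmod (c j * w ^ j)%C <= M.
Proof.
  intros H. rewrite <- is_series_Cpseries in H.
  destruct (filterlim_bounded (K := C_AbsRing) (V := C_NormedModule) _ (ex_intro _ S H)) as [M HM].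
  assert (HM' : forall n, Cmod (Cpsum c w (Datatypes.S n)) <= M).
  { intros n; rewrite <- Cpsum_sum_n. apply HM. }
  exists (M + M). intros [|j].
  - generalize (HM' O). cbn [Cpsum]. rewrite Cplus_0_l.
    pose proof (Cmod_ge_0 (c O * w ^ 0)%C). lra.
  - pose proof (HM' j) as H1; pose proof (HM' (Datatypes.S j)) as H2.
    cbn [Cpsum] in H1, H2.
    replace (c (Datatypes.S j) * w ^ Datatypes.S j)%C
      with ((Cpsum c w j + c j * w ^ j + c (Datatypes.S j) * w ^ Datatypes.S j)
            + - (Cpsum c w j + c j * w ^ j))%C by ring.
    eapply Rle_trans; [apply Cmod_triangle |]. rewrite Cmod_opp.
    apply Rplus_le_compat; [exact H2 | exact H1].
Qed.

(** Cauchy's estimates serve as the working form of a convergent power series: they survive shifting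
    the coefficients and give explicit bounds on tails. *)
Definition geometric_coefs (c : nat -> C) (rho M : R) : Prop :=
  0 < rho /\ forall j, Cmod (c j) * rho ^ j <= M.

Lemma geometric_coefs_term (c : nat -> C) (rho M : R) (w : C) (j : nat) :
  geometric_coefs c rho M -> Cmod (c j * w ^ j)%C <= M * (Cmod w / rho) ^ j.
Proof.
  intros [Hr H]. rewrite Cmod_mult, Cmod_pow.
  replace (Cmod (c j) * Cmod w ^ j) with (Cmod (c j) * rho ^ j * (Cmod w / rho) ^ j).
  - apply Rmult_le_compat_r; [| apply H].
    apply pow_le, Rdiv_le_0_compat; [apply Cmod_ge_0 | exact Hr].
  - rewrite Rmult_assoc, <- Rpow_mult_distr. do 2 f_equal. field; lra.
Qed.

Lemma geometric_coefs_ge_0 (c : nat -> C) (rho M : R) : geometric_coefs c rho M -> 0 <= M.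
Proof.
  intros [Hr H]. generalize (H O); simpl. pose proof (Cmod_ge_0 (c O)); lra.
Qed.

Lemma geometric_coefs_ex (c : nat -> C) (rho M : R) (w : C) :
  geometric_coefs c rho M -> Cmod w < rho -> exists S, Cpseries c w S.
Proof.
  intros H Hw. pose proof (proj1 H) as Hr.
  destruct (Cpseries_ex c w M (Cmod w / rho)) as [S [HS _]]; [| | exists S; exact HS].
  - split; [apply Rdiv_le_0_compat; [apply Cmod_ge_0 | exact Hr] |].
    apply Rlt_div_l; lra.
  - intros j; apply geometric_coefs_term, H.
Qed.

Lemma geometric_coefs_sum_le (c : nat -> C) (rho M : R) (w S : C) :
  geometric_coefs c rho M -> Cmod w <= rho / 2 -> Cpseries c w S -> Cmod S <= 2 * M.
Proof.
  intros H Hw HS. pose proof (proj1 H) as Hr.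
  destruct (Cpseries_ex c w M (1 / 2)) as [S' [HS' HM]]; [lra | |].
  - intros j; eapply Rle_trans; [apply geometric_coefs_term, H |].
    apply Rmult_le_compat_l; [eapply geometric_coefs_ge_0, H |].
    apply pow_incr; split; [apply Rdiv_le_0_compat; [apply Cmod_ge_0 | exact Hr] |].
    apply Rle_div_l; lra.
  - rewrite (Cpseries_unique _ _ _ _ HS HS'). lra.
Qed.

Lemma geometric_coefs_decr (c : nat -> C) (rho M : R) :
  geometric_coefs c rho M -> geometric_coefs (fun j => c (S j)) rho (M / rho).
Proof.
  intros [Hr H]; split; [exact Hr |]. intros j.
  apply Rmult_le_reg_r with rho; [exact Hr |].
  replace (M / rho * rho) with M by (field; lra).
  generalize (H (S j)); simpl. lra.
Qed.

Lemma geometric_coefs_incr_n (c : nat -> C) (rho M : R) (N : nat) :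
  geometric_coefs c rho M -> exists M', geometric_coefs (fun j => c (N + j)%nat) rho M'.
Proof.
  revert c M; induction N as [|N IH]; intros c M H; [exists M; exact H |].
  apply (IH (fun j => c (S j)) (M / rho)), geometric_coefs_decr, H.
Qed.

(** The remainder is [w^N] times the series with shifted coefficients, which again satisfy Cauchy's
    estimates; on the half disc its terms are dominated by a geometric series of ratio 1/2. The
    constant depends on [N] but not on [w]. *)
Lemma Cpseries_remainder_bound (c : nat -> C) (rho M : R) (N : nat) :
  geometric_coefs c rho M -> exists M', forall w S : C,
    Cmod w <= rho / 2 -> Cpseries c w S -> Cmod (S - Cpsum c w N)%C <= M' * Cmod w ^ N.
Proof.
  intros Hg. destruct (geometric_coefs_incr_n c rho M N Hg) as [M' HM'].
  exists (2 * M'). intros w S Hw HS.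
  destruct (geometric_coefs_ex _ _ _ w HM') as [S' HS'].
  { pose proof (proj1 Hg); lra. }
  assert (E : S = (Cpsum c w N + w ^ N * S')%C).
  { clear - HS HS'. revert c S S' HS HS'. induction N as [|N IH]; intros c S S' HS HS'.
    - rewrite (Cpseries_unique _ _ _ _ HS HS'). simpl; ring.
    - destruct (Ceq_dec w 0) as [-> | Hw].
      + rewrite (Cpseries_unique _ _ _ _ HS (Cpseries_zero c)), Cpsum_decr. simpl; ring.
      + rewrite Cpsum_decr.
        assert (E := IH _ _ _ (Cpseries_decr _ _ _ Hw HS) HS').
        simpl. replace S with (c O + w * (/ w * (S - c O)))%C by (field; exact Hw).
        rewrite E; ring. }
  rewrite E. replace (Cpsum c w N + w ^ N * S' - Cpsum c w N)%C with (S' * w ^ N)%C by ring.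
  rewrite Cmod_mult, Cmod_pow. apply Rmult_le_compat_r; [apply pow_le, Cmod_ge_0 |].
  eapply geometric_coefs_sum_le; eassumption.
Qed.

(** * Analytic functions *)

(** Convergence at the single point [z0 + r / 2] bounds the terms there, and these have modulus
    [|c_j| (r / 2)^j]. *)
Lemma analytic_at_coefs (f : C -> C) (z0 : C) :
  analytic_at f z0 -> exists c rho M, geometric_coefs c rho M /\
    forall z, Cmod (z - z0)%C <= rho -> Cpseries c (z - z0)%C (f z).
Proof.
  intros [c [r [Hr H]]].
  assert (Hs : forall z, Cmod (z - z0)%C <= r / 2 -> Cpseries c (z - z0)%C (f z)).
  { intros z Hz. apply is_pseries_Cpseries, H. lra. }
  assert (Hm : Cmod (RtoC (r / 2)) = r / 2) by (rewrite Cmod_R; apply Rabs_pos_eq; lra).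
  destruct (Cpseries_terms_bounded c (RtoC (r / 2)) (f (z0 + RtoC (r / 2))%C)) as [M HM].
  { replace (RtoC (r / 2)) with (z0 + RtoC (r / 2) - z0)%C at 1 by ring.
    apply Hs. replace (z0 + RtoC (r / 2) - z0)%C with (RtoC (r / 2)) by ring. lra. }
  exists c, (r / 2), M; split; [split; [lra |] | exact Hs].
  intros j. generalize (HM j). rewrite Cmod_mult, Cmod_pow, Hm. trivial.
Qed.

Lemma analytic_at_intro (f : C -> C) (z0 : C) (c : nat -> C) (r : R) :
  0 < r -> (forall z, Cmod (z - z0)%C < r -> Cpseries c (z - z0)%C (f z)) -> analytic_at f z0.
Proof.
  intros Hr H; exists c, r; split; [exact Hr |].
  intros z Hz; apply is_pseries_Cpseries, H, Hz.
Qed.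

Lemma analytic_at_ext (f g : C -> C) (z0 : C) (r : R) :
  0 < r -> (forall z, Cmod (z - z0)%C < r -> f z = g z) -> analytic_at f z0 -> analytic_at g z0.
Proof.
  intros Hr E [c [r' [Hr' H]]].
  exists c, (Rmin r r'); split; [apply Rmin_pos; assumption |].
  intros z Hz. rewrite <- E.
  - apply H, Rlt_le_trans with (1 := Hz), Rmin_r.
  - apply Rlt_le_trans with (1 := Hz), Rmin_l.
Qed.

Lemma analytic_at_ext_all (f g : C -> C) (z0 : C) :
  (forall z, f z = g z) -> analytic_at f z0 -> analytic_at g z0.
Proof. intros E; apply (analytic_at_ext f g z0 1 Rlt_0_1); intros; apply E. Qed.

Lemma analytic_at_plus (f g : C -> C) (z0 : C) :
  analytic_at f z0 -> analytic_at g z0 -> analytic_at (fun z => f z + g z)%C z0.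
Proof.
  intros [c [r [Hr H]]] [c' [r' [Hr' H']]].
  apply (analytic_at_intro _ _ (fun j => c j + c' j)%C (Rmin r r')).
  - apply Rmin_pos; assumption.
  - intros z Hz; apply Cpseries_plus; apply is_pseries_Cpseries.
    + apply H, Rlt_le_trans with (1 := Hz), Rmin_l.
    + apply H', Rlt_le_trans with (1 := Hz), Rmin_r.
Qed.

Lemma analytic_at_scal (a : C) (f : C -> C) (z0 : C) :
  analytic_at f z0 -> analytic_at (fun z => a * f z)%C z0.
Proof.
  intros [c [r [Hr H]]]. apply (analytic_at_intro _ _ (fun j => a * c j)%C r Hr).
  intros z Hz; apply Cpseries_scal, is_pseries_Cpseries, H, Hz.
Qed.

Lemma analytic_at_minus (f g : C -> C) (z0 : C) :
  analytic_at f z0 -> analytic_at g z0 -> analytic_at (fun z => f z - g z)%C z0.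
Proof.
  intros Hf Hg. apply (analytic_at_ext_all (fun z => f z + - RtoC 1 * g z)%C).
  - intros z; ring.
  - apply analytic_at_plus; [exact Hf | apply analytic_at_scal, Hg].
Qed.

Lemma analytic_at_const (a z0 : C) : analytic_at (fun _ => a) z0.
Proof.
  apply (analytic_at_intro _ _ (fun j => match j with O => a | S _ => RtoC 0 end) 1 Rlt_0_1).
  intros z _. unfold Cpseries; rewrite Clim_shift.
  apply (Clim_ext eventually (fun _ => a)); [| clim Clim_const].
  intros n; rewrite Cpsum_decr.
  assert (E : Cpsum (fun _ => RtoC 0) (z - z0)%C n = 0).
  { induction n as [|n IH]; simpl; [reflexivity | rewrite IH; ring]. }
  rewrite E; ring.
Qed.

(** Split [z - p] as [(z0 - p) + (z - z0)]: a scaling and a shift of the series. Integration by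
    parts will produce such a factor [l - l0]. *)
Lemma analytic_at_mult_linear (f : C -> C) (p z0 : C) :
  analytic_at f z0 -> analytic_at (fun z => (z - p) * f z)%C z0.
Proof.
  intros [c [r [Hr H]]].
  apply (analytic_at_intro _ _
           (fun j => (z0 - p) * c j + match j with O => RtoC 0 | S i => c i end)%C r Hr).
  intros z Hz. replace ((z - p) * f z)%C with ((z0 - p) * f z + (z - z0) * f z)%C by ring.
  apply Cpseries_plus; [apply Cpseries_scal | apply Cpseries_incr];
    apply is_pseries_Cpseries, H, Hz.
Qed.

(** Obtained by comparing coefficients in [(s + w) * sum b_j w^j = sum c_j w^j], where [s = z0 - p]
    and [w = z - z0]. *)
Fixpoint divided_coefs (s : C) (c : nat -> C) (j : nat) : C :=
  match j with
  | O => (c O / s)%C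
  | S i => ((c (S i) - divided_coefs s c i) / s)%C
  end.

Lemma analytic_at_div_linear (f : C -> C) (p z0 : C) :
  z0 <> p -> analytic_at f z0 -> analytic_at (fun z => f z / (z - p))%C z0.
Proof.
  intros Hp Hf. destruct (analytic_at_coefs _ _ Hf) as [c [rho [M [Hg H]]]].
  assert (HM := geometric_coefs_ge_0 _ _ _ Hg). destruct Hg as [Hr Hc].
  set (s := (z0 - p)%C).
  assert (Hs : s <> 0).
  { intros E; apply Hp. replace z0 with (s + p)%C by (unfold s; ring). rewrite E; ring. }
  assert (Hs' : 0 < Cmod s) by (apply Cmod_gt_0, Hs).
  (* With [r <= |s| / 2] the bound [2 M / |s|] reproduces itself in the recursion:
     [(M + r * (2 M / |s|)) / |s| <= 2 M / |s|]. *)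
  set (r := Rmin rho (Cmod s / 2)).
  assert (Hr0 : 0 < r) by (apply Rmin_pos; lra).
  assert (Hr1 : r <= rho) by apply Rmin_l.
  assert (Hr2 : r <= Cmod s / 2) by apply Rmin_r.
  set (b := divided_coefs s c).
  assert (Hcr : forall j, Cmod (c j) * r ^ j <= M).
  { intros j; eapply Rle_trans; [| apply (Hc j)].
    apply Rmult_le_compat_l; [apply Cmod_ge_0 | apply pow_incr; lra]. }
  assert (Hb : geometric_coefs b r (2 * M / Cmod s)).
  { split; [exact Hr0 |]. intros j; induction j as [|j IH].
    - change (b O) with (c O / s)%C. rewrite Cmod_div by exact Hs.
      generalize (Hcr O); simpl pow; intros H0.
      replace (Cmod (c O) / Cmod s * 1) with (Cmod (c O) * 1 / Cmod s) by (field; lra).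
      apply Rmult_le_compat_r; [apply Rlt_le, Rinv_0_lt_compat, Hs' | lra].
    - change (b (S j)) with ((c (S j) - b j) / s)%C. rewrite Cmod_div by exact Hs.
      assert (Ht : Cmod (c (S j) - b j)%C <= Cmod (c (S j)) + Cmod (b j)).
      { unfold Cminus; rewrite <- (Cmod_opp (b j)). apply Cmod_triangle. }
      specialize (Hcr (S j)).
      assert (Hp0 : 0 <= r ^ S j) by (apply pow_le; lra).
      replace (Cmod (c (S j) - b j)%C / Cmod s * r ^ S j)
        with (Cmod (c (S j) - b j)%C * r ^ S j / Cmod s) by (field; lra).
      apply Rmult_le_compat_r; [apply Rlt_le, Rinv_0_lt_compat, Hs' |].
      apply Rle_trans with (Cmod (c (S j)) * r ^ S j + r * (Cmod (b j) * r ^ j)).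
      { eapply Rle_trans; [apply Rmult_le_compat_r; [exact Hp0 | exact Ht] |].
        simpl; right; ring. }
      assert (r * (Cmod (b j) * r ^ j) <= Cmod s / 2 * (2 * M / Cmod s)).
      { apply Rmult_le_compat; [lra | | exact Hr2 | exact IH].
        apply Rmult_le_pos; [apply Cmod_ge_0 | apply pow_le; lra]. }
      replace (Cmod s / 2 * (2 * M / Cmod s)) with M in * by (field; lra). lra. }
  apply (analytic_at_intro _ _ b r Hr0). intros z Hz.
  destruct (geometric_coefs_ex _ _ _ _ Hb Hz) as [S HS].
  assert (Hzp : (z - p)%C <> 0).
  { intros E. assert (E' : (z - z0)%C = (- s)%C).
    { unfold s. replace (z - z0)%C with ((z - p) - (z0 - p))%C by ring. rewrite E; ring. }
    rewrite E', Cmod_opp in Hz. lra. }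
  assert (E : f z = (s * S + (z - z0) * S)%C).
  { apply (Cpseries_unique c (z - z0)%C); [apply H; lra |].
    apply (Clim_ext eventually
      (Cpsum (fun j => s * b j + match j with O => RtoC 0 | Datatypes.S i => b i end)%C (z - z0)%C)).
    - intros n; apply Cpsum_ext; intros [|j] _.
      + unfold b; simpl; field; exact Hs.
      + change (b (Datatypes.S j)) with ((c (Datatypes.S j) - b j) / s)%C. field; exact Hs.
    - apply Cpseries_plus; [apply Cpseries_scal | apply Cpseries_incr]; exact HS. }
  replace (f z / (z - p))%C with S; [exact HS |].
  rewrite E; unfold s; field; exact Hzp.
Qed.

Lemma analytic_at_inv_pow (p z0 : C) (n : nat) :
  z0 <> p -> analytic_at (fun z => / (z - p) ^ n)%C z0.
Proof.
  intros Hp. induction n as [|n IH].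
  - apply (analytic_at_ext_all (fun _ => RtoC 1)); [| apply analytic_at_const].
    intros z; simpl; field.
  - assert (Hd : 0 < Cmod (z0 - p)%C).
    { apply Cmod_gt_0. intros E; apply Hp.
      replace z0 with (z0 - p + p)%C by ring. rewrite E; ring. }
    apply (analytic_at_ext (fun z => / (z - p) ^ n / (z - p))%C _ _ _ Hd).
    + intros z Hz.
      assert (Hzp : (z - p)%C <> 0).
      { intros E. replace (z - z0)%C with ((z - p) - (z0 - p))%C in Hz by ring.
        rewrite E in Hz. replace (0 - (z0 - p))%C with (- (z0 - p))%C in Hz by ring.
        rewrite Cmod_opp in Hz. lra. }
      simpl. field. split; [apply Cpow_nz, Hzp | exact Hzp].
    + apply analytic_at_div_linear; assumption.
Qed.

Lemma analytic_at_continuous (f : C -> C) (z0 : C) :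
  analytic_at f z0 -> forall eps, 0 < eps -> exists delta, 0 < delta /\
    forall z, Cmod (z - z0)%C < delta -> Cmod (f z - f z0)%C < eps.
Proof.
  intros Hf eps Heps. destruct (analytic_at_coefs _ _ Hf) as [c [rho [M [Hg H]]]].
  destruct (Cpseries_remainder_bound c rho M 1 Hg) as [M' HM'].
  pose proof (proj1 Hg) as Hr.
  assert (E : c O = f z0).
  { apply (Cpseries_unique c 0); [apply Cpseries_zero |].
    replace (RtoC 0) with (z0 - z0)%C by ring. apply H.
    replace (z0 - z0)%C with (RtoC 0) by ring. rewrite Cmod_0; lra. }
  set (K := Rabs M' + 1). assert (HK : 0 < K) by (unfold K; pose proof (Rabs_pos M'); lra).
  exists (Rmin (rho / 2) (eps / K)); split.
  { apply Rmin_pos; [lra | apply Rdiv_lt_0_compat; lra]. }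
  intros z Hz.
  assert (Hz1 := Rlt_le_trans _ _ _ Hz (Rmin_l _ _)).
  assert (Hz2 := Rlt_le_trans _ _ _ Hz (Rmin_r _ _)).
  generalize (HM' (z - z0)%C (f z) (Rlt_le _ _ Hz1) (H z ltac:(lra))).
  simpl. replace (f z - (0 + c O * 1))%C with (f z - f z0)%C by (rewrite E; ring).
  intros Hle. eapply Rle_lt_trans; [exact Hle |]. rewrite Rmult_1_r.
  apply Rlt_div_r in Hz2; [| exact HK].
  pose proof (Cmod_ge_0 (z - z0)%C); pose proof (Rle_abs M'). unfold K in *. nra.
Qed.

(** Zeros accumulating at [z0] force the constant coefficient to vanish by continuity. Dividing the
    series by [w] keeps the zeros other than [z0], so the next coefficient vanishes too, and so
    on. *)
Lemma analytic_at_zero_nbhd (f : C -> C) (z0 : C) :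
  analytic_at f z0 ->
  (forall delta, 0 < delta -> exists z, z <> z0 /\ Cmod (z - z0)%C < delta /\ f z = 0) ->
  exists r, 0 < r /\ forall z, Cmod (z - z0)%C < r -> f z = 0.
Proof.
  intros Hf Hz. destruct (analytic_at_coefs _ _ Hf) as [c [rho [M [Hg H]]]].
  pose proof (proj1 Hg) as Hr.
  (* The zeros are recorded as zeros of the series and not of [f], so that the induction can pass to
     the shifted series. *)
  assert (Hacc : forall delta, 0 < delta ->
            exists w : C, w <> 0 /\ Cmod w < delta /\ Cpseries c w 0).
  { intros delta Hd. destruct (Hz (Rmin delta rho)) as [z [H1 [H2 H3]]].
    { apply Rmin_pos; assumption. }
    exists (z - z0)%C; repeat split.
    - intros E; apply H1. replace z with (z - z0 + z0)%C by ring. rewrite E; ring.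
    - apply Rlt_le_trans with (1 := H2), Rmin_l.
    - rewrite <- H3. apply H, Rlt_le, Rlt_le_trans with (1 := H2), Rmin_r. }
  assert (Hc0 : forall j, c j = 0).
  { clear - Hg Hacc. intros j. revert c M Hg Hacc.
    assert (Base : forall c M, geometric_coefs c rho M ->
      (forall delta, 0 < delta -> exists w : C, w <> 0 /\ Cmod w < delta /\ Cpseries c w 0) ->
      c O = 0).
    { intros c M Hg Hacc. pose proof (proj1 Hg) as Hr.
      apply Cmod_eq_0, Rle_antisym; [| apply Cmod_ge_0].
      apply Rnot_lt_le; intros Hlt.
      destruct (Cpseries_remainder_bound c rho M 1 Hg) as [M' HM'].
      set (K := Rabs M' + 1). assert (HK : 0 < K) by (unfold K; pose proof (Rabs_pos M'); lra).
      destruct (Hacc (Rmin (rho / 2) (Cmod (c O) / K))) as [w [_ [Hw Hs]]].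
      { apply Rmin_pos; [lra | apply Rdiv_lt_0_compat; lra]. }
      assert (Hw1 := Rlt_le_trans _ _ _ Hw (Rmin_l _ _)).
      assert (Hw2 := Rlt_le_trans _ _ _ Hw (Rmin_r _ _)).
      generalize (HM' w 0 (Rlt_le _ _ Hw1) Hs). simpl.
      replace (0 - (0 + c O * 1))%C with (- c O)%C by ring. rewrite Cmod_opp, Rmult_1_r.
      apply Rlt_div_r in Hw2; [| exact HK].
      pose proof (Cmod_ge_0 w); pose proof (Rle_abs M'). unfold K in *. nra. }
    induction j as [|j IH]; intros c M Hg Hacc; [eapply Base; eassumption |].
    apply (IH (fun i => c (S i)) (M / rho)); [apply geometric_coefs_decr, Hg |].
    intros delta Hd. destruct (Hacc delta Hd) as [w [H1 [H2 H3]]].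
    exists w; repeat split; try assumption.
    replace (RtoC 0) with (/ w * (0 - c O))%C; [apply Cpseries_decr; assumption |].
    rewrite (Base c M Hg Hacc). ring. }
  exists rho; split; [exact Hr |]. intros z Hzr.
  apply (Cpseries_unique c (z - z0)%C); [apply H; lra |].
  apply (Clim_ext eventually (fun _ => RtoC 0)); [| clim Clim_const].
  intros n; induction n as [|n IH]; simpl; [reflexivity |].
  rewrite <- IH, Hc0. ring.
Qed.

(** * The complex exponential and complex powers *)

Lemma Cexp_plus (z w : C) : Cexp (z + w)%C = (Cexp z * Cexp w)%C.
Proof.
  unfold Cexp, Re, Im. apply injective_projections; simpl;
    rewrite exp_plus, ?cos_plus, ?sin_plus; ring.
Qed.

Lemma Cexp_0 : Cexp 0 = 1.
Proof.
  unfold Cexp, Re, Im; simpl. rewrite exp_0, cos_0, sin_0.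
  apply injective_projections; simpl; ring.
Qed.

Lemma Cmod_Cexp (z : C) : Cmod (Cexp z) = exp (Re z).
Proof.
  unfold Cmod, Cexp; simpl.
  replace (exp (Re z) * cos (Im z) * (exp (Re z) * cos (Im z) * 1) +
           exp (Re z) * sin (Im z) * (exp (Re z) * sin (Im z) * 1))
    with (exp (Re z) * exp (Re z) * (Rsqr (sin (Im z)) + Rsqr (cos (Im z)))) by (unfold Rsqr; ring).
  rewrite sin2_cos2, Rmult_1_r. apply sqrt_square, Rlt_le, exp_pos.
Qed.

Lemma Cexp_neq_0 (z : C) : Cexp z <> 0.
Proof. apply Cmod_gt_0. rewrite Cmod_Cexp. apply exp_pos. Qed.

Lemma Cder_Cexp (phi : R -> C) (t : R) (v : C) :
  Cder phi t v -> Cder (fun x => Cexp (phi x)) t (v * Cexp (phi t))%C.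
Proof.
  intros H; apply Cder_components in H; destruct H as [H1 H2].
  replace (v * Cexp (phi t))%C with
    (fst v * exp (fst (phi t)) * cos (snd (phi t)) + exp (fst (phi t)) * (snd v * - sin (snd (phi t))),
     fst v * exp (fst (phi t)) * sin (snd (phi t)) + exp (fst (phi t)) * (snd v * cos (snd (phi t)))).
  - unfold Cexp, Re, Im.
    assert (He : is_derive (fun x => exp (fst (phi x))) t (fst v * exp (fst (phi t)))).
    { apply (is_derive_comp exp (fun x => fst (phi x))); [apply is_derive_exp | exact H1]. }
    apply Cder_pair.
    + apply (is_derive_mult (K := R_AbsRing) (fun x => exp (fst (phi x))) (fun x => cos (snd (phi x)))
               t (fst v * exp (fst (phi t))) (snd v * - sin (snd (phi t)))).
      * exact He.
      * apply (is_derive_comp cos (fun x => snd (phi x))); [apply is_derive_cos | exact H2].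
      * intros; apply Rmult_comm.
    + apply (is_derive_mult (K := R_AbsRing) (fun x => exp (fst (phi x))) (fun x => sin (snd (phi x)))
               t (fst v * exp (fst (phi t))) (snd v * cos (snd (phi t)))).
      * exact He.
      * apply (is_derive_comp sin (fun x => snd (phi x))); [apply is_derive_sin | exact H2].
      * intros; apply Rmult_comm.
  - unfold Cexp, Re, Im. apply injective_projections; simpl; ring.
Qed.

Lemma cpower_plus (t : R) (z w : C) : cpower t (z + w)%C = (cpower t z * cpower t w)%C.
Proof. unfold cpower. rewrite Cmult_plus_distr_r. apply Cexp_plus. Qed.

Lemma cpower_0 (t : R) : cpower t 0 = 1.
Proof. unfold cpower. rewrite Cmult_0_l. apply Cexp_0. Qed.

Lemma cpower_neq_0 (t : R) (z : C) : cpower t z <> 0.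
Proof. apply Cexp_neq_0. Qed.

Lemma cpower_opp (t : R) (z : C) : cpower t (- z)%C = (/ cpower t z)%C.
Proof.
  assert (H := cpower_plus t z (- z)).
  replace (z + - z)%C with (RtoC 0) in H by ring. rewrite cpower_0 in H.
  replace (/ cpower t z)%C with (/ cpower t z * (cpower t z * cpower t (- z)))%C.
  - field. apply cpower_neq_0.
  - rewrite <- H. ring.
Qed.

Lemma Cmod_cpower (t : R) (z : C) : Cmod (cpower t z) = Rpower t (Re z).
Proof.
  unfold cpower, Rpower. rewrite Cmod_Cexp. f_equal. unfold Re; simpl. ring.
Qed.

Lemma cpower_INR (t : R) (m : nat) : 0 < t -> cpower t (RtoC (INR m)) = (RtoC t ^ m)%C.
Proof.
  intros Ht. rewrite <- RtoC_pow, <- Rpower_pow by exact Ht.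
  unfold cpower, Rpower, Cexp. rewrite <- RtoC_mult. unfold Re, Im; simpl.
  rewrite cos_0, sin_0. apply injective_projections; simpl; ring.
Qed.

Lemma cpower_1 (t : R) : 0 < t -> cpower t 1 = t.
Proof. intros Ht. change (RtoC 1) with (RtoC (INR 1)). rewrite (cpower_INR t 1 Ht). simpl; ring. Qed.

Lemma cpower_at_1 (z : C) : cpower 1 z = 1.
Proof. unfold cpower. rewrite ln_1, Cmult_0_r. apply Cexp_0. Qed.

Lemma Cder_cpower (t : R) (z : C) :
  0 < t -> Cder (fun x => cpower x z) t (z * cpower t (z - 1))%C.
Proof.
  intros Ht.
  replace (z * cpower t (z - 1))%C with (z * RtoC (/ t) * Cexp (z * RtoC (ln t)))%C.
  - unfold cpower. apply (Cder_Cexp (fun x => z * RtoC (ln x))%C).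
    apply (Cder_scal z (fun x => RtoC (ln x))), Cder_RtoC.
    auto_derive; [exact Ht | field; lra].
  - unfold Cminus. rewrite cpower_plus, cpower_opp, cpower_1 by exact Ht.
    rewrite RtoC_inv by lra. unfold cpower. field. intros E; injection E; lra.
Qed.

Lemma Ccont_cpower (t : R) (z : C) : 0 < t -> Ccont (fun x => cpower x z) t.
Proof. intros Ht; eapply Cder_Ccont, Cder_cpower, Ht. Qed.

Lemma continuous_ln_pow (t : R) (n : nat) : 0 < t -> continuous (fun x => ln x ^ n) t.
Proof.
  intros Ht. apply (ex_derive_continuous (V := R_NormedModule)).
  auto_derive; exact Ht.
Qed.

Lemma continuous_Rpower (t y : R) : 0 < t -> continuous (fun x => Rpower x y) t.
Proof.
  intros Ht. apply (ex_derive_continuous (V := R_NormedModule)).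
  unfold Rpower; auto_derive; exact Ht.
Qed.

(** * The exponential series and a geometric bound for its remainder *)

Definition exp_coefs (j : nat) : C := RtoC (/ INR (fact j)).

Lemma Cder_scaled_pow (z : C) (k : nat) (t : R) :
  Cder (fun x => (RtoC x * z) ^ S k)%C t (RtoC (INR (S k)) * z * (RtoC t * z) ^ k)%C.
Proof.
  assert (H1 : Cder (fun x => RtoC x * z)%C t z).
  { apply (Cder_ext (fun x => z * RtoC x)%C); [intros; ring |].
    generalize (Cder_scal z (fun x => RtoC x) t 1 (Cder_RtoC _ _ _ (is_derive_id (K := R_AbsRing) t))).
    rewrite Cmult_1_r; trivial. }
  induction k as [|k IH].
  - apply (Cder_ext (fun x => RtoC x * z)%C); [intros; simpl; ring |].
    replace (RtoC (INR 1) * z * (RtoC t * z) ^ 0)%C with z by (simpl; ring). exact H1.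
  - replace (RtoC (INR (S (S k))) * z * (RtoC t * z) ^ S k)%C
      with (z * (RtoC t * z) ^ S k + RtoC t * z * (RtoC (INR (S k)) * z * (RtoC t * z) ^ k))%C.
    + apply (Cder_mult (fun x => RtoC x * z)%C (fun x => (RtoC x * z) ^ S k)%C); assumption.
    + rewrite (S_INR (S k)), RtoC_plus. simpl Cpow. ring.
Qed.

Lemma Cder_exp_psum (z : C) (N : nat) (t : R) :
  Cder (fun x => Cpsum exp_coefs (RtoC x * z) (S N)) t (z * Cpsum exp_coefs (RtoC t * z) N)%C.
Proof.
  induction N as [|N IH].
  - apply (Cder_ext (fun _ => RtoC 1)).
    + intros x; unfold exp_coefs; simpl. rewrite Rinv_1. ring.
    + replace (z * Cpsum exp_coefs (RtoC t * z) 0)%C with (RtoC 0) by (simpl; ring).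
      apply Cder_const.
  - replace (z * Cpsum exp_coefs (RtoC t * z) (S N))%C
      with (z * Cpsum exp_coefs (RtoC t * z) N
            + exp_coefs (S N) * (RtoC (INR (S N)) * z * (RtoC t * z) ^ N))%C.
    + apply (Cder_plus (fun x => Cpsum exp_coefs (RtoC x * z) (S N)) _ t _ _ IH).
      apply (Cder_scal _ (fun x => (RtoC x * z) ^ S N)%C), Cder_scaled_pow.
    + cbn [Cpsum].
      replace (exp_coefs N) with (exp_coefs (S N) * RtoC (INR (S N)))%C; [ring |].
      unfold exp_coefs. rewrite <- RtoC_mult. f_equal.
      rewrite fact_simpl, mult_INR. field.
      split; [apply not_0_INR, fact_neq_0 | apply not_0_INR; lia].
Qed.

(* Halving at each integration is cruder than [|z|^N / N!] but gives a geometric rate for free. *)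
Lemma Cexp_remainder (z : C) (N : nat) :
  Cmod (Cexp z - Cpsum exp_coefs z N)%C <= (1 / 2) ^ N * exp (2 * Cmod z).
Proof.
  set (a := Cmod z). assert (Ha : 0 <= a) by apply Cmod_ge_0.
  assert (Main : forall N t, 0 <= t ->
    Cmod (Cexp (RtoC t * z) - Cpsum exp_coefs (RtoC t * z) N)%C <= (1 / 2) ^ N * exp (2 * a * t)).
  { clear N; intros N; induction N as [|N IH]; intros t Ht.
    - cbn [Cpsum pow]. replace (Cexp (RtoC t * z) - 0)%C with (Cexp (RtoC t * z)) by ring.
      rewrite Cmod_Cexp, Rmult_1_l.
      assert (H : Re (RtoC t * z)%C <= 2 * a * t).
      { eapply Rle_trans; [apply Rle_abs |]. eapply Rle_trans; [apply re_le_Cmod |].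
        rewrite Cmod_mult, Cmod_R, Rabs_pos_eq by exact Ht. fold a. nra. }
      destruct H as [H | H]; [left; apply exp_increasing, H | rewrite H; right; reflexivity].
    - set (f := fun N x => (Cexp (RtoC x * z) - Cpsum exp_coefs (RtoC x * z) N)%C) in *.
      assert (HE : forall x, Cder (fun x => Cexp (RtoC x * z)%C) x (z * Cexp (RtoC x * z))%C).
      { intros x. apply (Cder_Cexp (fun x => RtoC x * z)%C). generalize (Cder_scaled_pow z 0 x).
        replace (RtoC (INR 1) * z * (RtoC x * z) ^ 0)%C with z by (simpl; ring).
        apply Cder_ext; intros; simpl; ring. }
      assert (Hder : forall N x, Cder (f (S N)) x (z * f N x)%C).
      { intros m x. unfold f.
        apply (Cder_ext (fun x => Cexp (RtoC x * z) + - RtoC 1 * Cpsum exp_coefs (RtoC x * z) (S m))%C).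
        { intros; ring. }
        replace (z * (Cexp (RtoC x * z) - Cpsum exp_coefs (RtoC x * z) m))%C
          with (z * Cexp (RtoC x * z) + - RtoC 1 * (z * Cpsum exp_coefs (RtoC x * z) m))%C by ring.
        apply Cder_plus; [apply HE | apply Cder_scal, Cder_exp_psum]. }
      assert (Hcont : forall m x, Ccont (f m) x).
      { intros [|m] x; [| eapply Cder_Ccont, Hder].
        unfold f; cbn [Cpsum]. apply Ccont_minus; [eapply Cder_Ccont, HE | apply Ccont_const]. }
      assert (E : f (S N) t = CRInt (fun x => z * f N x)%C 0 t).
      { rewrite (CRInt_derive (f (S N))).
        - replace (f (S N) 0) with (RtoC 0); [ring |]. unfold f.
          rewrite Cmult_0_l, Cexp_0, Cpsum_decr, Cmult_0_l.
          unfold exp_coefs; simpl. rewrite Rinv_1. ring.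
        - intros; apply Hder.
        - intros; apply Ccont_mult; [apply Ccont_const | apply Hcont]. }
      change (Cmod (f (S N) t) <= (1 / 2) ^ S N * exp (2 * a * t)). rewrite E.
      (* This is [|z|] times the bound for order [N]; its primitive [(1/2)^(N+1) exp (2 a x)]
         supplies the new factor 1/2. *)
      set (g := fun x => (1 / 2) ^ N * (a * exp (2 * a * x))).
      assert (Hg : is_RInt g 0 t ((1 / 2) ^ S N * exp (2 * a * t) - (1 / 2) ^ S N * exp (2 * a * 0))).
      { apply (is_RInt_derive (V := R_CompleteNormedModule) (fun x => (1 / 2) ^ S N * exp (2 * a * x))).
        - intros x _. unfold g. auto_derive; [trivial | simpl; field].
        - intros x _. apply (ex_derive_continuous (V := R_NormedModule)).
          unfold g; auto_derive; trivial. }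
      eapply Rle_trans; [apply (CRInt_Cmod_le _ g) |].
      + intros; apply Ccont_mult; [apply Ccont_const | apply Hcont].
      + intros x _. apply (ex_derive_continuous (V := R_NormedModule)).
        unfold g; auto_derive; trivial.
      + intros x Hx. unfold Rbetween in Hx. rewrite Rmin_left in Hx by exact Ht.
        rewrite Cmod_mult. fold a. unfold g.
        replace ((1 / 2) ^ N * (a * exp (2 * a * x))) with (a * ((1 / 2) ^ N * exp (2 * a * x))) by ring.
        apply Rmult_le_compat_l; [exact Ha |]. apply IH, Hx.
      + rewrite (is_RInt_unique _ _ _ _ Hg), Rmult_0_r, exp_0, Rmult_1_r.
        assert (H0 : 0 < (1 / 2) ^ S N) by (apply pow_lt; lra).
        assert (H1 : 1 <= exp (2 * a * t)).
        { rewrite <- exp_0. assert (H : 0 <= 2 * a * t) by nra.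
          destruct H as [H | <-]; [left; apply exp_increasing, H | right; reflexivity]. }
        rewrite Rabs_pos_eq; nra. }
  generalize (Main N 1 Rle_0_1). rewrite Rmult_1_r, Cmult_1_l. trivial.
Qed.

(** Raise [c x <= exp (c x)] to the power [n], with [c] so small that [n c <= eta]; the 1 in its
    denominator covers [n = 0]. *)
Lemma pow_le_exp (n : nat) (eta : R) :
  0 < eta -> exists K, 0 < K /\ forall x, 0 <= x -> x ^ n <= K * exp (eta * x).
Proof.
  intros He. set (c := eta / (INR n + 1)).
  assert (Hn := pos_INR n).
  assert (Hc : 0 < c) by (apply Rdiv_lt_0_compat; lra).
  exists ((/ c) ^ n); split; [apply pow_lt, Rinv_0_lt_compat, Hc |].
  intros x Hx.
  assert (H1 : x <= / c * exp (c * x)).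
  { apply Rmult_le_reg_l with c; [exact Hc |].
    replace (c * (/ c * exp (c * x))) with (exp (c * x)) by (field; lra).
    pose proof (exp_ineq1_le (c * x)); lra. }
  eapply Rle_trans; [apply pow_incr; split; [exact Hx | exact H1] |].
  rewrite Rpow_mult_distr. apply Rmult_le_compat_l; [apply pow_le; left; apply Rinv_0_lt_compat, Hc |].
  rewrite <- Rpower_pow by apply exp_pos. unfold Rpower; rewrite ln_exp.
  assert (H2 : INR n * (c * x) <= eta * x).
  { replace (eta * x) with (c * x * (INR n + 1)) by (unfold c; field; lra).
    assert (0 <= c * x) by nra. nra. }
  destruct H2 as [H2 | ->]; [left; apply exp_increasing, H2 | right; reflexivity].
Qed.

(** With [u = ln t] this bounds [exp (c |ln t|)] by [t^c + t^(-c)], covering small and large [t] at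
    once. *)
Lemma exp_Rabs_le (c u : R) : exp (c * Rabs u) <= exp (c * u) + exp (- c * u).
Proof.
  unfold Rabs; destruct Rcase_abs.
  - replace (c * - u) with (- c * u) by ring. pose proof (exp_pos (c * u)); lra.
  - pose proof (exp_pos (- c * u)); lra.
Qed.

(** * Absolutely convergent Mellin-type integrals *)

Definition mellin_itg (g : R -> C) (n : nat) (l : C) (t : R) : C :=
  (g t * cpower t (- l) * RtoC (ln t ^ n))%C.

Lemma mellin_itg_Ccont (g : R -> C) (n : nat) (l : C) (t : R) :
  0 < t -> Ccont g t -> Ccont (mellin_itg g n l) t.
Proof.
  intros Ht Hg. apply (Ccont_mult (fun t => g t * cpower t (- l))%C).
  - apply Ccont_mult; [exact Hg | apply Ccont_cpower, Ht].
  - apply Ccont_RtoC, continuous_ln_pow, Ht.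
Qed.

Section AbsoluteConvergence.

(* [F] approaches the free endpoint of the integrals [int_b^x] inside the interval [D]; [Q] is
   the open set of exponents [q] for which [int t^(p-q)] converges there. *)
Context (F : (R -> Prop) -> Prop) {FF : ProperFilter F}.
Context (D : R -> Prop) (b : R) (g : R -> C) (M p : R) (Q : R -> Prop).
Hypothesis D_pos : forall t, D t -> 0 < t.
Hypothesis D_conv : forall x y t, D x -> D y -> Rbetween x y t -> D t.
Hypothesis D_b : D b.
Hypothesis D_F : F D.
Hypothesis g_cont : forall t, D t -> Ccont g t.
Hypothesis g_bound : forall t, D t -> Cmod (g t) <= M * Rpower t p.
Hypothesis Q_open : forall q, Q q -> exists e, 0 < e /\ forall q', Rabs (q' - q) <= e -> Q q'.
Hypothesis Q_conv : forall q, Q q ->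
  exists L, filterlim (fun x => RInt (fun t => Rpower t (p - q)) b x) F (locally L).

Lemma ex_RInt_Rpower (c x y : R) : D x -> D y -> ex_RInt (fun t => Rpower t c) x y.
Proof.
  intros Hx Hy. apply (ex_RInt_continuous (V := R_CompleteNormedModule)).
  intros t Ht; apply continuous_Rpower, D_pos, (D_conv x y t Hx Hy Ht).
Qed.

(** Increments of [CRInt h b] are at most [B] times increments of [Psi], the primitive of the two
    dominating powers, and [Psi] converges; Cauchy's criterion applies. [P] comes from an eventual
    bound on [Psi] alone, so it is fixed before [h], and the bound [B * P] can tend to 0 along a
    sequence of functions [h]. *)
Lemma dominated_limit (q e : R) :
  Q (q - e) -> Q (q + e) ->
  exists P, 0 <= P /\ forall (h : R -> C) (B : R), 0 <= B ->
    (forall t, D t -> Ccont h t) ->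
    (forall t, D t -> Cmod (h t) <= B * (Rpower t (p - (q - e)) + Rpower t (p - (q + e)))) ->
    exists v, Clim F (CRInt h b) v /\ Cmod v <= B * P.
Proof.
  intros H1 H2. destruct (Q_conv _ H1) as [L1 HL1]; destruct (Q_conv _ H2) as [L2 HL2].
  set (c1 := p - (q - e)) in *; set (c2 := p - (q + e)) in *.
  set (Psi := fun x => RInt (fun t => Rpower t c1) b x + RInt (fun t => Rpower t c2) b x).
  assert (HPsi : Clim F (fun x => RtoC (Psi x)) (RtoC (L1 + L2))).
  { apply (Clim_ext F (fun x => RtoC (RInt (fun t => Rpower t c1) b x)
                                + RtoC (RInt (fun t => Rpower t c2) b x))%C).
    - intros x; unfold Psi; rewrite RtoC_plus; reflexivity.
    - rewrite RtoC_plus. clim Clim_plus; clim RtoC_lim; assumption. }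
  exists (Cmod (RtoC (L1 + L2)) + 1); split.
  { pose proof (Cmod_ge_0 (RtoC (L1 + L2))); lra. }
  intros h B HB Hh Hle.
  assert (Hxy : forall x y, D x -> D y -> Cmod (CRInt h x y) <= B * Rabs (Psi y - Psi x)).
  { intros x y Hx Hy.
    assert (E : RInt (fun t => B * (Rpower t c1 + Rpower t c2)) x y = B * (Psi y - Psi x)).
    { apply is_RInt_unique. apply (is_RInt_scal (V := R_NormedModule)).
      replace (Psi y - Psi x) with (RInt (fun t => Rpower t c1) x y + RInt (fun t => Rpower t c2) x y).
      - apply (is_RInt_plus (V := R_NormedModule));
          apply (RInt_correct (V := R_CompleteNormedModule)), ex_RInt_Rpower; assumption.
      - unfold Psi.
        rewrite <- (RInt_Chasles (V := R_CompleteNormedModule) (fun t => Rpower t c1) b x y)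
          by (apply ex_RInt_Rpower; assumption).
        rewrite <- (RInt_Chasles (V := R_CompleteNormedModule) (fun t => Rpower t c2) b x y)
          by (apply ex_RInt_Rpower; assumption).
        unfold plus; simpl; ring. }
    rewrite <- (Rabs_pos_eq B HB) at 1. rewrite <- Rabs_mult, <- E.
    apply CRInt_Cmod_le.
    - intros t Ht; apply Hh, (D_conv x y t Hx Hy Ht).
    - intros t Ht.
      apply (continuous_scal_r (V := R_NormedModule) B (fun t => Rpower t c1 + Rpower t c2)).
      apply (continuous_plus (V := R_NormedModule));
        apply continuous_Rpower, D_pos, (D_conv x y t Hx Hy Ht).
    - intros t Ht; apply Hle, (D_conv x y t Hx Hy Ht). }
  destruct (Clim_cauchy F (CRInt h b)) as [v Hv].
  - intros eps Heps.
    assert (He : 0 < eps / (2 * (B + 1))) by (apply Rdiv_lt_0_compat; lra).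
    exists (fun x => D x /\ Cmod (RtoC (Psi x) - RtoC (L1 + L2))%C < eps / (2 * (B + 1))).
    split; [apply filter_and; [exact D_F |] |].
    { apply (proj1 (Clim_Cmod F _ _) HPsi _ He). }
    intros x y [Hx Hx'] [Hy Hy'].
    replace (CRInt h b y - CRInt h b x)%C with (CRInt h x y).
    + eapply Rle_lt_trans; [apply Hxy; assumption |].
      rewrite <- RtoC_minus, Cmod_R in Hx', Hy'.
      replace (Psi y - Psi x) with ((Psi y - (L1 + L2)) - (Psi x - (L1 + L2))) by ring.
      assert (Ht := Rabs_triang (Psi y - (L1 + L2)) (- (Psi x - (L1 + L2)))).
      rewrite Rabs_Ropp in Ht.
      apply Rle_lt_trans with (B * (2 * (eps / (2 * (B + 1))))).
      { apply Rmult_le_compat_l; [exact HB | unfold Rminus in *; lra]. }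
      replace (B * (2 * (eps / (2 * (B + 1))))) with (eps * (B / (B + 1))) by (field; lra).
      rewrite <- (Rmult_1_r eps) at 2. apply Rmult_lt_compat_l; [exact Heps |].
      apply Rlt_div_l; lra.
    + rewrite <- (CRInt_Chasles h b x y); [ring | |];
        intros t Ht; apply Hh; eapply D_conv; try exact Ht; assumption.
  - exists v; split; [exact Hv |].
    apply (Clim_Cmod_le F (CRInt h b)); [| exact Hv].
    generalize (filter_and _ _ D_F (Clim_bounded F _ _ HPsi)); apply filter_imp.
    intros x [Hx Hb]. eapply Rle_trans; [apply Hxy; assumption |].
    apply Rmult_le_compat_l; [exact HB |]. rewrite Cmod_R in Hb.
    replace (Psi b) with 0; [rewrite Rminus_0_r; exact Hb |].
    unfold Psi; rewrite !(RInt_point (V := R_CompleteNormedModule)); unfold zero; simpl; ring.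
Qed.

(** [|ln t|^n] costs a factor [K exp (e/2 |ln t|)], and the exponential remainder costs
    [(1/2)^N exp (2 |w| |ln t|)], which is at most [(1/2)^N exp (e/2 |ln t|)] because
    [|w| <= e / 4]. Together they give [exp (e |ln t|) <= t^e + t^(-e)]. *)
Lemma mellin_itg_remainder_bound (n : nat) (e : R) :
  0 < e -> exists K, 0 < K /\ forall (l w : C) (N : nat) (t : R), D t -> Cmod w <= e / 4 ->
    Cmod (mellin_itg g n l t *
          (Cexp (- w * RtoC (ln t)) - Cpsum exp_coefs (- w * RtoC (ln t)) N))%C
    <= M * (1 / 2) ^ N * K * (Rpower t (p - (Re l - e)) + Rpower t (p - (Re l + e))).
Proof.
  intros He. destruct (pow_le_exp n (e / 2)) as [K [HK HKle]]; [lra |].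
  exists K; split; [exact HK |]. intros l w N t Ht Hw.
  pose proof (D_pos t Ht) as Htp. set (u := ln t).
  assert (HM : 0 <= M * Rpower t p).
  { eapply Rle_trans; [apply Cmod_ge_0 | apply (g_bound t Ht)]. }
  unfold mellin_itg. rewrite !Cmod_mult, Cmod_cpower, Cmod_R, <- RPow_abs. fold u.
  assert (HE : Cmod (Cexp (- w * RtoC u) - Cpsum exp_coefs (- w * RtoC u) N)%C
               <= (1 / 2) ^ N * exp (e / 2 * Rabs u)).
  { eapply Rle_trans; [apply Cexp_remainder |].
    apply Rmult_le_compat_l; [apply pow_le; lra |].
    rewrite Cmod_mult, Cmod_opp, Cmod_R. pose proof (Rabs_pos u).
    assert (H1 : 2 * (Cmod w * Rabs u) <= e / 2 * Rabs u) by nra.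
    destruct H1 as [H1 | ->]; [left; apply exp_increasing, H1 | right; reflexivity]. }
  apply Rle_trans with
    (M * Rpower t p * Rpower t (Re (- l)%C) * (K * exp (e / 2 * Rabs u)) * ((1 / 2) ^ N * exp (e / 2 * Rabs u))).
  { assert (HR : 0 <= Rpower t (Re (- l)%C)) by (apply Rlt_le, exp_pos).
    apply Rmult_le_compat; [| apply Cmod_ge_0 | | exact HE].
    { repeat apply Rmult_le_pos; try apply Cmod_ge_0; [exact HR | apply pow_le, Rabs_pos]. }
    apply Rmult_le_compat.
    - apply Rmult_le_pos; [apply Cmod_ge_0 | exact HR].
    - apply pow_le, Rabs_pos.
    - apply Rmult_le_compat_r; [exact HR | apply g_bound, Ht].
    - apply HKle, Rabs_pos. }
  replace (p - (Re l - e)) with (p + Re (- l)%C + e) by (unfold Re; simpl; ring).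
  replace (p - (Re l + e)) with (p + Re (- l)%C + - e) by (unfold Re; simpl; ring).
  rewrite !(Rpower_plus _ _ t), <- Rmult_plus_distr_l.
  replace (M * Rpower t p * Rpower t (Re (- l)%C) * (K * exp (e / 2 * Rabs u)) *
           ((1 / 2) ^ N * exp (e / 2 * Rabs u)))
    with (M * Rpower t p * (Rpower t (Re (- l)%C) * (K * (1 / 2) ^ N)) * exp (e * Rabs u)).
  - replace (M * (1 / 2) ^ N * K * (Rpower t p * Rpower t (Re (- l)%C) * (Rpower t e + Rpower t (- e))))
      with (M * Rpower t p * (Rpower t (Re (- l)%C) * (K * (1 / 2) ^ N)) * (Rpower t e + Rpower t (- e)))
      by ring.
    apply Rmult_le_compat_l; [| apply exp_Rabs_le].
    apply Rmult_le_pos; [exact HM |]. apply Rmult_le_pos; [apply Rlt_le, exp_pos |].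
    apply Rmult_le_pos; [lra | apply pow_le; lra].
  - replace (e * Rabs u) with (e / 2 * Rabs u + e / 2 * Rabs u) by field.
    rewrite exp_plus; ring.
Qed.

Lemma M_ge_0 : 0 <= M.
Proof.
  apply Rmult_le_reg_r with (Rpower b p); [apply exp_pos |]. rewrite Rmult_0_l.
  eapply Rle_trans; [apply Cmod_ge_0 | apply (g_bound b D_b)].
Qed.

Lemma Q_margin (q : R) : Q q -> exists e, 0 < e /\ Q (q - e) /\ Q (q + e).
Proof.
  intros Hq. destruct (Q_open q Hq) as [e [He H]]. exists e; split; [exact He |].
  split; apply H; [replace (q - e - q) with (- e) by ring; rewrite Rabs_Ropp |
                   replace (q + e - q) with e by ring]; rewrite Rabs_pos_eq; lra.
Qed.

Lemma mellin_itg_limit (n : nat) (l : C) :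
  Q (Re l) -> exists v, Clim F (CRInt (mellin_itg g n l) b) v.
Proof.
  intros Hl. destruct (Q_margin _ Hl) as [e [He [H1 H2]]].
  destruct (dominated_limit _ _ H1 H2) as [P [HP Hdom]].
  destruct (mellin_itg_remainder_bound n e He) as [K [HK HKle]].
  destruct (Hdom (mellin_itg g n l) (M * (1 / 2) ^ 0 * K)) as [v [Hv _]];
    [| | | exists v; exact Hv].
  - pose proof M_ge_0. simpl; nra.
  - intros t Ht; apply mellin_itg_Ccont; [apply D_pos | apply g_cont]; exact Ht.
  (* For [w = 0] and [N = 0] the remainder factor is [exp 0 = 1], and the bound is one for the
     integrand itself. *)
  - intros t Ht. generalize (HKle l (RtoC 0) O t Ht).
    rewrite Cmod_0. cbn [Cpsum].
    replace (- RtoC 0 * RtoC (ln t))%C with (RtoC 0) by ring. rewrite Cexp_0.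
    replace (mellin_itg g n l t * (1 - 0))%C with (mellin_itg g n l t) by ring.
    intros H; apply H; lra.
Qed.

(** Expanding [t^(-w)] under the integral turns powers of [w] into powers of [ln t]: the Taylor
    coefficients of [H n] at [l1] are, up to signs and factorials, the values [H (n + j) l1]. This
    is why one [H] is produced for all [n]. *)
Lemma mellin_transform :
  exists H : nat -> C -> C, forall n l, Q (Re l) ->
    Clim F (CRInt (mellin_itg g n l) b) (H n l) /\ analytic_at (H n) l.
Proof.
  (* Choice picks the limit at each [l], giving a function that does not depend on the point where
     analyticity is tested. *)
  set (H := fun n l => epsilon (inhabits (RtoC 0)) (fun v => Clim F (CRInt (mellin_itg g n l) b) v)).
  assert (HH : forall n l, Q (Re l) -> Clim F (CRInt (mellin_itg g n l) b) (H n l)).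
  { intros n l Hl. unfold H. apply epsilon_spec, mellin_itg_limit, Hl. }
  exists H; intros n l1 Hl1; split; [apply HH, Hl1 |].
  destruct (Q_margin _ Hl1) as [e [He [H1 H2]]].
  destruct (Q_open _ Hl1) as [e' [He' Hnear]].
  destruct (dominated_limit _ _ H1 H2) as [P [HP Hdom]].
  destruct (mellin_itg_remainder_bound n e He) as [K [HK HKle]].
  set (a := fun j => (exp_coefs j * (- RtoC 1) ^ j * H (n + j)%nat l1)%C).
  apply (analytic_at_intro _ _ a (Rmin (e / 4) e')); [apply Rmin_pos; lra |].
  intros l Hl. set (w := (l - l1)%C) in *.
  assert (Hw := Rlt_le_trans _ _ _ Hl (Rmin_l _ _)).
  assert (Hw' := Rlt_le_trans _ _ _ Hl (Rmin_r _ _)).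
  assert (Hql : Q (Re l)).
  { apply Hnear. eapply Rle_trans; [| apply Rlt_le, Hw'].
    replace (Re l - Re l1) with (Re w) by (unfold w, Re; simpl; ring). apply re_le_Cmod. }
  set (S := fun N t => (mellin_itg g n l1 t * Cpsum exp_coefs (- w * RtoC (ln t)) N)%C).
  assert (HS : forall N t, D t -> Ccont (S N) t).
  { intros N t Ht. apply Ccont_mult.
    - apply mellin_itg_Ccont; [apply D_pos | apply g_cont]; exact Ht.
    - apply (Ccont_Cpsum exp_coefs (fun t => - w * RtoC (ln t))%C).
      apply Ccont_mult; [apply Ccont_const |]. apply Ccont_RtoC.
      apply (ex_derive_continuous (V := R_NormedModule)). auto_derive. apply D_pos, Ht. }
  (* Finite sums commute with the limit along [F], so the integral of the truncated expansion tends
     to the partial sum of the Taylor series. *)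
  assert (Hlim : forall N, Clim F (CRInt (S N) b) (Cpsum a w N)).
  { intros N; induction N as [|N IH].
    - apply (Clim_ext F (fun _ => RtoC 0)); [| clim Clim_const].
      intros x. rewrite (CRInt_ext _ (fun _ => RtoC 0 * RtoC 0)%C).
      + rewrite (CRInt_scal 0 (fun _ => RtoC 0)); [ring | intros; apply Ccont_const].
      + intros; unfold S; cbn [Cpsum]; ring.
    - cbn [Cpsum].
      apply (Clim_ext_loc F (fun x => CRInt (S N) b x +
        exp_coefs N * (- RtoC 1) ^ N * w ^ N * CRInt (mellin_itg g (n + N) l1) b x)%C).
      + revert D_F; apply filter_imp; intros x Hx.
        assert (Hg' : forall t, Rbetween b x t -> Ccont (mellin_itg g (n + N) l1) t).
        { intros t Ht; assert (Dt := D_conv b x t D_b Hx Ht).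
          apply mellin_itg_Ccont; [apply D_pos | apply g_cont]; exact Dt. }
        rewrite <- CRInt_scal, <- CRInt_plus; [| | | exact Hg'].
        * apply CRInt_ext; intros t _. unfold S, mellin_itg; cbn [Cpsum].
          rewrite pow_add, RtoC_mult.
          replace (- w * RtoC (ln t))%C with ((- RtoC 1) * w * RtoC (ln t))%C by ring.
          rewrite !Cpow_mult_l, !RtoC_pow. ring.
        * intros t Ht; apply HS, (D_conv b x t D_b Hx Ht).
        * intros t Ht; apply Ccont_mult; [apply Ccont_const | apply Hg', Ht].
      + clim Clim_plus; [exact IH |].
        replace (a N * w ^ N)%C
          with (exp_coefs N * (- RtoC 1) ^ N * w ^ N * H (n + N)%nat l1)%C by (unfold a; ring).
        clim Clim_mult; [clim Clim_const | apply HH, Hl1]. }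
  (* The integral of the remainder tends to [H n l - Cpsum a w N], and [dominated_limit] bounds this
     limit with the same [P] for every [N]. *)
  assert (Hrem : forall N, Cmod (Cpsum a w N - H n l)%C <= M * K * P * (1 / 2) ^ N).
  { intros N.
    destruct (Hdom (fun t => mellin_itg g n l1 t *
       (Cexp (- w * RtoC (ln t)) - Cpsum exp_coefs (- w * RtoC (ln t)) N))%C (M * (1 / 2) ^ N * K))
      as [v [Hv Hvle]].
    - apply Rmult_le_pos; [apply Rmult_le_pos; [apply M_ge_0 | apply pow_le; lra] | lra].
    - intros t Ht.
      assert (Hc : Ccont (fun t => mellin_itg g n l t - S N t)%C t).
      { apply Ccont_minus; [| apply HS, Ht].
        apply mellin_itg_Ccont; [apply D_pos | apply g_cont]; exact Ht. }
      revert Hc. unfold Ccont, continuous.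
      match goal with |- filterlim ?f _ (locally ?u) -> filterlim ?h _ (locally ?v) =>
        assert (E : forall t, f t = h t) end.
      { intros s; unfold S, mellin_itg.
        replace (- l)%C with (- l1 + - w)%C by (unfold w; ring).
        rewrite cpower_plus. unfold cpower. ring. }
      cbv beta in E. rewrite <- (E t). apply filterlim_ext; exact E.
    - intros t Ht. apply HKle; [exact Ht | lra].
    - assert (Ev : v = (H n l - Cpsum a w N)%C).
      { apply (Clim_unique F _ _ _ Hv).
        apply (Clim_ext_loc F (fun x => CRInt (mellin_itg g n l) b x + - RtoC 1 * CRInt (S N) b x)%C).
        - revert D_F; apply filter_imp; intros x Hx.
          assert (Dt : forall t, Rbetween b x t -> D t) by (intros t; apply D_conv; assumption).
          assert (Hc : forall t, Rbetween b x t -> Ccont (mellin_itg g n l) t).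
          { intros t Ht. apply mellin_itg_Ccont; [apply D_pos | apply g_cont]; apply Dt, Ht. }
          rewrite <- CRInt_scal, <- CRInt_plus.
          + apply CRInt_ext; intros t _. unfold S, mellin_itg.
            replace (- l)%C with (- l1 + - w)%C by (unfold w; ring).
            rewrite cpower_plus. unfold cpower. ring.
          + exact Hc.
          + intros t Ht; apply Ccont_mult; [apply Ccont_const | apply HS, Dt, Ht].
          + intros t Ht; apply HS, Dt, Ht.
        - replace (H n l - Cpsum a w N)%C with (H n l + - RtoC 1 * Cpsum a w N)%C by ring.
          clim Clim_plus; [apply HH, Hql |]. clim Clim_mult; [clim Clim_const | apply Hlim]. }
      replace (Cpsum a w N - H n l)%C with (- v)%C by (rewrite Ev; ring).
      rewrite Cmod_opp. eapply Rle_trans; [exact Hvle | right; ring]. }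
  unfold Cpseries. apply (Clim_ext eventually (fun N => (Cpsum a w N - H n l) + H n l)%C);
    [intros; ring |].
  rewrite <- (Cplus_0_l (H n l)) at 1. clim Clim_plus; [| clim Clim_const].
  apply (Clim_zero_le eventually _ (fun N => M * K * P * (1 / 2) ^ N)).
  - exists O; intros N _; apply Hrem.
  - change (is_lim_seq (fun N => M * K * P * (1 / 2) ^ N) (Finite 0)).
    replace (Finite 0) with (Rbar_mult (M * K * P) 0) by (simpl; f_equal; ring).
    apply is_lim_seq_scal_l, is_lim_seq_geom. rewrite Rabs_pos_eq; lra.
Qed.

End AbsoluteConvergence.

(** * Logarithmic monomials and their primitives *)

(** This convention makes a pole term vanish at the pole, which is its share in the regularized
    value. *)
Lemma Cinv_0 : (/ RtoC 0)%C = 0.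
Proof. unfold Cinv; apply injective_projections; simpl; unfold Rdiv; ring. Qed.

Lemma at_right_0_lt (c : R) : 0 < c -> at_right 0 (fun x => 0 < x < c).
Proof.
  intros Hc. exists (mkposreal c Hc). intros y Hy Hy0.
  change (Rabs (y - 0) < c) in Hy. rewrite Rminus_0_r in Hy.
  apply Rabs_def2 in Hy. lra.
Qed.

Lemma Rpower_lim_0 (c : R) : 0 < c -> filterlim (fun t => Rpower t c) (at_right 0) (locally 0).
Proof.
  intros Hc. apply filterlim_locally. intros eps.
  generalize (at_right_0_lt (Rpower eps (/ c)) (exp_pos _)). apply filter_imp.
  intros t [Ht0 Ht]. change (Rabs (Rpower t c - 0) < eps).
  rewrite Rminus_0_r, Rabs_pos_eq by (apply Rlt_le, exp_pos).
  replace (pos eps) with (Rpower (Rpower eps (/ c)) c).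
  - apply Rlt_Rpower_l; [exact Hc | split; assumption].
  - rewrite Rpower_mult, Rinv_l by lra. apply Rpower_1, cond_pos.
Qed.

Lemma Rpower_lim_p_infty (c : R) :
  c < 0 -> filterlim (fun t => Rpower t c) (Rbar_locally p_infty) (locally 0).
Proof.
  intros Hc. apply filterlim_locally. intros eps.
  exists (Rmax 1 (Rpower eps (/ c))). intros t Ht.
  assert (H1 := Rle_lt_trans _ _ _ (Rmax_l _ _) Ht).
  assert (H2 := Rle_lt_trans _ _ _ (Rmax_r _ _) Ht).
  change (Rabs (Rpower t c - 0) < eps).
  rewrite Rminus_0_r, Rabs_pos_eq by (apply Rlt_le, exp_pos).
  rewrite <- (Rpower_1 eps (cond_pos eps)), <- (Rinv_l c) by lra.
  rewrite <- Rpower_mult.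
  replace c with (- - c) at 1 3 by ring. rewrite !(Rpower_Ropp _ (- c)).
  apply Rinv_lt_contravar; [apply Rmult_lt_0_compat; apply exp_pos |].
  apply Rlt_Rpower_l; [lra | split; [apply exp_pos | exact H2]].
Qed.

Lemma is_derive_Rpower (c t : R) :
  0 < t -> is_derive (fun x => Rpower x c) t (c * Rpower t (c - 1)).
Proof.
  intros Ht. unfold Rpower. auto_derive; [exact Ht |].
  replace ((c - 1) * ln t) with (c * ln t + - ln t) by ring.
  rewrite exp_plus, exp_Ropp, exp_ln by exact Ht. field; lra.
Qed.

Lemma RInt_Rpower (c x y : R) :
  c + 1 <> 0 -> 0 < x -> 0 < y ->
  RInt (fun t => Rpower t c) x y = / (c + 1) * (Rpower y (c + 1) - Rpower x (c + 1)).
Proof.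
  intros Hc Hx Hy. apply is_RInt_unique.
  replace (/ (c + 1) * (Rpower y (c + 1) - Rpower x (c + 1)))
    with (minus (/ (c + 1) * Rpower y (c + 1)) (/ (c + 1) * Rpower x (c + 1)))
    by (unfold minus, plus, opp; simpl; ring).
  assert (Hpos : forall t, Rmin x y <= t <= Rmax x y -> 0 < t).
  { intros t [Ht _]; eapply Rlt_le_trans; [apply Rmin_pos; [exact Hx | exact Hy] | exact Ht]. }
  apply (is_RInt_derive (V := R_CompleteNormedModule) (fun t => / (c + 1) * Rpower t (c + 1))).
  - intros t Ht.
    replace (Rpower t c) with (/ (c + 1) * ((c + 1) * Rpower t (c + 1 - 1))).
    + apply (is_derive_scal (fun t => Rpower t (c + 1))), is_derive_Rpower, Hpos, Ht.
    + replace (c + 1 - 1) with c by ring. field; exact Hc.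
  - intros t Ht; apply continuous_Rpower, Hpos, Ht.
Qed.

Lemma Cmod_eps_monomial (p : C) (m : nat) (t : R) :
  Cmod (eps_monomial p m t) = Rpower t (Re p) * Rabs (ln t) ^ m.
Proof.
  unfold eps_monomial. rewrite Cmod_mult, Cmod_cpower, Cmod_R, RPow_abs. reflexivity.
Qed.

(** Half of the exponent absorbs the logarithms, [|ln t|^m <= K t^(- Re p / 2)] for [t < 1], and the
    other half still tends to 0. *)
Lemma eps_monomial_lim_0 (p : C) (m : nat) :
  0 < Re p -> Clim (at_right 0) (eps_monomial p m) 0.
Proof.
  intros Hp. destruct (pow_le_exp m (Re p / 2)) as [K [HK HKle]]; [lra |].
  apply (Clim_zero_le (at_right 0) _ (fun t => K * Rpower t (Re p / 2))).
  - generalize (at_right_0_lt 1 Rlt_0_1); apply filter_imp; intros t Ht.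
    rewrite Cmod_eps_monomial.
    assert (Hln : ln t < 0) by (rewrite <- ln_1; apply ln_increasing; lra).
    rewrite Rabs_left by exact Hln.
    eapply Rle_trans; [apply Rmult_le_compat_l; [apply Rlt_le, exp_pos |] |].
    + apply HKle; lra.
    + unfold Rpower. right.
      replace (Re p * ln t) with (Re p / 2 * ln t + Re p / 2 * ln t) by field.
      rewrite exp_plus. replace (Re p / 2 * - ln t) with (- (Re p / 2 * ln t)) by ring.
      rewrite exp_Ropp. field. apply Rgt_not_eq, exp_pos.
  - assert (Hf : filterlim (fun t => K * Rpower t (Re p / 2)) (at_right 0) (locally (K * 0))).
    { apply (filterlim_comp _ _ _ (fun t => Rpower t (Re p / 2)) (fun y => K * y) _ (locally 0)).
      - apply Rpower_lim_0; lra.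
      - apply (filterlim_scal_r (V := R_NormedModule) K 0). }
    rewrite Rmult_0_r in Hf; exact Hf.
Qed.

Lemma exp_opp_at_right : filterlim (fun u => exp (- u)) (Rbar_locally p_infty) (at_right 0).
Proof.
  intros P [e He]. exists (- ln e). intros u Hu.
  apply He; [| apply exp_pos].
  change (Rabs (exp (- u) - 0) < e). rewrite Rminus_0_r, Rabs_pos_eq by (apply Rlt_le, exp_pos).
  rewrite <- (exp_ln e (cond_pos e)). apply exp_increasing; lra.
Qed.

(** Put [eps = exp (- u)]. The modulus becomes [exp (- Re p u) u^m], which grows at least linearly
    if [Re p < 0] or [m > 0], against the boundedness of a convergent function. If [Re p = 0] and
    [m = 0], the modulus is 1 and only the phase turns. *)
Lemma eps_monomial_divergent (p : C) (m : nat) :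
  Re p <= 0 -> (p <> 0 \/ (0 < m)%nat) -> divergent_monomial p m.
Proof.
  intros Hp Hpm [v Hv].
  assert (HG : Clim (Rbar_locally p_infty) (fun u => eps_monomial p m (exp (- u))) v).
  { eapply filterlim_comp; [apply exp_opp_at_right | exact Hv]. }
  clear Hv. set (G := fun u => eps_monomial p m (exp (- u))) in HG.
  assert (HGmod : forall u, Cmod (G u) = exp (- Re p * u) * Rabs u ^ m).
  { intros u; unfold G. rewrite Cmod_eps_monomial. unfold Rpower. rewrite ln_exp, Rabs_Ropp.
    do 2 f_equal; ring. }
  assert (Hub : forall c, 0 < c -> ~ Rbar_locally p_infty (fun u => c * u <= Cmod (G u))).
  { intros c Hc Hle.
    assert (Hlarge : Rbar_locally p_infty (fun u => (Cmod v + 1) / c < u))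
      by (exists ((Cmod v + 1) / c); trivial).
    destruct (filter_ex _ (filter_and _ _ Hlarge
               (filter_and _ _ Hle (Clim_bounded (Rbar_locally p_infty) _ _ HG))))
      as [u [H1 [H2 H3]]].
    apply Rlt_div_l in H1; [| exact Hc]. lra. }
  assert (Hlarge1 : Rbar_locally p_infty (fun u => 1 < u)) by (exists 1; trivial).
  destruct Hp as [Hp | Hp].
  - apply (Hub (- Re p)); [lra |]. revert Hlarge1; apply filter_imp; intros u Hu.
    rewrite HGmod. rewrite Rabs_pos_eq by lra.
    pose proof (exp_ineq1_le (- Re p * u)).
    assert (1 <= u ^ m) by (apply pow_R1_Rle; lra).
    assert (0 <= exp (- Re p * u)) by (apply Rlt_le, exp_pos). nra.
  - destruct m as [|m].
    + destruct Hpm as [Hp0 | Hm]; [| lia].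
      assert (HIm : Im p <> 0).
      { intros HIm; apply Hp0. apply injective_projections; [exact Hp | exact HIm]. }
      (* Half a period of the phase: translation by [T] changes the sign of [G], so its limit would
         be 0 although [|G| = 1]. *)
      set (T := PI / Im p).
      assert (Hper : forall u, G (u + T) = (- G u)%C).
      { intros u; unfold G, eps_monomial, cpower. rewrite !ln_exp.
        replace (p * RtoC (- (u + T)))%C with (p * RtoC (- u) + ((0, - PI)%R : C))%C.
        - rewrite Cexp_plus. unfold Cexp at 2; simpl. rewrite exp_0, cos_neg, sin_neg, cos_PI, sin_PI.
          apply injective_projections; simpl; ring.
        - unfold Re, Im in *; apply injective_projections; simpl; unfold T; simpl.
          + rewrite Hp; ring.
          + rewrite Hp; field; exact HIm. }
      assert (HGT : Clim (Rbar_locally p_infty) (fun u => G (u + T)) v).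
      { eapply filterlim_comp; [| exact HG]. intros P [B HB].
        exists (B - T). intros u Hu; apply HB; lra. }
      assert (HGn : Clim (Rbar_locally p_infty) (fun u => G (u + T)) (- RtoC 1 * v)%C).
      { apply (Clim_ext (Rbar_locally p_infty) (fun u => - RtoC 1 * G u)%C).
        - intros u; rewrite Hper; ring.
        - clim Clim_mult; [clim Clim_const | exact HG]. }
      assert (Ev := Clim_unique (Rbar_locally p_infty) _ _ _ HGT HGn).
      assert (Hv0 : v = 0).
      { replace v with ((v - - RtoC 1 * v) * RtoC (/ 2))%C; [rewrite <- Ev; ring |].
        apply injective_projections; simpl; field. }
      assert (Hone := proj1 (Clim_Cmod (Rbar_locally p_infty) _ _) HG 1 Rlt_0_1).
      destruct (filter_ex _ Hone) as [u Hu]. rewrite Hv0 in Hu.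
      replace (G u - 0)%C with (G u) in Hu by ring.
      rewrite HGmod, Hp, Ropp_0, Rmult_0_l, exp_0 in Hu; simpl in Hu. lra.
    + apply (Hub 1 Rlt_0_1). revert Hlarge1; apply filter_imp; intros u Hu.
      rewrite HGmod, Hp, Ropp_0, Rmult_0_l, exp_0, Rabs_pos_eq by lra. simpl.
      assert (1 <= u ^ m) by (apply pow_R1_Rle; lra). nra.
Qed.

(* Terms of the primitive of [t^(s-1) ln^n t] without constant term, for [s <> 0] by repeated
   integration by parts. *)
Fixpoint log_primitive_terms (n : nat) (s : C) : list (C * (C * nat)) :=
  match n with
  | O => ((/ s)%C, (s, O)) :: nil
  | S m => ((/ s)%C, (s, S m)) ::
           map (fun e => (- (RtoC (INR (S m)) / s) * fst e, snd e)%C) (log_primitive_terms m s)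
  end.

Definition log_primitive_list (n : nat) (s : C) : list (C * (C * nat)) :=
  if Ceq_dec s 0 then (RtoC (/ INR (S n)), (RtoC 0, S n)) :: nil else log_primitive_terms n s.

(** Keeping the primitive as a list of monomials lets the same object be differentiated and be
    handed over as the divergent part of an integral. *)
Definition log_primitive (n : nat) (s : C) (t : R) : C := divergent_sum (log_primitive_list n s) t.

Lemma divergent_sum_scal (a : C) (L : list (C * (C * nat))) (t : R) :
  divergent_sum (map (fun e => (a * fst e, snd e)%C) L) t = (a * divergent_sum L t)%C.
Proof.
  induction L as [|e L IH]; [symmetry; apply Cmult_0_r |].
  unfold divergent_sum in *. simpl. rewrite IH. simpl. ring.
Qed.

Lemma divergent_sum_app (L L' : list (C * (C * nat))) (t : R) :
  divergent_sum (L ++ L') t = (divergent_sum L t + divergent_sum L' t)%C.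
Proof.
  induction L as [|e L IH]; [symmetry; apply Cplus_0_l |].
  unfold divergent_sum in *. simpl. rewrite IH. ring.
Qed.

Lemma log_primitive_terms_S (n : nat) (s : C) (t : R) :
  divergent_sum (log_primitive_terms (S n) s) t =
  (/ s * eps_monomial s (S n) t
   + - (RtoC (INR (S n)) / s) * divergent_sum (log_primitive_terms n s) t)%C.
Proof. rewrite <- divergent_sum_scal. reflexivity. Qed.

Lemma Cder_eps_monomial (p : C) (m : nat) (t : R) :
  0 < t -> Cder (eps_monomial p m) t
    (p * cpower t (p - 1) * RtoC (ln t ^ m)
     + cpower t p * RtoC (INR m * ln t ^ pred m / t))%C.
Proof.
  intros Ht. apply (Cder_mult (fun t => cpower t p) (fun t => RtoC (ln t ^ m))).
  - apply Cder_cpower, Ht.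
  - apply Cder_RtoC. auto_derive; [exact Ht | field; lra].
Qed.

Lemma cpower_minus_1 (t : R) (s : C) : 0 < t -> cpower t (s - 1)%C = (cpower t s * RtoC (/ t))%C.
Proof.
  intros Ht. unfold Cminus. rewrite cpower_plus, cpower_opp, cpower_1 by exact Ht.
  rewrite RtoC_inv by lra. reflexivity.
Qed.

Lemma Cder_log_primitive (n : nat) (s : C) (t : R) :
  0 < t -> Cder (log_primitive n s) t (cpower t (s - 1) * RtoC (ln t ^ n))%C.
Proof.
  intros Ht. unfold log_primitive, log_primitive_list.
  assert (Hsum : forall c p m, divergent_sum ((c, (p, m)) :: nil) = (fun t => c * eps_monomial p m t)%C).
  { intros; apply functional_extensionality; intros x; unfold divergent_sum; simpl; ring. }
  destruct (Ceq_dec s 0) as [-> | Hs].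
  - rewrite Hsum.
    replace (cpower t (0 - 1) * RtoC (ln t ^ n))%C with (RtoC (/ INR (S n)) *
      (0 * cpower t (0 - 1) * RtoC (ln t ^ S n) + cpower t 0 * RtoC (INR (S n) * ln t ^ pred (S n) / t)))%C.
    + apply Cder_scal, Cder_eps_monomial, Ht.
    + rewrite cpower_minus_1, cpower_0 by exact Ht.
      replace (INR (S n) * ln t ^ pred (S n) / t) with (INR (S n) * (ln t ^ n * / t)) by (simpl pred; field; lra).
      rewrite !RtoC_mult.
      replace (RtoC (/ INR (S n)) * (0 * (1 * RtoC (/ t)) * RtoC (ln t ^ S n) + 1 * (RtoC (INR (S n)) * (RtoC (ln t ^ n) * RtoC (/ t)))))%C
        with (RtoC (/ INR (S n)) * RtoC (INR (S n)) * RtoC (ln t ^ n) * RtoC (/ t))%C by ring.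
      rewrite <- RtoC_mult, Rinv_l by (apply not_0_INR; lia). ring.
  - induction n as [|n IH].
    + cbn [log_primitive_terms]. rewrite Hsum.
      replace (cpower t (s - 1) * RtoC (ln t ^ 0))%C with
        (/ s * (s * cpower t (s - 1) * RtoC (ln t ^ 0) + cpower t s * RtoC (INR 0 * ln t ^ pred 0 / t)))%C.
      * apply Cder_scal, Cder_eps_monomial, Ht.
      * replace (INR 0 * ln t ^ pred 0 / t) with 0 by (simpl; field; lra). simpl. field; exact Hs.
    + apply (Cder_ext (fun t => / s * eps_monomial s (S n) t
               + - (RtoC (INR (S n)) / s) * divergent_sum (log_primitive_terms n s) t)%C).
      { intros x; symmetry; apply log_primitive_terms_S. }
      replace (cpower t (s - 1) * RtoC (ln t ^ S n))%C with
        (/ s * (s * cpower t (s - 1) * RtoC (ln t ^ S n)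
                + cpower t s * RtoC (INR (S n) * ln t ^ pred (S n) / t))
         + - (RtoC (INR (S n)) / s) * (cpower t (s - 1) * RtoC (ln t ^ n)))%C.
      * apply Cder_plus; apply Cder_scal; [apply Cder_eps_monomial, Ht | exact IH].
      * rewrite cpower_minus_1 by exact Ht.
        replace (INR (S n) * ln t ^ pred (S n) / t) with (INR (S n) * (ln t ^ n * / t))
          by (simpl pred; field; lra).
        rewrite !RtoC_mult. field; exact Hs.
Qed.

Definition pole_coef (n : nat) : C := RtoC ((-1) ^ n * INR (fact n)).

(* At [s = 0] both sides vanish, the right one because division by 0 gives 0. *)
Lemma log_primitive_at_1 (n : nat) (s : C) :
  log_primitive n s 1 = (pole_coef n * / s ^ S n)%C.
Proof.
  unfold log_primitive, log_primitive_list, pole_coef. destruct (Ceq_dec s 0) as [-> | Hs].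
  - unfold divergent_sum, eps_monomial; simpl. rewrite ln_1, !Cmult_0_l, Cinv_0.
    rewrite Rmult_0_l. ring.
  - induction n as [|n IH].
    + unfold divergent_sum, eps_monomial; simpl. rewrite cpower_at_1, Rmult_1_l. field; exact Hs.
    + rewrite log_primitive_terms_S, IH. unfold eps_monomial. rewrite ln_1, pow_i by lia.
      rewrite fact_simpl, mult_INR.
      replace ((-1) ^ S n * (INR (S n) * INR (fact n))) with (- INR (S n) * ((-1) ^ n * INR (fact n)))
        by (simpl pow; ring).
      rewrite (RtoC_mult (- INR (S n))), RtoC_opp.
      change (s ^ S (S n))%C with (s * s ^ S n)%C. field.
      split; [apply Cpow_nz, Hs | exact Hs].
Qed.

(** The condition at [s = 0] excludes a constant monomial; every other monomial with [Re s <= 0]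
    diverges. *)
Lemma log_primitive_list_spec (n : nat) (s : C) :
  List.Forall (fun e => fst (snd e) = s /\ (s = 0 -> (0 < snd (snd e))%nat)) (log_primitive_list n s).
Proof.
  unfold log_primitive_list. destruct (Ceq_dec s 0) as [-> | Hs].
  - constructor; [split; [reflexivity | intros; simpl; lia] | constructor].
  - induction n as [|n IH]; simpl; constructor; try (split; [reflexivity | intros; contradiction]).
    + constructor.
    + apply List.Forall_map. revert IH; apply List.Forall_impl. trivial.
Qed.

Lemma log_primitive_lim_0 (n : nat) (s : C) :
  0 < Re s -> Clim (at_right 0) (log_primitive n s) 0.
Proof.
  intros Hs. unfold log_primitive.
  generalize (log_primitive_list_spec n s). generalize (log_primitive_list n s) as L.
  induction L as [|[c [p m]] L IH]; intros HL.
  - clim (Clim_const (at_right 0) 0).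
  - inversion HL as [|? ? [H1 _] H2]. simpl in H1.
    apply (Clim_ext (at_right 0) (fun t => c * eps_monomial p m t + divergent_sum L t)%C); [reflexivity |].
    replace (RtoC 0) with (c * 0 + 0)%C by ring.
    clim Clim_plus; [| apply IH, H2].
    clim Clim_mult; [clim Clim_const | apply eps_monomial_lim_0]. rewrite H1; exact Hs.
Qed.

Lemma log_primitive_list_divergent (n : nat) (s a : C) :
  Re s <= 0 ->
  List.Forall (fun e => divergent_monomial (fst (snd e)) (snd (snd e)))
    (map (fun e => (a * fst e, snd e)%C) (log_primitive_list n s)).
Proof.
  intros Hs. apply List.Forall_map. generalize (log_primitive_list_spec n s). apply List.Forall_impl.
  intros [c [p m]] [H1 H2]; simpl in *. subst s. apply eps_monomial_divergent; [exact Hs |].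
  destruct (Ceq_dec p 0); auto.
Qed.

Lemma CRInt_log_primitive (n : nat) (s : C) (x y : R) :
  0 < x -> 0 < y ->
  CRInt (fun t => cpower t (s - 1) * RtoC (ln t ^ n))%C x y
  = (log_primitive n s y - log_primitive n s x)%C.
Proof.
  intros Hx Hy.
  assert (Hpos : forall t, Rbetween x y t -> 0 < t).
  { intros t [Ht _]; eapply Rlt_le_trans; [apply Rmin_pos; [exact Hx | exact Hy] | exact Ht]. }
  apply CRInt_derive.
  - intros t Ht; apply Cder_log_primitive, Hpos, Ht.
  - intros t Ht; apply Ccont_mult; [apply Ccont_cpower | apply Ccont_RtoC, continuous_ln_pow];
      apply Hpos, Ht.
Qed.

(** The value at [b] is the value at 1, a pure pole term, plus the integral from 1 to [b]. The
    latter is entire: [mellin_transform] applies with the filter of the point [b], for which every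
    exponent is admissible. *)
Lemma log_primitive_analytic (n m : nat) (b : R) :
  0 < b -> exists h : C -> C, (forall l, analytic_at h l) /\
    forall l, log_primitive n (RtoC (INR m) + 1 - l)%C b
              = (h l + pole_coef n * / (RtoC (INR m) + 1 - l) ^ S n)%C.
Proof.
  intros Hb.
  destruct (mellin_transform (at_point b) (fun t => 0 < t) 1 (fun t => RtoC t ^ m)%C 1 (INR m)
              (fun _ => True)) as [H HH].
  - trivial.
  - intros x y t Hx Hy [Ht _]; eapply Rlt_le_trans; [apply Rmin_pos; [exact Hx | exact Hy] | exact Ht].
  - lra.
  - exact Hb.
  - intros t _. induction m as [|m IH]; [apply Ccont_const |]. cbn [Cpow].
    apply Ccont_mult; [apply Ccont_RtoC, continuous_id | exact IH].
  - intros t Ht. rewrite Cmod_pow, Cmod_R, Rabs_pos_eq, Rpower_pow by lra. lra.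
  - intros; exists 1; split; [lra | trivial].
  - intros q _. exists (RInt (fun t => Rpower t (INR m - q)) 1 b).
    intros P HP. apply (locally_singleton _ _ HP).
  - exists (H n); split; [intros l; apply (HH n l I) |]. intros l.
    rewrite <- log_primitive_at_1.
    replace (H n l) with (CRInt (mellin_itg (fun t => RtoC t ^ m)%C n l) 1 b).
    + rewrite (CRInt_ext _ (fun t => cpower t (RtoC (INR m) + 1 - l - 1) * RtoC (ln t ^ n))%C).
      * rewrite CRInt_log_primitive by lra. ring.
      * intros t [Ht _]. assert (0 < t).
        { eapply Rlt_trans; [| exact Ht]. apply Rmin_pos; lra. }
        unfold mellin_itg. rewrite <- cpower_INR by assumption.
        replace (RtoC (INR m) + 1 - l - 1)%C with (RtoC (INR m) + - l)%C by ring.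
        rewrite cpower_plus; reflexivity.
    + apply (Clim_unique (at_point b) (CRInt (mellin_itg (fun t => RtoC t ^ m)%C n l) 1)).
      * intros P HP. apply (locally_singleton _ _ HP).
      * apply (HH n l I).
Qed.

(** * The contribution of a neighbourhood of 0 *)

Fixpoint Csum (u : nat -> C) (N : nat) : C :=
  match N with
  | O => 0
  | S m => (Csum u m + u m)%C
  end.

Lemma Csum_plus (u v : nat -> C) (N : nat) :
  Csum (fun m => u m + v m)%C N = (Csum u N + Csum v N)%C.
Proof. induction N as [|N IH]; cbn [Csum]; [ring | rewrite IH; ring]. Qed.

Lemma CRInt_mellin_itg_poly (c : nat -> C) (n N : nat) (l : C) (x y : R) :
  0 < x -> 0 < y ->
  CRInt (mellin_itg (fun t => Cpsum c (RtoC t) N) n l) x y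
  = Csum (fun m => c m * (log_primitive n (RtoC (INR m) + 1 - l) y
                          - log_primitive n (RtoC (INR m) + 1 - l) x))%C N.
Proof.
  intros Hx Hy.
  assert (Hpos : forall t, Rbetween x y t -> 0 < t).
  { intros t [Ht _]; eapply Rlt_le_trans; [apply Rmin_pos; [exact Hx | exact Hy] | exact Ht]. }
  assert (Hpow : forall N t, Ccont (fun t => Cpsum c (RtoC t) N) t).
  { intros m t; apply (Ccont_Cpsum c RtoC), Ccont_RtoC, continuous_id. }
  induction N as [|N IH].
  - cbn [Csum]. rewrite (CRInt_ext _ (fun _ => RtoC 0 * RtoC 0)%C).
    + rewrite (CRInt_scal 0 (fun _ => RtoC 0)); [ring | intros; apply Ccont_const].
    + intros; unfold mellin_itg; cbn [Cpsum]; ring.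
  - cbn [Csum]. rewrite <- IH, <- CRInt_log_primitive by assumption.
    assert (Hc : forall t, Rbetween x y t ->
              Ccont (fun t => cpower t (RtoC (INR N) + 1 - l - 1) * RtoC (ln t ^ n))%C t).
    { intros t Ht; apply Ccont_mult; [apply Ccont_cpower | apply Ccont_RtoC, continuous_ln_pow];
        apply Hpos, Ht. }
    rewrite <- CRInt_scal, <- CRInt_plus; [| | | exact Hc].
    + apply CRInt_ext; intros t Ht. unfold mellin_itg; cbn [Cpsum].
      rewrite <- cpower_INR by (apply Hpos; split; lra).
      replace (RtoC (INR N) + 1 - l - 1)%C with (RtoC (INR N) + - l)%C by ring.
      rewrite cpower_plus. ring.
    + intros t Ht; apply mellin_itg_Ccont; [apply Hpos, Ht | apply Hpow].
    + intros t Ht; apply Ccont_mult; [apply Ccont_const | apply Hc, Ht].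
Qed.

(* The integral from [eps] to [b] with its divergent part, and terms tending to 0, removed. *)
Definition near_itg (k : R -> C) (c : nat -> C) (b : R) (n N : nat) (l : C) (eps : R) : C :=
  (CRInt (mellin_itg k n l) eps b
   + Csum (fun m => c m * log_primitive n (RtoC (INR m) + 1 - l) eps) N)%C.

Definition pole_sum (c : nat -> C) (n N : nat) (l : C) : C :=
  Csum (fun m => c m * (pole_coef n * / (RtoC (INR m) + 1 - l) ^ S n))%C N.

Lemma Csum_log_primitive_analytic (c : nat -> C) (n N : nat) (b : R) :
  0 < b -> exists h : C -> C, (forall l, analytic_at h l) /\
    forall l, Csum (fun m => c m * log_primitive n (RtoC (INR m) + 1 - l) b)%C N
              = (h l + pole_sum c n N l)%C.
Proof.
  intros Hb. induction N as [|N [h [Hh E]]].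
  - exists (fun _ => RtoC 0); split; [intros; apply analytic_at_const |].
    intros l; unfold pole_sum; cbn [Csum]; ring.
  - destruct (log_primitive_analytic n N b Hb) as [h' [Hh' E']].
    exists (fun l => h l + c N * h' l)%C; split.
    + intros l; apply analytic_at_plus; [apply Hh | apply analytic_at_scal, Hh'].
    + intros l; unfold pole_sum in *; cbn [Csum]. rewrite E, E'. ring.
Qed.

Lemma INR_above (x : R) : exists N, x < INR N + 1.
Proof.
  destruct (nfloor_ex (Rmax x 0)) as [N HN]; [apply Rmax_r |].
  exists N. pose proof (Rmax_l x 0). lra.
Qed.

(** [k] minus its Taylor polynomial of degree below [N] is of order [t^N], so its integral converges
    absolutely for [Re l < N + 1]. The polynomial contributes primitives at [b], which carry the
    poles, minus primitives at [eps], which the sum in [near_itg] cancels. Raising [N] adds a term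
    tending to 0, so the limits for different [N] agree and define one [V]. *)
Lemma near_part (k : R -> C) (c : nat -> C) (b : R) (n : nat) :
  0 < b ->
  (forall t, 0 < t <= b -> Ccont k t) ->
  (forall N, exists M, forall t, 0 < t <= b -> Cmod (k t - Cpsum c (RtoC t) N)%C <= M * t ^ N) ->
  exists V : C -> C,
    (forall N l, Re l < INR N + 1 -> Clim (at_right 0) (near_itg k c b n N l) (V l)) /\
    (forall N, exists h, forall l, Re l < INR N + 1 ->
       analytic_at h l /\ V l = (h l + pole_sum c n N l)%C).
Proof.
  intros Hb Hk Hbound.
  assert (Hstep : forall N l v, Re l < INR N + 1 ->
    Clim (at_right 0) (near_itg k c b n N l) v -> Clim (at_right 0) (near_itg k c b n (S N) l) v).
  { intros N l v Hl Hv.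
    apply (Clim_ext (at_right 0) (fun eps => near_itg k c b n N l eps
             + c N * log_primitive n (RtoC (INR N) + 1 - l) eps)%C).
    - intros eps; unfold near_itg; cbn [Csum]; ring.
    - replace v with (v + c N * 0)%C by ring. clim Clim_plus; [exact Hv |].
      clim Clim_mult; [clim Clim_const | apply log_primitive_lim_0].
      unfold Re; simpl. unfold Re in Hl. lra. }
  assert (Hmono : forall N j l v, Re l < INR N + 1 ->
    Clim (at_right 0) (near_itg k c b n N l) v -> Clim (at_right 0) (near_itg k c b n (N + j) l) v).
  { intros N j l v Hl Hv. induction j as [|j IH]; [rewrite Nat.add_0_r; exact Hv |].
    rewrite Nat.add_succ_r. apply Hstep; [| exact IH].
    rewrite plus_INR. pose proof (pos_INR j). lra. }
  assert (Hex : forall N, exists V : C -> C, exists h : C -> C, forall l, Re l < INR N + 1 ->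
    Clim (at_right 0) (near_itg k c b n N l) (V l) /\
    analytic_at h l /\ V l = (h l + pole_sum c n N l)%C).
  { intros N. destruct (Hbound N) as [M HM].
    set (g := fun t => (k t - Cpsum c (RtoC t) N)%C).
    assert (Hpow : forall N t, Ccont (fun t => Cpsum c (RtoC t) N) t).
    { intros m t; apply (Ccont_Cpsum c RtoC), Ccont_RtoC, continuous_id. }
    assert (Hgc : forall t, 0 < t <= b -> Ccont g t).
    { intros t Ht. apply Ccont_minus; [apply Hk, Ht | apply Hpow]. }
    destruct (mellin_transform (at_right 0) (fun t => 0 < t <= b) b g M (INR N)
                (fun q => q < INR N + 1)) as [H HH].
    - intros t Ht; apply Ht.
    - intros x y t Hx Hy [H1 H2]. unfold Rmin, Rmax in *; repeat destruct Rle_dec; lra.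
    - lra.
    - generalize (at_right_0_lt b Hb); apply filter_imp; intros; lra.
    - exact Hgc.
    - intros t Ht. rewrite Rpower_pow by lra. apply HM, Ht.
    - intros q Hq; exists ((INR N + 1 - q) / 2); split; [lra |]. intros q' Hq'.
      apply Rabs_le_between in Hq'. lra.
    - intros q Hq. set (e := INR N - q).
      exists (/ (e + 1) * (0 - Rpower b (e + 1))).
      apply filterlim_ext_loc with (fun x => / (e + 1) * (Rpower x (e + 1) - Rpower b (e + 1))).
      + generalize (at_right_0_lt b Hb); apply filter_imp; intros x Hx.
        symmetry; apply RInt_Rpower; unfold e; lra.
      + apply (filterlim_comp _ _ _ (fun x => Rpower x (e + 1))
                 (fun y => / (e + 1) * (y - Rpower b (e + 1))) _ (locally 0)).
        * apply Rpower_lim_0; unfold e; lra.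
        * apply (continuous_scal_r (V := R_NormedModule) (/ (e + 1)) (fun y => y - Rpower b (e + 1)) 0).
          apply (continuous_minus (V := R_NormedModule)); [apply continuous_id | apply continuous_const].
    - destruct (Csum_log_primitive_analytic c n N b Hb) as [h [Hh E]].
      (* The minus sign arises because [H] integrates from [b] down to 0. *)
      exists (fun l => - RtoC 1 * H n l + Csum (fun m => c m * log_primitive n (RtoC (INR m) + 1 - l) b) N)%C.
      exists (fun l => - RtoC 1 * H n l + h l)%C.
      intros l Hl; split; [| split].
      + apply (Clim_ext_loc (at_right 0) (fun eps => - RtoC 1 * CRInt (mellin_itg g n l) b eps +
                 Csum (fun m => c m * log_primitive n (RtoC (INR m) + 1 - l) b) N)%C).
        * generalize (at_right_0_lt b Hb); apply filter_imp; intros eps Heps.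
          unfold near_itg.
          assert (Hpos : forall t, Rbetween eps b t -> 0 < t <= b).
          { intros t [H1 H2]. rewrite Rmin_left in H1 by lra; rewrite Rmax_right in H2; lra. }
          assert (Hgi : forall t, Rbetween eps b t -> Ccont (mellin_itg g n l) t).
          { intros t Ht; apply mellin_itg_Ccont; [apply Hpos, Ht | apply Hgc, Hpos, Ht]. }
          rewrite (CRInt_ext (mellin_itg k n l)
            (fun t => mellin_itg g n l t + mellin_itg (fun t => Cpsum c (RtoC t) N) n l t)%C)
            by (intros; unfold mellin_itg, g; ring).
          rewrite CRInt_plus; [| exact Hgi |].
          2: { intros t Ht; apply mellin_itg_Ccont; [apply Hpos, Ht | apply Hpow]. }
          rewrite CRInt_mellin_itg_poly by lra.
          rewrite (CRInt_swap (mellin_itg g n l) eps b Hgi).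
          transitivity (- CRInt (mellin_itg g n l) b eps +
            Csum (fun m => c m * (log_primitive n (RtoC (INR m) + 1 - l) b
               - log_primitive n (RtoC (INR m) + 1 - l) eps)
               + c m * log_primitive n (RtoC (INR m) + 1 - l) eps) N)%C.
          -- replace (- RtoC 1 * CRInt (mellin_itg g n l) b eps)%C
               with (- CRInt (mellin_itg g n l) b eps)%C by ring. f_equal.
             clear; induction N as [|N IH]; cbn [Csum]; [reflexivity | rewrite IH; ring].
          -- rewrite Csum_plus. ring.
        * clim Clim_plus; [| clim Clim_const].
          clim Clim_mult; [clim Clim_const | apply (HH n l Hl)].
      + apply analytic_at_plus; [apply analytic_at_scal, (HH n l Hl) | apply Hh].
      + cbv beta. rewrite E. ring. }
  (* The limit is taken for some admissible [N]; two choices [N] and [N'] are compared at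
     [N + N']. *)
  set (V := fun l => epsilon (inhabits (RtoC 0)) (fun v => exists N, Re l < INR N + 1 /\
                                Clim (at_right 0) (near_itg k c b n N l) v)).
  assert (HV : forall N l v, Re l < INR N + 1 -> Clim (at_right 0) (near_itg k c b n N l) v -> v = V l).
  { intros N l v Hl Hv.
    destruct (epsilon_spec (inhabits (RtoC 0)) (fun v => exists N, Re l < INR N + 1 /\
                Clim (at_right 0) (near_itg k c b n N l) v)) as [N' [Hl' Hv']].
    { exists v, N; split; assumption. }
    fold (V l) in Hv'.
    apply (Clim_unique (at_right 0) (near_itg k c b n (N + N') l)).
    - apply Hmono; assumption.
    - rewrite Nat.add_comm. apply Hmono; assumption. }
  exists V; split.
  - intros N l Hl. destruct (Hex N) as [VN [h HN]]. destruct (HN l Hl) as [H1 _].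
    rewrite <- (HV N l (VN l) Hl H1). exact H1.
  - intros N. destruct (Hex N) as [VN [h HN]]. exists h. intros l Hl.
    destruct (HN l Hl) as [H1 [H2 H3]]. split; [exact H2 |].
    rewrite <- (HV N l (VN l) Hl H1). exact H3.
Qed.

(** * The contribution of the upper end *)

Global Instance at_end_proper (a : Rbar) : ProperFilter (at_end a).
Proof. destruct a; simpl; typeclasses eauto. Qed.

Lemma at_end_inside (a : Rbar) (b : R) :
  Rbar_lt b a -> at_end a (fun t => b < t /\ Rbar_lt t a).
Proof.
  destruct a as [x | |]; simpl; intros H; [| exists b; auto | contradiction].
  assert (Hp : 0 < x - b) by lra. exists (mkposreal _ Hp). intros y Hy Hyx.
  change (Rabs (y - x) < x - b) in Hy. apply Rabs_def2 in Hy. lra.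
Qed.

(** Splits [[b, a)] into a compact interval and a remainder on which an eventual property holds
    throughout; used to bound a function that converges at the end. *)
Lemma at_end_witness (a : Rbar) (b : R) (P : R -> Prop) :
  Rbar_lt b a -> at_end a P ->
  exists y0, b <= y0 /\ Rbar_lt y0 a /\ forall t, y0 < t -> Rbar_lt t a -> P t.
Proof.
  destruct a as [x | |]; simpl; intros H HP; [| | contradiction].
  - destruct HP as [e He]. exists (Rmax b (x - e)). pose proof (cond_pos e).
    split; [apply Rmax_l |]. split; [apply Rmax_lub_lt; lra |].
    intros t H1 H2. apply He; [| exact H2].
    change (Rabs (t - x) < e). pose proof (Rmax_r b (x - e)). apply Rabs_def1; lra.
  - destruct HP as [M HM]. exists (Rmax b M).
    split; [apply Rmax_l |]. split; [exact I |]. intros t H1 _. apply HM.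
    pose proof (Rmax_r b M); lra.
Qed.

Lemma Rbar_lt_between (a : Rbar) (x y t : R) :
  Rbar_lt x a -> Rbar_lt y a -> Rbetween x y t -> Rbar_lt t a.
Proof.
  intros Hx Hy [_ Ht]. apply Rbar_le_lt_trans with (Rmax x y); [exact Ht |].
  unfold Rmax; destruct Rle_dec; assumption.
Qed.

Lemma is_RInt_gen_CRInt (f : R -> C) (Fa Fb : (R -> Prop) -> Prop) (v : C) :
  is_RInt_gen (V := C_R_NormedModule) f Fa Fb v ->
  Clim (filter_prod Fa Fb) (fun xy => CRInt f (fst xy) (snd xy)) v.
Proof.
  intros H P HP. destruct (H P HP) as [A B HA HB HAB].
  exists A B; [exact HA | exact HB |]. intros x y Hx Hy.
  destruct (HAB x y Hx Hy) as [z [Hz HPz]]. simpl in Hz. simpl.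
  rewrite (CRInt_unique _ _ _ _ Hz). exact HPz.
Qed.

Lemma CRInt_is_RInt_gen (f : R -> C) (Fa Fb : (R -> Prop) -> Prop) (v : C)
  {FFa : Filter Fa} {FFb : Filter Fb} :
  filter_prod Fa Fb (fun xy => forall t, Rbetween (fst xy) (snd xy) t -> Ccont f t) ->
  Clim (filter_prod Fa Fb) (fun xy => CRInt f (fst xy) (snd xy)) v ->
  is_RInt_gen (V := C_R_NormedModule) f Fa Fb v.
Proof.
  intros Hc H P HP. assert (HP' := H P HP). unfold filtermap in HP'.
  unfold filtermapi. generalize (filter_and _ _ Hc HP'). apply filter_imp. intros xy [H1 H2]. exists (CRInt f (fst xy) (snd xy)).
  split; [apply CRInt_correct, H1 | exact H2].
Qed.

(** Convergence at both ends jointly, once a single point [x] close to 0 is fixed and the known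
    limit at 0 subtracted, gives convergence at the upper end alone. *)
Lemma mellin_end_limit (a : Rbar) (f : R -> C) (b : R) (u v : C) :
  0 < b -> Rbar_lt b a ->
  (forall t, 0 < t -> Rbar_lt t a -> Ccont f t) ->
  Clim (at_right 0) (fun x => CRInt f x b) u ->
  is_RInt_gen (V := C_R_NormedModule) f (at_right 0) (at_end a) v ->
  Clim (at_end a) (CRInt f b) (v - u)%C.
Proof.
  intros Hb Hba Hf Hu Hv. apply is_RInt_gen_CRInt in Hv.
  apply Clim_Cmod; [typeclasses eauto |]. intros eps Heps.
  assert (He : 0 < eps / 2) by lra.
  assert (Hv' := proj1 (Clim_Cmod (filter_prod (at_right 0) (at_end a)) _ _) Hv _ He).
  destruct Hv' as [A B HA HB HAB]; simpl in HAB.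
  assert (Hu' := proj1 (Clim_Cmod (at_right 0) _ _) Hu _ He).
  destruct (filter_ex _ (filter_and _ _ (at_right_0_lt b Hb) (filter_and _ _ HA Hu'))) as [x [Hx [HxA Hxu]]].
  generalize (filter_and _ _ HB (at_end_inside a b Hba)); apply filter_imp.
  intros y [HyB [Hy1 Hy2]].
  assert (Hpos : forall s t z, 0 < s -> Rbar_lt s a -> 0 < t -> Rbar_lt t a -> Rbetween s t z -> Ccont f z).
  { intros s t z Hs1 Hs2 Ht1 Ht2 Hz. apply Hf.
    - destruct Hz as [Hz _]; eapply Rlt_le_trans; [apply Rmin_pos; [exact Hs1 | exact Ht1] | exact Hz].
    - eapply Rbar_lt_between; [exact Hs2 | exact Ht2 | exact Hz]. }
  assert (Hxa : Rbar_lt x a) by (apply (Rbar_lt_trans x b a); [simpl; lra | exact Hba]).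
  assert (E : (CRInt f x b + CRInt f b y = CRInt f x y)%C).
  { apply CRInt_Chasles; intros z; apply Hpos; try assumption; lra. }
  replace (CRInt f b y - (v - u))%C with ((CRInt f x y - v) + - (CRInt f x b - u))%C
    by (rewrite <- E; ring).
  eapply Rle_lt_trans; [apply Cmod_triangle |]. rewrite Cmod_opp.
  specialize (HAB x y HxA HyB). lra.
Qed.

Lemma Ccont_bounded (f : R -> C) (x y : R) :
  x <= y -> (forall t, x <= t <= y -> Ccont f t) ->
  exists B, forall t, x <= t <= y -> Cmod (f t) <= B.
Proof.
  intros Hxy Hf.
  destruct (continuity_ab_maj (fun t => Cmod (f t)) x y Hxy) as [m [Hm _]].
  - intros t Ht. apply continuity_pt_filterlim.
    apply filterlim_locally. intros eps.
    generalize (proj1 (Clim_Cmod (locally t) f (f t)) (Hf t Ht) eps (cond_pos eps)).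
    apply filter_imp. intros s Hs. change (Rabs (Cmod (f s) - Cmod (f t)) < eps).
    eapply Rle_lt_trans; [| exact Hs].
    assert (H1 := Cmod_triangle (f s - f t)%C (f t)).
    assert (H2 := Cmod_triangle (- (f s - f t))%C (f s)).
    replace (f s - f t + f t)%C with (f s) in H1 by ring.
    replace (- (f s - f t) + f s)%C with (f t) in H2 by ring.
    rewrite Cmod_opp in H2. apply Rabs_le; lra.
  - exists (Cmod (f m)); intros t Ht; apply Hm, Ht.
Qed.

(** The substitution [t -> / t] changes the signs of the exponent and of the logarithm and reduces
    this to the limit at 0. *)
Lemma eps_monomial_lim_p_infty (p : C) (m : nat) :
  Re p < 0 -> Clim (Rbar_locally p_infty) (eps_monomial p m) 0.
Proof.
  intros Hp.
  apply (Clim_ext_loc (Rbar_locally p_infty)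
           (fun t => RtoC ((-1) ^ m) * eps_monomial (- p) m (/ t))%C).
  - exists 0. intros t Ht. unfold eps_monomial, cpower. rewrite ln_Rinv by exact Ht.
    replace (- p * RtoC (- ln t))%C with (p * RtoC (ln t))%C by (rewrite RtoC_opp; ring).
    replace (ln t ^ m) with ((-1) ^ m * (- ln t) ^ m).
    + rewrite RtoC_mult; ring.
    + rewrite <- Rpow_mult_distr. f_equal; ring.
  - replace (RtoC 0) with (RtoC ((-1) ^ m) * 0)%C by ring.
    clim Clim_mult; [clim Clim_const |].
    apply (filterlim_comp _ _ _ Rinv (eps_monomial (- p) m) _ (at_right 0)).
    + intros P [e He]. exists (/ e). intros t Ht.
      assert (Hie : 0 < / e) by (apply Rinv_0_lt_compat, cond_pos).
      assert (Hit : 0 < / t) by (apply Rinv_0_lt_compat; lra).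
      apply He; [| exact Hit].
      change (Rabs (/ t - 0) < e). rewrite Rminus_0_r, Rabs_pos_eq by lra.
      rewrite <- (Rinv_inv e). apply Rinv_lt_contravar; [apply Rmult_lt_0_compat; lra | exact Ht].
    + apply eps_monomial_lim_0. unfold Re in *; simpl. lra.
Qed.

Lemma analytic_at_cpower (t : R) (z0 l : C) : analytic_at (fun z => cpower t (z0 - z)%C) l.
Proof.
  set (u := (- RtoC (ln t))%C).
  apply (analytic_at_intro _ _ (fun j => cpower t (z0 - l) * (exp_coefs j * u ^ j))%C 1 Rlt_0_1).
  intros z _. replace (cpower t (z0 - z))%C with (cpower t (z0 - l) * Cexp (u * (z - l)))%C.
  2: { unfold cpower. rewrite <- Cexp_plus. f_equal. unfold u; ring. }
  apply Cpseries_scal.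
  assert (E : forall N, Cpsum (fun j => exp_coefs j * u ^ j)%C (z - l)%C N
                        = Cpsum exp_coefs (u * (z - l))%C N).
  { intros N; induction N as [|N IH]; cbn [Cpsum]; [reflexivity |].
    rewrite IH, Cpow_mult_l. ring. }
  apply (Clim_ext eventually
    (fun N => - RtoC 1 * (Cexp (u * (z - l)) - Cpsum exp_coefs (u * (z - l)) N) + Cexp (u * (z - l)))%C).
  { intros N; rewrite E; ring. }
  set (v := (u * (z - l))%C).
  cut (Clim eventually (fun N => - RtoC 1 * (Cexp v - Cpsum exp_coefs v N) + Cexp v)%C
         (- RtoC 1 * 0 + Cexp v)%C).
  { replace (- RtoC 1 * 0 + Cexp v)%C with (Cexp v) by ring. trivial. }
  clim Clim_plus; [| clim Clim_const]. clim Clim_mult; [clim Clim_const |].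
  set (B := exp (2 * Cmod v)).
  apply (Clim_zero_le eventually _ (fun N => B * (1 / 2) ^ N)).
  - exists O; intros N _. rewrite (Rmult_comm B). apply Cexp_remainder.
  - change (is_lim_seq (fun N => B * (1 / 2) ^ N) (Finite 0)).
    replace (Finite 0) with (Rbar_mult B 0) by (simpl; f_equal; ring).
    apply is_lim_seq_scal_l, is_lim_seq_geom. rewrite Rabs_pos_eq; lra.
Qed.

Lemma Rpower_end_limit (a : Rbar) (c : R) :
  Rbar_lt 0 a -> c < 0 -> exists L, filterlim (fun t => Rpower t c) (at_end a) (locally L).
Proof.
  destruct a as [x | |]; simpl; intros Ha Hc; [| | contradiction].
  - exists (Rpower x c). apply (filterlim_filter_le_1 (F := locally x)); [apply filter_le_within |].
    apply continuous_Rpower, Ha.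
  - exists 0. apply Rpower_lim_p_infty, Hc.
Qed.

(* Abel's device: [K x = int_b^x k t^(-l0)] is bounded, and integrating by parts against
   [t^(l0 - l) ln^n t] leaves absolutely convergent integrals. *)
Lemma tail_by_parts (a : Rbar) (k : R -> C) (b l0 : R) (kappa : C) :
  0 < b -> Rbar_lt b a ->
  (forall t, 0 < t -> Rbar_lt t a -> Ccont k t) ->
  Clim (at_end a) (CRInt (mellin_itg k 0 (RtoC l0)) b) kappa ->
  forall n, exists T : C -> C, forall l, l0 < Re l ->
    Clim (at_end a) (CRInt (mellin_itg k n l) b) (T l) /\ analytic_at T l.
Proof.
  intros Hb Hba Hk Hkappa n.
  set (k0 := mellin_itg k 0 (RtoC l0)) in *. set (K := CRInt k0 b) in *.
  assert (Hk0 : forall t, 0 < t -> Rbar_lt t a -> Ccont k0 t).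
  { intros t Ht Hta; apply mellin_itg_Ccont; [exact Ht | apply Hk; assumption]. }
  assert (Hin : forall x t, b <= x -> Rbar_lt x a -> Rbetween b x t -> 0 < t /\ Rbar_lt t a).
  { intros x t Hx Hxa Ht; split.
    - destruct Ht as [Ht _]. rewrite Rmin_left in Ht by exact Hx. lra.
    - eapply Rbar_lt_between; [exact Hba | exact Hxa | exact Ht]. }
  assert (HKder : forall x, b <= x -> Rbar_lt x a -> Cder K x (k0 x)).
  { intros x Hx Hxa. apply CRInt_is_derive.
    - intros t Ht; apply Hk0; eapply Hin; eassumption.
    - assert (Hl : locally x (fun t => 0 < t /\ Rbar_lt t a)).
      { apply filter_and; [apply (open_gt 0 x); lra |].
        destruct a as [y | |]; simpl in *; [apply (open_lt y x); exact Hxa | | contradiction].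
        apply filter_true. }
      revert Hl; apply filter_imp. intros t [H1 H2]; apply Hk0; assumption. }
  (* Bounded by convergence near the end, and by continuity on the compact interval before it. *)
  assert (HKB : exists B, forall t, b <= t -> Rbar_lt t a -> Cmod (K t) <= B).
  { destruct (at_end_witness a b _ Hba (Clim_bounded (at_end a) _ _ Hkappa)) as [y0 [Hy1 [Hy2 Hy3]]].
    destruct (Ccont_bounded K b y0 Hy1) as [B HB].
    - intros t Ht. apply (Cder_Ccont _ _ (k0 t)), HKder; [apply Ht |].
      apply Rbar_le_lt_trans with y0; [apply Ht | exact Hy2].
    - exists (Rmax B (Cmod kappa + 1)). intros t Ht Hta.
      destruct (Rle_dec t y0) as [H | H].
      + eapply Rle_trans; [apply HB; lra | apply Rmax_l].
      + eapply Rle_trans; [apply Hy3; [lra | exact Hta] | apply Rmax_r]. }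
  destruct HKB as [B HB].
  (* The factor [t^(l0 - 1)] comes from differentiating [t^(l0 - l)]. With [K] bounded, [g t] times
     [t^(-l)] is absolutely integrable at the end as soon as [Re l > l0]. *)
  set (g := fun t => (K t * cpower t (RtoC (l0 - 1)))%C).
  assert (Hgc : forall t, b <= t -> Rbar_lt t a -> Ccont g t).
  { intros t Ht Hta; apply Ccont_mult; [eapply Cder_Ccont, HKder; assumption |].
    apply Ccont_cpower; lra. }
  destruct (mellin_transform (at_end a) (fun t => b <= t /\ Rbar_lt t a) b g B (l0 - 1)
              (fun q => l0 < q)) as [H HH].
  - intros; lra.
  - intros x y t [Hx Hxa] [Hy Hya] Ht; split; [| eapply Rbar_lt_between; [exact Hxa | exact Hya | exact Ht]].
    destruct Ht as [Ht _]; eapply Rle_trans; [apply Rmin_glb; [exact Hx | exact Hy] | exact Ht].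
  - split; [lra | exact Hba].
  - generalize (at_end_inside a b Hba); apply filter_imp; intros t [H1 H2]; split; [lra | exact H2].
  - intros t [H1 H2]; apply Hgc; assumption.
  - intros t [H1 H2]. unfold g. rewrite Cmod_mult, Cmod_cpower.
    apply Rmult_le_compat_r; [apply Rlt_le, exp_pos | apply HB; assumption].
  - intros q Hq; exists ((q - l0) / 2); split; [lra |]. intros q' Hq'.
    apply Rabs_le_between in Hq'. lra.
  - intros q Hq. set (c := l0 - 1 - q).
    destruct (Rpower_end_limit a (c + 1)) as [L HL].
    { apply Rbar_lt_trans with b; assumption. }
    { unfold c; lra. }
    exists (/ (c + 1) * (L - Rpower b (c + 1))).
    apply filterlim_ext_loc with (fun x => / (c + 1) * (Rpower x (c + 1) - Rpower b (c + 1))).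
    + generalize (at_end_inside a b Hba); apply filter_imp; intros x Hx.
      symmetry; apply RInt_Rpower; unfold c; lra.
    + apply (filterlim_comp _ _ _ (fun x => Rpower x (c + 1))
               (fun y => / (c + 1) * (y - Rpower b (c + 1))) _ (locally L) _ HL).
      apply (continuous_scal_r (V := R_NormedModule) (/ (c + 1)) (fun y => y - Rpower b (c + 1)) L).
      apply (continuous_minus (V := R_NormedModule)); [apply continuous_id | apply continuous_const].
  (* The boundary term survives at a finite end; at infinity it tends to 0 because [Re l > l0]. *)
  - set (bdry := fun l => match a with
                          | Finite x => (kappa * RtoC (ln x ^ n) * cpower x (RtoC l0 - l))%C
                          | _ => RtoC 0
                          end).
    (* For [n = 0] the coefficient [INR n] is 0, so the meaning of [pred 0] does not matter. *)
    exists (fun l => bdry l + (l - RtoC l0) * H n l + - RtoC (INR n) * H (pred n) l)%C.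
    intros l Hl; split.
    + apply (Clim_ext_loc (at_end a) (fun x => K x * eps_monomial (RtoC l0 - l) n x
        + (l - RtoC l0) * CRInt (mellin_itg g n l) b x
        + - RtoC (INR n) * CRInt (mellin_itg g (pred n) l) b x)%C).
      * generalize (at_end_inside a b Hba); apply filter_imp. intros x [Hbx Hxa].
        assert (Hin' := fun t Ht => Hin x t (Rlt_le _ _ Hbx) Hxa Ht).
        assert (Hbt : forall t, Rbetween b x t -> b <= t).
        { intros t [Ht _]; rewrite Rmin_left in Ht; lra. }
        assert (Hgi : forall m t, Rbetween b x t -> Ccont (mellin_itg g m l) t).
        { intros m t Ht; apply mellin_itg_Ccont; [apply Hin', Ht |].
          apply Hgc; [apply Hbt, Ht | apply Hin', Ht]. }
        assert (Hki : forall t, Rbetween b x t -> Ccont (mellin_itg k n l) t).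
        { intros t Ht; destruct (Hin' t Ht); apply mellin_itg_Ccont; [| apply Hk]; assumption. }
        (* The derivative of [K t * t^(l0 - l) ln^n t], arranged so that its first term is the
           integrand sought; there is no boundary term at [b] since [K b = 0]. *)
        set (f' := fun t => (mellin_itg k n l t + - (l - RtoC l0) * mellin_itg g n l t
                              + RtoC (INR n) * mellin_itg g (pred n) l t)%C).
        assert (E : CRInt f' b x = (K x * eps_monomial (RtoC l0 - l) n x)%C).
        { rewrite (CRInt_derive (fun t => K t * eps_monomial (RtoC l0 - l) n t)%C).
          - unfold K at 2. rewrite CRInt_point. ring.
          - intros t Ht. destruct (Hin' t Ht) as [Ht0 Hta].
            replace (f' t) with (k0 t * eps_monomial (RtoC l0 - l) n t + K t *
              ((RtoC l0 - l) * cpower t (RtoC l0 - l - 1) * RtoC (ln t ^ n)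
               + cpower t (RtoC l0 - l) * RtoC (INR n * ln t ^ pred n / t)))%C.
            + apply Cder_mult; [apply HKder; [apply Hbt, Ht | exact Hta] |].
              apply Cder_eps_monomial, Ht0.
            + unfold f', k0, g, mellin_itg, eps_monomial.
              rewrite RtoC_minus, !cpower_minus_1 by exact Ht0.
              replace (INR n * ln t ^ pred n / t) with (INR n * (ln t ^ pred n * / t))
                by (field; lra).
              unfold Cminus. rewrite !RtoC_mult, !cpower_plus, !(cpower_opp t (RtoC l0)).
              change (ln t ^ 0) with 1. field. apply cpower_neq_0.
          - intros t Ht. unfold f'. apply Ccont_plus; [apply Ccont_plus |].
            + apply Hki, Ht.
            + apply Ccont_mult; [apply Ccont_const | apply Hgi, Ht].
            + apply Ccont_mult; [apply Ccont_const | apply Hgi, Ht]. }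
        rewrite <- E. unfold f'.
        rewrite CRInt_plus, CRInt_plus, !CRInt_scal.
        -- ring.
        -- apply Hgi.
        -- apply Hgi.
        -- apply Hki.
        -- intros t Ht; apply Ccont_mult; [apply Ccont_const | apply Hgi, Ht].
        -- intros t Ht; apply Ccont_plus; [apply Hki, Ht |].
           apply Ccont_mult; [apply Ccont_const | apply Hgi, Ht].
        -- intros t Ht; apply Ccont_mult; [apply Ccont_const | apply Hgi, Ht].
      * clim Clim_plus; [clim Clim_plus |].
        -- destruct a as [y | |]; simpl in Hba; [| | contradiction].
           ++ replace (bdry l) with (kappa * eps_monomial (RtoC l0 - l) n y)%C
                by (unfold bdry, eps_monomial; ring).
              clim Clim_mult; [exact Hkappa |].
              apply (filterlim_filter_le_1 (F := locally y)); [apply filter_le_within |].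
              apply (Cder_Ccont _ _ _ (Cder_eps_monomial _ _ _ (Rlt_trans _ _ _ Hb Hba))).
           ++ unfold bdry. rewrite <- (Cmult_0_r kappa). clim Clim_mult; [exact Hkappa |].
              apply eps_monomial_lim_p_infty. unfold Re in *; simpl; lra.
        -- clim Clim_mult; [clim Clim_const | apply (HH n l Hl)].
        -- clim Clim_mult; [clim Clim_const | apply (HH (pred n) l Hl)].
    + apply analytic_at_plus; [apply analytic_at_plus |].
      * unfold bdry. destruct a; try apply analytic_at_const.
        apply analytic_at_scal, analytic_at_cpower.
      * apply analytic_at_mult_linear, (HH n l Hl).
      * apply analytic_at_scal, (HH (pred n) l Hl).
Qed.

Lemma Rbar_lt_real_between (d : Rbar) (x y : R) :
  Rbar_lt d x -> Rbar_lt d y -> exists z : R, Rbar_lt d z /\ z < x /\ z < y.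
Proof.
  intros Hx Hy. destruct d as [w | |]; simpl in *; [| contradiction |].
  - exists ((w + Rmin x y) / 2). unfold Rmin; destruct Rle_dec; lra.
  - exists (Rmin x y - 1). unfold Rmin; destruct Rle_dec; lra.
Qed.

(** Every [l] has a real [l0] of the strip to its left, where the transform of [k] converges, and
    [tail_by_parts] then covers [Re l > l0] for all [n]. The functions found for different [l0]
    agree because limits are unique, so they glue to one [T]. *)
Lemma tail_part (a d : Rbar) (k : R -> C) (b : R) :
  0 < b -> Rbar_lt b a ->
  (forall t, 0 < t -> Rbar_lt t a -> Ccont k t) ->
  mellin_strip a k d ->
  (forall l0, l0 < 1 -> exists u,
     Clim (at_right 0) (fun x => CRInt (mellin_itg k 0 (RtoC l0)) x b) u) ->
  forall n, exists T : C -> C, forall l, Rbar_lt d (Re l) ->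
    Clim (at_end a) (CRInt (mellin_itg k n l) b) (T l) /\ analytic_at T l.
Proof.
  intros Hb Hba Hk [Hd1 [_ Hstrip]] Hnear n.
  assert (Hloc : forall l, Rbar_lt d (Re l) -> exists (l0 : R) (T : C -> C), l0 < Re l /\
    forall l', l0 < Re l' -> Clim (at_end a) (CRInt (mellin_itg k n l') b) (T l') /\ analytic_at T l').
  { intros l Hl. destruct (Rbar_lt_real_between d (Re l) 1 Hl Hd1) as [l0 [H1 [H2 H3]]].
    destruct (Hstrip (RtoC l0) H1 H3) as [v Hv]. destruct (Hnear l0 H3) as [u Hu].
    assert (E : (fun t => (k t * cpower t (1 - RtoC l0 - 1))%C) = mellin_itg k 0 (RtoC l0)).
    { apply functional_extensionality; intros t. unfold mellin_itg.
      replace (1 - RtoC l0 - 1)%C with (- RtoC l0)%C by ring. simpl pow. ring. }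
    unfold is_mellin in Hv. rewrite E in Hv.
    destruct (tail_by_parts a k b l0 (v - u)%C Hb Hba Hk) with (n := n) as [T HT].
    - apply mellin_end_limit; try assumption.
      intros t Ht Hta; apply mellin_itg_Ccont; [exact Ht | apply Hk; assumption].
    - exists l0, T; split; [exact H2 | exact HT]. }
  set (T := fun l => epsilon (inhabits (RtoC 0)) (fun v => Clim (at_end a) (CRInt (mellin_itg k n l) b) v)).
  assert (HTlim : forall l, Rbar_lt d (Re l) -> Clim (at_end a) (CRInt (mellin_itg k n l) b) (T l)).
  { intros l Hl. destruct (Hloc l Hl) as [l0 [T0 [H1 H2]]].
    unfold T; apply epsilon_spec. exists (T0 l); apply (H2 l H1). }
  exists T; intros l Hl; split; [apply HTlim, Hl |].
  destruct (Hloc l Hl) as [l0 [T0 [H1 H2]]].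
  apply (analytic_at_ext T0 T l (Re l - l0)); [lra | | apply (H2 l H1)].
  intros z Hz.
  assert (Hzl : l0 < Re z).
  { assert (Hz' := re_le_Cmod (z - l)%C). unfold Re in Hz', Hz |- *; simpl in Hz'.
    pose proof (Rabs_maj2 (fst z + - fst l)). lra. }
  destruct (H2 z Hzl) as [H3 _].
  apply (Clim_unique (at_end a) _ _ _ H3).
  unfold T; apply epsilon_spec. exists (T0 z); exact H3.
Qed.

(** * The identity theorem with isolated singularities *)

(** At the supremum of the [t] with [P] on [[0, t]], the closing step gives [P]; the opening step
    would go beyond it if it were less than 1. *)
Lemma real_induction (P : R -> Prop) :
  P 0 ->
  (forall t, 0 <= t < 1 -> P t -> exists e, 0 < e /\ forall s, t < s < t + e -> P s) ->
  (forall t, 0 < t <= 1 -> (forall s, 0 <= s < t -> P s) -> P t) ->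
  P 1.
Proof.
  intros H0 Hopen Hclosed.
  destruct (completeness (fun t => 0 <= t <= 1 /\ forall s, 0 <= s <= t -> P s)) as [m [Hub Hlub]].
  - exists 1; intros t [Ht _]; lra.
  - exists 0; split; [lra |]. intros s Hs; replace s with 0 by lra. exact H0.
  - assert (Hm0 : 0 <= m).
    { apply Hub; split; [lra |]. intros s Hs; replace s with 0 by lra. exact H0. }
    assert (Hm1 : m <= 1) by (apply Hlub; intros t [Ht _]; lra).
    assert (Hlt : forall s, 0 <= s < m -> P s).
    { intros s Hs. apply NNPP; intros Hn. apply (Rlt_irrefl s).
      apply Rlt_le_trans with m; [apply Hs |]. apply Hlub.
      intros t [Ht HP]. apply Rnot_lt_le; intros Hst. apply Hn, HP; lra. }
    assert (HPm : P m).
    { destruct (Rle_lt_or_eq_dec 0 m Hm0) as [H | <-]; [| exact H0].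
      apply Hclosed; [lra | exact Hlt]. }
    destruct (Rle_lt_or_eq_dec m 1 Hm1) as [H | <-]; [| exact HPm].
    exfalso. destruct (Hopen m (conj Hm0 H) HPm) as [e [He Hs]].
    set (m' := m + Rmin (e / 2) (1 - m)).
    assert (Hmin : 0 < Rmin (e / 2) (1 - m)) by (apply Rmin_pos; lra).
    pose proof (Rmin_l (e / 2) (1 - m)); pose proof (Rmin_r (e / 2) (1 - m)).
    assert (m' <= m); [| unfold m' in *; lra].
    apply Hub; split; [unfold m'; lra |]. intros s Hs'.
    destruct (Rlt_le_dec s m) as [Hsm | Hsm]; [apply Hlt; lra |].
    destruct (Rle_lt_or_eq_dec m s Hsm) as [Hms | <-]; [| exact HPm].
    apply Hs; unfold m' in *; lra.
Qed.

Definition vanishes_near (f : C -> C) (z : C) : Prop :=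
  exists r, 0 < r /\ forall z', Cmod (z' - z)%C < r -> f z' = 0.

(** The puncture is essential: two continuations may differ at an isolated singularity, where their
    values are arbitrary. *)
Definition vanishes_around (f : C -> C) (z : C) : Prop :=
  exists r, 0 < r /\ forall z', 0 < Cmod (z' - z)%C < r -> f z' = 0.

Definition segment (z1 z2 : C) (t : R) : C := (z1 + RtoC t * (z2 - z1))%C.

Lemma Cmod_segment_diff (z1 z2 : C) (s t : R) :
  Cmod (segment z1 z2 s - segment z1 z2 t)%C = Rabs (s - t) * Cmod (z2 - z1)%C.
Proof.
  unfold segment. rewrite <- Cmod_R, <- Cmod_mult, RtoC_minus. f_equal. ring.
Qed.

Lemma segment_0 (z1 z2 : C) : segment z1 z2 0 = z1.
Proof. unfold segment; ring. Qed.

Lemma segment_1 (z1 z2 : C) : segment z1 z2 1 = z2.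
Proof. unfold segment; ring. Qed.

Lemma Cmod_minus_pos (z w : C) : z <> w -> 0 < Cmod (z - w)%C.
Proof.
  intros H. apply Cmod_gt_0. intros E; apply H.
  replace z with (z - w + w)%C by ring. rewrite E; ring.
Qed.

Lemma Cmod_minus_triangle (x y z : C) : Cmod (x - z)%C <= Cmod (x - y)%C + Cmod (y - z)%C.
Proof. replace (x - z)%C with ((x - y) + (y - z))%C by ring. apply Cmod_triangle. Qed.

Lemma Cmod_minus_sym (x y : C) : Cmod (x - y)%C = Cmod (y - x)%C.
Proof. replace (x - y)%C with (- (y - x))%C by ring. apply Cmod_opp. Qed.

(** Real induction along the segment: vanishing near a point passes to nearby points with a smaller
    disc, and a limit of such points is an accumulation point of zeros. *)
Lemma vanishes_near_segment (f : C -> C) (z1 z2 : C) :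
  (forall t, 0 <= t <= 1 -> analytic_at f (segment z1 z2 t)) ->
  vanishes_near f z1 -> vanishes_near f z2.
Proof.
  intros Hf H1. destruct (Ceq_dec z2 z1) as [-> | Hne]; [exact H1 |].
  assert (HL := Cmod_minus_pos _ _ Hne). set (L := Cmod (z2 - z1)%C) in *.
  rewrite <- (segment_1 z1 z2). apply (real_induction (fun t => vanishes_near f (segment z1 z2 t))).
  - rewrite segment_0; exact H1.
  - intros t Ht [r [Hr Hz]]. exists (r / (2 * L)); split; [apply Rdiv_lt_0_compat; lra |].
    intros s Hs. exists (r / 2); split; [lra |]. intros z' Hz'. apply Hz.
    eapply Rle_lt_trans; [apply (Cmod_minus_triangle _ (segment z1 z2 s)) |].
    rewrite Cmod_segment_diff, Rabs_pos_eq by lra. fold L.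
    assert ((s - t) * L < r / (2 * L) * L) by (apply Rmult_lt_compat_r; lra).
    replace (r / (2 * L) * L) with (r / 2) in * by (field; lra). lra.
  - intros t Ht Hs. apply analytic_at_zero_nbhd; [apply Hf; lra |].
    intros delta Hd. set (e := Rmin (t / 2) (delta / (2 * L))).
    assert (He : 0 < e) by (apply Rmin_pos; [lra | apply Rdiv_lt_0_compat; lra]).
    assert (He1 : e <= t / 2) by apply Rmin_l.
    assert (He2 : e <= delta / (2 * L)) by apply Rmin_r.
    assert (HD : Cmod (segment z1 z2 (t - e) - segment z1 z2 t)%C = e * L).
    { rewrite Cmod_segment_diff. replace (t - e - t) with (- e) by ring.
      rewrite Rabs_Ropp, Rabs_pos_eq by lra. reflexivity. }
    exists (segment z1 z2 (t - e)). split; [| split].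
    + intros E. rewrite E in HD. replace (segment z1 z2 t - segment z1 z2 t)%C with (RtoC 0) in HD by ring.
      rewrite Cmod_0 in HD. nra.
    + rewrite HD. assert (e * L <= delta / (2 * L) * L) by (apply Rmult_le_compat_r; lra).
      replace (delta / (2 * L) * L) with (delta / 2) in * by (field; lra). lra.
    + destruct (Hs (t - e)) as [r [Hr Hz]]; [lra |]. apply Hz.
      replace (segment z1 z2 (t - e) - segment z1 z2 (t - e))%C with (RtoC 0) by ring.
      rewrite Cmod_0; exact Hr.
Qed.

Lemma vanishes_near_punctured_segment (f : C -> C) (z0 : C) (r : R) (u1 u2 : C) :
  analytic_on_punctured_disk f z0 r -> Cmod u1 < r -> Cmod u2 < r ->
  (forall t, 0 <= t <= 1 -> segment u1 u2 t <> 0) ->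
  vanishes_near f (z0 + u1)%C -> vanishes_near f (z0 + u2)%C.
Proof.
  intros Hf H1 H2 Hne. apply vanishes_near_segment. intros t Ht. apply Hf.
  replace (segment (z0 + u1) (z0 + u2) t - z0)%C with (segment u1 u2 t) by (unfold segment; ring).
  split; [apply Cmod_gt_0, Hne, Ht |].
  replace (segment u1 u2 t) with (RtoC (1 - t) * u1 + RtoC t * u2)%C
    by (unfold segment; rewrite RtoC_minus; ring).
  eapply Rle_lt_trans; [apply Cmod_triangle |].
  rewrite !Cmod_mult, !Cmod_R, !Rabs_pos_eq by lra.
  apply Rle_lt_trans with ((1 - t) * Rmax (Cmod u1) (Cmod u2) + t * Rmax (Cmod u1) (Cmod u2)).
  - apply Rplus_le_compat; apply Rmult_le_compat_l; try lra; [apply Rmax_l | apply Rmax_r].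
  - replace ((1 - t) * Rmax (Cmod u1) (Cmod u2) + t * Rmax (Cmod u1) (Cmod u2))
      with (Rmax (Cmod u1) (Cmod u2)) by ring.
    apply Rmax_lub_lt; assumption.
Qed.

Lemma vanishes_punctured_disk (f : C -> C) (z0 : C) (r : R) (z1 z2 : C) :
  analytic_on_punctured_disk f z0 r ->
  0 < Cmod (z1 - z0)%C < r -> 0 < Cmod (z2 - z0)%C < r ->
  vanishes_near f z1 -> vanishes_near f z2.
Proof.
  intros Hf. set (u1 := (z1 - z0)%C); set (u2 := (z2 - z0)%C).
  replace z1 with (z0 + u1)%C by (unfold u1; ring). replace z2 with (z0 + u2)%C by (unfold u2; ring).
  clearbody u1 u2. intros [H1 H1'] [H2 H2'].
  destruct (classic (forall t, 0 <= t <= 1 -> segment u1 u2 t <> 0)) as [Hd | Hd].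
  { apply (vanishes_near_punctured_segment f z0 r); assumption. }
  (* The segment passes through the centre: make a detour through [Ci * u1]. *)
  apply not_all_ex_not in Hd; destruct Hd as [t Hd].
  apply imply_to_and in Hd; destruct Hd as [Ht Hd]. apply NNPP in Hd.
  assert (Hu1 : u1 <> 0) by (apply Cmod_gt_0, H1).
  assert (Hu2 : u2 <> 0) by (apply Cmod_gt_0, H2).
  assert (Ht0 : t <> 0) by (intros ->; apply Hu1; rewrite <- (segment_0 u1 u2); exact Hd).
  assert (Ht1 : t <> 1) by (intros ->; apply Hu2; rewrite <- (segment_1 u1 u2); exact Hd).
  assert (E : (RtoC t * u2 = - (RtoC (1 - t) * u1))%C).
  { rewrite RtoC_minus.
    replace (RtoC t * u2)%C with (segment u1 u2 t - (1 - RtoC t) * u1)%C by (unfold segment; ring).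
    rewrite Hd; ring. }
  assert (Hnz : forall x y : R, x <> 0 \/ y <> 0 -> ((x, y) * u1)%C <> 0).
  { intros x y Hxy. apply Cmod_gt_0. rewrite Cmod_mult. apply Rmult_lt_0_compat; [| exact H1].
    apply Cmod_gt_0. intros Exy; injection Exy as Ex Ey; destruct Hxy; contradiction. }
  intros Hv. apply (vanishes_near_punctured_segment f z0 r (Ci * u1)%C); try assumption.
  - rewrite Cmod_mult, Cmod_Ci; lra.
  (* Second leg, from [Ci * u1] to [u2]: [t] times its point is [(- s (1 - t) + i t (1 - s)) u1],
     which is not 0 because [0 < t < 1]. *)
  - intros s Hs E'.
    apply (Hnz (- (s * (1 - t))) (t * (1 - s))).
    { destruct (Req_dec s 0) as [-> | Hs0]; [right; lra | left].
      apply Rlt_not_eq. assert (0 < s * (1 - t)) by (apply Rmult_lt_0_compat; lra). lra. }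
    replace ((- (s * (1 - t)), t * (1 - s))%R * u1)%C with (RtoC t * segment (Ci * u1) u2 s)%C.
    + rewrite E'; ring.
    + replace (RtoC t * segment (Ci * u1) u2 s)%C
        with (RtoC t * (1 - RtoC s) * Ci * u1 + RtoC s * (RtoC t * u2))%C by (unfold segment; ring).
      rewrite E. apply injective_projections; simpl; ring.
  (* First leg, from [u1] to [Ci * u1]: its points are [((1 - s) + i s) u1]. *)
  - apply (vanishes_near_punctured_segment f z0 r u1); try assumption.
    + rewrite Cmod_mult, Cmod_Ci; lra.
    + intros s Hs.
      replace (segment u1 (Ci * u1) s) with (((1 - s)%R, s) * u1)%C
        by (apply injective_projections; simpl; ring).
      apply Hnz. destruct (Req_dec s 0); [left; lra | right; assumption].
Qed.

(** Real induction again, now with possible singularities on the segment itself. At a limit point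
    [f] is analytic in a punctured disc, which contains earlier points of the segment; vanishing
    near one point of that disc spreads over all of it. *)
Lemma identity_theorem (D : C -> Prop) (f : C -> C) (p z : C) :
  analytic_except_isolated D f ->
  (forall t, 0 <= t <= 1 -> D (segment p z t)) ->
  vanishes_around f p -> vanishes_around f z.
Proof.
  intros Hf HD Hp. destruct (Ceq_dec z p) as [-> | Hne]; [exact Hp |].
  assert (HL := Cmod_minus_pos _ _ Hne). set (L := Cmod (z - p)%C) in *.
  rewrite <- (segment_1 p z).
  apply (real_induction (fun t => vanishes_around f (segment p z t))).
  - rewrite segment_0; exact Hp.
  - intros t Ht [r [Hr Hz]]. exists (r / L); split; [apply Rdiv_lt_0_compat; lra |].
    intros s Hs.
    assert (HD' : Cmod (segment p z s - segment p z t)%C = (s - t) * L)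
      by (rewrite Cmod_segment_diff, Rabs_pos_eq by lra; reflexivity).
    assert (Hs1 : 0 < (s - t) * L) by (apply Rmult_lt_0_compat; lra).
    assert (Hs2 : (s - t) * L < r).
    { assert ((s - t) * L < r / L * L) by (apply Rmult_lt_compat_r; lra).
      replace (r / L * L) with r in * by (field; lra). lra. }
    (* The first bound keeps the disc away from [segment p z t], where [f] need not vanish; the
       second keeps it inside the disc of radius [r]. *)
    exists (Rmin ((s - t) * L) (r - (s - t) * L)); split; [apply Rmin_pos; lra |].
    intros z' [_ Hz'].
    assert (H1 := Rlt_le_trans _ _ _ Hz' (Rmin_l _ _)).
    assert (H2 := Rlt_le_trans _ _ _ Hz' (Rmin_r _ _)).
    apply Hz. split.
    + assert (H3 := Cmod_minus_triangle (segment p z s) z' (segment p z t)).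
      rewrite HD', (Cmod_minus_sym (segment p z s) z') in H3. lra.
    + assert (H3 := Cmod_minus_triangle z' (segment p z s) (segment p z t)). lra.
  - intros t Ht Hs. destruct (Hf (segment p z t)) as [r [Hr Ha]]; [apply HD; lra |].
    set (e := Rmin (t / 2) (r / (2 * L))).
    assert (He : 0 < e) by (apply Rmin_pos; [lra | apply Rdiv_lt_0_compat; lra]).
    assert (He1 : e <= t / 2) by apply Rmin_l.
    assert (He2 : e * L <= r / 2).
    { apply Rle_trans with (r / (2 * L) * L); [apply Rmult_le_compat_r; [lra | apply Rmin_r] |].
      right; field; lra. }
    assert (HeL : 0 < e * L) by (apply Rmult_lt_0_compat; lra).
    set (w := segment p z (t - e)).
    assert (HDw : Cmod (w - segment p z t)%C = e * L).
    { unfold w; rewrite Cmod_segment_diff. replace (t - e - t) with (- e) by ring.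
      rewrite Rabs_Ropp, Rabs_pos_eq by lra. reflexivity. }
    destruct (Hs (t - e)) as [q [Hq Hz]]; [lra |]. fold w in Hz.
    (* [f] may fail to vanish at [w] itself, so one moves to [w + eta]: the disc of radius [eta]
       about that point avoids [w], and the point stays in the punctured disc at the limit point. *)
    set (eta := Rmin (q / 2) (e * L / 2)).
    assert (Heta : 0 < eta) by (apply Rmin_pos; lra).
    assert (Heta1 : eta <= q / 2) by apply Rmin_l.
    assert (Heta2 : eta <= e * L / 2) by apply Rmin_r.
    set (z1 := (w + RtoC eta)%C).
    assert (Hz1w : Cmod (z1 - w)%C = eta).
    { replace (z1 - w)%C with (RtoC eta) by (unfold z1; ring). rewrite Cmod_R. apply Rabs_pos_eq; lra. }
    assert (Hz1 : 0 < Cmod (z1 - segment p z t)%C < r).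
    { assert (H1 := Cmod_minus_triangle z1 w (segment p z t)).
      assert (H2 := Cmod_minus_triangle w z1 (segment p z t)).
      rewrite (Cmod_minus_sym w z1) in H2. lra. }
    assert (Hv : vanishes_near f z1).
    { exists eta; split; [exact Heta |]. intros z' Hz'. apply Hz.
      assert (H1 := Cmod_minus_triangle z' z1 w).
      assert (H2 := Cmod_minus_triangle z1 z' w).
      rewrite (Cmod_minus_sym z1 z') in H2. lra. }
    exists r; split; [exact Hr |]. intros z' Hz'.
    destruct (vanishes_punctured_disk f _ r z1 z' Ha Hz1 Hz' Hv) as [r' [Hr' Hz'']].
    apply Hz''. replace (z' - z')%C with (RtoC 0) by ring. rewrite Cmod_0; exact Hr'.
Qed.

(** * Finite parts and the continuation *)

Lemma Cinv_pow_opp (p l : C) (n : nat) :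
  (/ (p - l) ^ S n = RtoC ((-1) ^ S n) * / (l - p) ^ S n)%C.
Proof.
  destruct (Ceq_dec (l - p)%C 0) as [E | E].
  - replace (p - l)%C with (- (l - p))%C by ring. rewrite E.
    replace (- RtoC 0)%C with (RtoC 0) by ring. cbn [Cpow]. rewrite Cmult_0_l, Cinv_0. ring.
  - replace (p - l)%C with (RtoC (-1) * (l - p))%C by (apply injective_projections; simpl; ring).
    rewrite Cpow_mult_l, <- RtoC_pow.
    assert (H : RtoC ((-1) ^ S n) <> 0).
    { intros H; apply RtoC_inj in H. revert H; apply pow_nonzero; lra. }
    assert (H2 : (RtoC ((-1) ^ S n) * RtoC ((-1) ^ S n) = 1)%C).
    { rewrite <- RtoC_mult, <- Rpow_mult_distr.
      replace (-1 * -1) with 1 by ring. rewrite pow1; reflexivity. }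
    set (e := RtoC ((-1) ^ S n)) in *.
    replace (/ (e * (l - p) ^ S n))%C with ((e * e) / (e * (l - p) ^ S n))%C
      by (rewrite H2; unfold Cdiv; ring).
    field. split; [apply Cpow_nz, E | exact H].
Qed.

(** The poles [m + 1] are separated, so on a small enough disc only the term with its pole at [z0],
    if any, is singular. The identity holds at [l = z0] as well, by [/ 0 = 0]. *)
Lemma pole_sum_local (c : nat -> C) (n N : nat) (z0 : C) :
  exists (A : C) (h : C -> C) (r : R), 0 < r /\
    (forall l, Cmod (l - z0)%C < r -> analytic_at h l) /\
    forall l, pole_sum c n N l = (h l + A * / (l - z0) ^ S n)%C.
Proof.
  induction N as [|N [A [h [r [Hr [Hh E]]]]]].
  - exists 0, (fun _ => RtoC 0), 1. split; [lra |]. split; [intros; apply analytic_at_const |].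
    intros l; unfold pole_sum; cbn [Csum]; ring.
  - set (p := (RtoC (INR N) + 1)%C). set (q := (c N * (pole_coef n * RtoC ((-1) ^ S n)))%C).
    assert (Eq : forall l, pole_sum c n (S N) l = (pole_sum c n N l + q * / (l - p) ^ S n)%C).
    { intros l; unfold pole_sum at 1; cbn [Csum]. fold (pole_sum c n N l). fold p.
      rewrite Cinv_pow_opp. unfold q; ring. }
    destruct (Ceq_dec z0 p) as [Ez | Ez].
    + exists (A + q)%C, h, r. split; [exact Hr |]. split; [exact Hh |].
      intros l; rewrite Eq, E, Ez. ring.
    + exists A, (fun l => h l + q * / (l - p) ^ S n)%C, (Rmin r (Cmod (z0 - p)%C)).
      assert (Hp := Cmod_minus_pos _ _ Ez).
      split; [apply Rmin_pos; assumption |]. split.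
      * intros l Hl. apply analytic_at_plus.
        -- apply Hh, Rlt_le_trans with (1 := Hl), Rmin_l.
        -- apply analytic_at_scal, analytic_at_inv_pow. intros ->.
           assert (H := Rlt_le_trans _ _ _ Hl (Rmin_r _ _)).
           rewrite Cmod_minus_sym in H. lra.
      * intros l; rewrite Eq, E. ring.
Qed.

(** Each primitive is wholly of one kind, decided by the sign of [Re s]: it tends to 0 and joins the
    convergent group, or all its monomials diverge and enter the list. *)
Lemma log_primitive_sum_split (c : nat -> C) (n N : nat) (l : C) :
  exists (L : list (C * (C * nat))) (G : R -> C),
    List.Forall (fun e => divergent_monomial (fst (snd e)) (snd (snd e))) L /\
    Clim (at_right 0) G 0 /\
    forall eps, (- Csum (fun m => c m * log_primitive n (RtoC (INR m) + 1 - l) eps) N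
                 = G eps + divergent_sum L eps)%C.
Proof.
  induction N as [|N [L [G [HL [HG E]]]]].
  - exists nil, (fun _ => RtoC 0). split; [constructor |]. split; [clim Clim_const |].
    intros eps; cbn [Csum]. unfold divergent_sum; simpl. ring.
  - set (s := (RtoC (INR N) + 1 - l)%C).
    destruct (Rlt_le_dec 0 (Re s)) as [Hs | Hs].
    + exists L, (fun eps => G eps + - c N * log_primitive n s eps)%C.
      split; [exact HL |]. split.
      * replace (RtoC 0) with (0 + - c N * 0)%C by ring. clim Clim_plus; [exact HG |].
        clim Clim_mult; [clim Clim_const | apply log_primitive_lim_0, Hs].
      * intros eps; cbn [Csum]. fold s.
        replace (G eps + - c N * log_primitive n s eps + divergent_sum L eps)%C
          with (G eps + divergent_sum L eps + - c N * log_primitive n s eps)%C by ring.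
        rewrite <- E. ring.
    + exists (List.map (fun e => (- c N * fst e, snd e)%C) (log_primitive_list n s) ++ L), G.
      split; [| split; [exact HG |]].
      * apply List.Forall_app; split; [apply log_primitive_list_divergent, Hs | exact HL].
      * intros eps; cbn [Csum]. fold s.
        rewrite divergent_sum_app, divergent_sum_scal. fold (log_primitive n s eps).
        replace (G eps + (- c N * log_primitive n s eps + divergent_sum L eps))%C
          with (G eps + divergent_sum L eps + - c N * log_primitive n s eps)%C by ring.
        rewrite <- E. ring.
Qed.

Lemma is_RInt_gen_from_point (f : R -> C) (b : R) (F : (R -> Prop) -> Prop) {FF : Filter F} (v : C) :
  F (fun y => forall t, Rbetween b y t -> Ccont f t) ->
  Clim F (CRInt f b) v -> is_RInt_gen (V := C_R_NormedModule) f (at_point b) F v.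
Proof.
  intros Hc H. apply CRInt_is_RInt_gen; [typeclasses eauto | exact FF | |].
  - eapply (Filter_prod _ _ _ (fun x => x = b)); [exact (eq_refl b) | exact Hc |]. intros x y -> Hy; exact Hy.
  - intros P HP. eapply (Filter_prod _ _ _ (fun x => x = b)); [exact (eq_refl b) | exact (H P HP) |]. intros x y -> Hy; exact Hy.
Qed.

Lemma is_RInt_gen_to_point (f : R -> C) (b : R) (F : (R -> Prop) -> Prop) {FF : Filter F} (v : C) :
  F (fun x => forall t, Rbetween x b t -> Ccont f t) ->
  Clim F (fun x => CRInt f x b) v -> is_RInt_gen (V := C_R_NormedModule) f F (at_point b) v.
Proof.
  intros Hc H. apply CRInt_is_RInt_gen; [exact FF | typeclasses eauto | |].
  - eapply (Filter_prod _ _ _ _ (fun y => y = b)); [exact Hc | exact (eq_refl b) |]. intros x y Hx ->; exact Hx.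
  - intros P HP. eapply (Filter_prod _ _ _ _ (fun y => y = b)); [exact (H P HP) | exact (eq_refl b) |]. intros x y Hx ->; exact Hx.
Qed.

(** Solving the definition of [near_itg] for the integral leaves minus the sum of primitives at
    [eps], which the splitting lemma turns into [G] plus the divergent list. No order between [b]
    and [x] is required: [v] may be an integral run backwards. *)
Lemma fp_int_finite_of_near (k : R -> C) (c : nat -> C) (b x : R) (n N : nat) (l u v : C) :
  0 < b ->
  (forall t, 0 < t <= b -> Ccont k t) ->
  Clim (at_right 0) (near_itg k c b n N l) u ->
  is_RInt_gen (V := C_R_NormedModule) (mellin_itg k n l) (at_point b) (at_left x) v ->
  is_fp_int_finite (mellin_itg k n l) x (u + v)%C.
Proof.
  intros Hb Hk Hu Hv. destruct (log_primitive_sum_split c n N l) as [L [G [HL [HG E]]]].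
  exists (fun eps => near_itg k c b n N l eps + v + G eps)%C, L.
  split; [exact HL |]. split.
  - generalize (at_right_0_lt b Hb); apply filter_imp. intros eps Heps.
    replace (near_itg k c b n N l eps + v + G eps + divergent_sum L eps)%C
      with (CRInt (mellin_itg k n l) eps b + v)%C.
    + apply (is_RInt_gen_Chasles (V := C_R_NormedModule) _ b); [| exact Hv].
      apply is_RInt_gen_at_point, CRInt_correct. intros t [H1 H2].
      rewrite Rmin_left in H1 by lra. rewrite Rmax_right in H2 by lra.
      apply mellin_itg_Ccont; [lra | apply Hk; lra].
    + unfold near_itg.
      replace (CRInt (mellin_itg k n l) eps b
        + Csum (fun m => c m * log_primitive n (RtoC (INR m) + 1 - l) eps) N + v + G eps
        + divergent_sum L eps)%C
        with (CRInt (mellin_itg k n l) eps b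
        + Csum (fun m => c m * log_primitive n (RtoC (INR m) + 1 - l) eps) N + v
        + (G eps + divergent_sum L eps))%C by ring.
      rewrite <- E. ring.
  - replace (u + v)%C with (u + v + 0)%C by ring.
    clim Clim_plus; [clim Clim_plus; [exact Hu | clim Clim_const] | exact HG].
Qed.

Lemma fp_int_of_parts (a : Rbar) (k : R -> C) (c : nat -> C) (b : R) (n N : nat) (l u v : C) :
  0 < b -> Rbar_lt b a ->
  (forall t, 0 < t -> Rbar_lt t a -> Ccont k t) ->
  Clim (at_right 0) (near_itg k c b n N l) u ->
  Clim (at_end a) (CRInt (mellin_itg k n l) b) v ->
  is_fp_int a (mellin_itg k n l) (u + v)%C.
Proof.
  intros Hb Hba Hk Hu Hv.
  assert (Hkb : forall t, 0 < t <= b -> Ccont k t).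
  { intros t Ht; apply Hk; [apply Ht |]. apply Rbar_le_lt_trans with b; [apply Ht | exact Hba]. }
  assert (Hi : forall t, 0 < t -> Rbar_lt t a -> Ccont (mellin_itg k n l) t).
  { intros t Ht Hta; apply mellin_itg_Ccont; [exact Ht | apply Hk; assumption]. }
  destruct a as [x | |]; [| | contradiction].
  - apply (fp_int_finite_of_near k c b x n N); [exact Hb | exact Hkb | exact Hu |].
    apply is_RInt_gen_from_point; [typeclasses eauto | | exact Hv].
    generalize (at_end_inside (Finite x) b Hba); apply filter_imp. intros y [H1 H2] t Ht.
    apply Hi.
    + destruct Ht as [Ht _]; rewrite Rmin_left in Ht; lra.
    + eapply (Rbar_lt_between (Finite x)); [exact Hba | exact H2 | exact Ht].
  (* A finite part is due for every upper limit [y > 0], including [y < b]. *)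
  - exists (fun y => u + CRInt (mellin_itg k n l) b y)%C. split.
    + intros y Hy.
      assert (Hc : forall z, 0 < z -> forall t, Rbetween b z t -> Ccont (mellin_itg k n l) t).
      { intros z Hz t [Ht _]. apply Hi; [| exact I].
        eapply Rlt_le_trans; [apply Rmin_pos; [exact Hb | exact Hz] | exact Ht]. }
      assert (Hpos : locally y (fun t => 0 < t)) by (apply (open_gt 0 y); exact Hy).
      apply (fp_int_finite_of_near k c b y n N); [exact Hb | exact Hkb | exact Hu |].
      apply is_RInt_gen_from_point; [typeclasses eauto | |].
      * apply (filter_le_within (fun t => t < y)). revert Hpos; apply filter_imp. exact Hc.
      * apply (filterlim_filter_le_1 (F := locally y)); [apply filter_le_within |].
        apply (Cder_Ccont _ _ (mellin_itg k n l y)), CRInt_is_derive; [apply Hc, Hy |].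
        revert Hpos; apply filter_imp. intros t Ht; apply Hi; [exact Ht | exact I].
    + apply (Clim_plus (Rbar_locally p_infty)); [clim Clim_const | exact Hv].
Qed.

(** * The regularized limit at a single pole *)

Lemma is_series_single (u : nat -> C) (n : nat) :
  (forall j, j <> n -> u j = 0) ->
  is_series (K := C_AbsRing) (V := C_NormedModule) u (u n).
Proof.
  intros Hu. apply (is_series_ext (fun j => (u j * 1 ^ j)%C)).
  { intros j; rewrite Cpow_1_l; apply Cmult_1_r. }
  apply is_series_Cpseries. apply (Clim_ext_loc eventually (fun _ => u n)); [| clim Clim_const].
  exists (S n). intros N HN.
  assert (H : forall N, Cpsum u 1 N = if Nat.ltb n N then u n else 0).
  { clear N HN; intros N; induction N as [|N IH]; [reflexivity |].
    cbn [Cpsum]. rewrite IH, Cpow_1_l.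
    destruct (Nat.ltb_spec n N); destruct (Nat.ltb_spec n (S N)); try lia.
    - rewrite (Hu N) by lia. ring.
    - replace N with n by lia. ring.
    - rewrite (Hu N) by lia. ring. }
  rewrite H. destruct (Nat.ltb_spec n N); [reflexivity | lia].
Qed.

Lemma locally_Cmod (z0 : C) (delta : R) :
  0 < delta -> locally (T := C_UniformSpace) z0 (fun z => Cmod (z - z0)%C < delta).
Proof.
  intros Hd. apply (proj1 (Clim_Cmod (locally (T := C_UniformSpace) z0) (fun z => z) z0)).
  - apply filterlim_id.
  - exact Hd.
Qed.

(** The Laurent expansion can be written down: the Taylor series of [h] and one negative power.
    Subtracting that power leaves [h], which is continuous at [z0]. *)
Lemma is_reglim_single_pole (w h : C -> C) (A z0 : C) (n : nat) (r : R) :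
  0 < r ->
  (forall z, 0 < Cmod (z - z0)%C < r ->
     analytic_at w z /\ w z = (h z + A * / (z - z0) ^ S n)%C) ->
  analytic_at h z0 ->
  is_reglim w z0 (h z0).
Proof.
  intros Hr Hw Hh. pose proof Hh as [ch [rh [Hrh Hs]]].
  set (q := Rmin r rh). assert (Hq : 0 < q) by (apply Rmin_pos; assumption).
  assert (Hqr : q <= r) by apply Rmin_l. assert (Hqh : q <= rh) by apply Rmin_r.
  exists q, (fun j : Z => if Z.leb 0 j then ch (Z.to_nat j)
                          else if Z.eqb j (- Z.of_nat (S n)) then A else 0),
    (fun z => A * / (z - z0) ^ S n)%C.
  split; [exact Hq |]. split; [| split].
  - intros z Hz. apply Hw; lra.
  - intros z Hz. split.
    + set (u := fun j : nat => _). replace (A * / (z - z0) ^ S n)%C with (u n).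
      * apply is_series_single. intros j Hj. unfold u.
        replace (0 <=? - Z.of_nat (S j))%Z with false by (symmetry; apply Z.leb_gt; lia).
        replace (- Z.of_nat (S j) =? - Z.of_nat (S n))%Z with false by (symmetry; apply Z.eqb_neq; lia).
        unfold Cdiv; ring.
      * unfold u. replace (0 <=? - Z.of_nat (S n))%Z with false by (symmetry; apply Z.leb_gt; lia).
        rewrite Z.eqb_refl. reflexivity.
    + destruct (Hw z) as [_ E]; [lra |].
      replace (w z - A * / (z - z0) ^ S n)%C with (h z) by (rewrite E; ring).
      apply (is_series_ext (fun j => (ch j * (z - z0) ^ j)%C)).
      * intros j. replace (0 <=? Z.of_nat j)%Z with true by (symmetry; apply Z.leb_le; lia).
        rewrite Nat2Z.id. reflexivity.
      * apply is_series_Cpseries, is_pseries_Cpseries, Hs. lra.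
  - apply (Clim_Cmod (locally' (T := C_UniformSpace) z0)). intros eps Heps.
    destruct (analytic_at_continuous h z0 Hh eps Heps) as [delta [Hd Hc]].
    generalize (locally_Cmod z0 (Rmin delta q) ltac:(apply Rmin_pos; assumption)).
    unfold locally', within. apply filter_imp. intros z Hz Hne.
    assert (H1 := Rlt_le_trans _ _ _ Hz (Rmin_l _ _)).
    assert (H2 := Rlt_le_trans _ _ _ Hz (Rmin_r _ _)).
    destruct (Hw z) as [_ E]; [split; [apply Cmod_minus_pos, Hne | lra] |].
    replace (w z - A * / (z - z0) ^ S n - h z0)%C with (h z - h z0)%C by (rewrite E; ring).
    apply Hc, H1.
Qed.

Lemma Rbar_lt_nearby (d : Rbar) (x : R) :
  Rbar_lt d x -> exists r, 0 < r /\ forall y, Rabs (y - x) < r -> Rbar_lt d y.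
Proof.
  destruct d as [w | |]; simpl; intros H; [| contradiction | exists 1; split; [lra | trivial]].
  exists (x - w); split; [lra |]. intros y Hy. apply Rabs_def2 in Hy. lra.
Qed.

Lemma Re_diff_lt (z w : C) (r : R) : Cmod (z - w)%C < r -> Rabs (Re z - Re w) < r.
Proof. apply Rle_lt_trans, (re_le_Cmod (z - w)%C). Qed.

Theorem theorem5p5 :
  forall (a d : Rbar) (k : R -> C),
    Rbar_lt 0 a ->
    class_K a k ->
    mellin_strip a k d ->
    forall n : nat,
      (exists W : C -> C, is_mellin_continuation a (times_ln_pow k n) d W) /\
      (forall W : C -> C,
         is_mellin_continuation a (times_ln_pow k n) d W ->
         exists Wx : C -> C,
           is_regularized (right_half_plane d) W Wx /\
           forall l : C, Rbar_lt d (Re l) ->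
             is_fp_int a
               (fun t : R => (times_ln_pow k n t / cpower t l)%C) (Wx l)).
Proof.
  intros a d k Ha [_ [[kz Hkz] _]] Hstrip n.
  assert (Hk : forall t, 0 < t -> Rbar_lt t a -> Ccont k t).
  { intros t Ht Hta. destruct (Hkz t) as [E Han]; [lra | exact Hta |].
    apply (Clim_Cmod (locally t)). intros eps Heps.
    destruct (analytic_at_continuous kz _ Han eps Heps) as [delta [Hd Hc]].
    assert (Hl : locally t (fun s => 0 < s /\ Rbar_lt s a)).
    { apply filter_and; [apply (open_gt 0 t); lra |].
      destruct a as [y | |]; simpl in *; [apply (open_lt y t); exact Hta | | contradiction].
      apply filter_true. }
    generalize (filter_and _ _ Hl (locally_ball t (mkposreal _ Hd))). apply filter_imp.
    intros s [[Hs Hsa] Hst]. destruct (Hkz s) as [Es _]; [lra | exact Hsa |].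
    rewrite <- E, <- Es. apply Hc. rewrite <- RtoC_minus, Cmod_R. exact Hst. }
  destruct (Hkz 0 (Rle_refl 0) Ha) as [_ Han0].
  destruct (analytic_at_coefs _ _ Han0) as [c [rho [M [Hg Hc]]]].
  assert (Hrho := proj1 Hg).
  (* The bound [rho / 2] is the radius on which Taylor remainders are controlled. *)
  assert (Hbex : exists b, 0 < b /\ b <= rho / 2 /\ Rbar_lt b a).
  { destruct a as [x | |]; simpl in *; [| | contradiction].
    - exists (Rmin (rho / 2) (x / 2)). pose proof (Rmin_r (rho / 2) (x / 2)).
      split; [apply Rmin_pos; lra |]. split; [apply Rmin_l | lra].
    - exists (rho / 2). split; [lra |]. split; [lra | exact I]. }
  destruct Hbex as [b [Hb [Hbrho Hba]]].
  assert (Hkb : forall t, 0 < t <= b -> Ccont k t).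
  { intros t Ht; apply Hk; [apply Ht |]. apply Rbar_le_lt_trans with b; [apply Ht | exact Hba]. }
  assert (Hbound : forall N, exists M, forall t, 0 < t <= b ->
            Cmod (k t - Cpsum c (RtoC t) N)%C <= M * t ^ N).
  { intros N. destruct (Cpseries_remainder_bound c rho M N Hg) as [M' HM'].
    exists M'. intros t Ht.
    assert (Hta : Rbar_lt t a) by (apply Rbar_le_lt_trans with b; [apply Ht | exact Hba]).
    destruct (Hkz t) as [E _]; [lra | exact Hta |]. rewrite <- E.
    assert (Et : Cmod (RtoC t) = t) by (rewrite Cmod_R; apply Rabs_pos_eq; lra).
    rewrite <- Et at 3. apply HM'; [lra |].
    replace (RtoC t) with (RtoC t - RtoC 0)%C at 1 by ring. apply Hc.
    replace (RtoC t - RtoC 0)%C with (RtoC t) by ring. lra. }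
  destruct (near_part k c b n Hb Hkb Hbound) as [V [HV HVloc]].
  assert (Hnear0 : forall l0, l0 < 1 -> exists u,
     Clim (at_right 0) (fun x => CRInt (mellin_itg k 0 (RtoC l0)) x b) u).
  { intros l0 Hl0. destruct (near_part k c b 0 Hb Hkb Hbound) as [V0 [HV0 _]].
    exists (V0 (RtoC l0)).
    apply (Clim_ext (at_right 0) (near_itg k c b 0 0 (RtoC l0))).
    - intros x; unfold near_itg; cbn [Csum]; ring.
    - apply HV0. simpl. lra. }
  destruct (tail_part a d k b Hb Hba Hk Hstrip Hnear0 n) as [T HT].
  set (W0 := fun l => (V l + T l)%C).
  assert (Hloc : forall z0, Rbar_lt d (Re z0) -> exists (A : C) (h : C -> C) (r : R), 0 < r /\
    forall l, Cmod (l - z0)%C < r ->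
      analytic_at h l /\ W0 l = (h l + A * / (l - z0) ^ S n)%C).
  (* The extra 1 leaves room for a unit disc around [z0] inside the half plane
     [Re l < INR N + 1]. *)
  { intros z0 Hz0. destruct (INR_above (Re z0 + 1)) as [N HN].
    destruct (HVloc N) as [h1 Hh1].
    destruct (pole_sum_local c n N z0) as [A [h2 [r2 [Hr2 [Hh2 E2]]]]].
    destruct (Rbar_lt_nearby d (Re z0) Hz0) as [r3 [Hr3 Hd3]].
    exists A, (fun l => h1 l + h2 l + T l)%C, (Rmin 1 (Rmin r2 r3)).
    split; [repeat apply Rmin_pos; lra |]. intros l Hl.
    assert (H1 := Rlt_le_trans _ _ _ Hl (Rmin_l _ _)).
    assert (H23 := Rlt_le_trans _ _ _ Hl (Rmin_r _ _)).
    assert (H2 := Rlt_le_trans _ _ _ H23 (Rmin_l _ _)).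
    assert (H3 := Rlt_le_trans _ _ _ H23 (Rmin_r _ _)).
    assert (HlN : Re l < INR N + 1).
    { assert (H1' := Re_diff_lt _ _ _ H1). apply Rabs_def2 in H1'. lra. }
    destruct (Hh1 l HlN) as [Ha1 E1]. split.
    - apply analytic_at_plus; [apply analytic_at_plus; [exact Ha1 | apply Hh2, H2] |].
      apply HT, Hd3, Re_diff_lt, H3.
    - unfold W0. rewrite E1, E2. ring. }
  assert (Hana : forall z0, Rbar_lt d (Re z0) -> exists r, 0 < r /\
            analytic_on_punctured_disk W0 z0 r).
  { intros z0 Hz0. destruct (Hloc z0 Hz0) as [A [h [r [Hr Hh]]]].
    exists r; split; [exact Hr |]. intros z [Hz1 Hz2].
    apply (analytic_at_ext (fun l => h l + A * / (l - z0) ^ S n)%C W0 z (r - Cmod (z - z0)%C)).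
    - lra.
    - intros l Hl. symmetry; apply Hh.
      eapply Rle_lt_trans; [apply (Cmod_minus_triangle l z z0) | lra].
    - apply analytic_at_plus; [apply Hh, Hz2 |].
      apply analytic_at_scal, analytic_at_inv_pow. intros ->.
      replace (z0 - z0)%C with (RtoC 0) in Hz1 by ring. rewrite Cmod_0 in Hz1. lra. }
  assert (Hmellin : forall l, Rbar_lt d (Re l) -> Re l < 1 ->
            is_mellin a (times_ln_pow k n) (1 - l)%C (W0 l)).
  { intros l Hl Hl1. unfold is_mellin.
    replace (fun t => (times_ln_pow k n t * cpower t (1 - l - 1))%C) with (mellin_itg k n l).
    2: { apply functional_extensionality; intros t. unfold mellin_itg, times_ln_pow.
         replace (1 - l - 1)%C with (- l)%C by ring. ring. }
    apply (is_RInt_gen_Chasles (V := C_R_NormedModule) _ b).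
    - apply is_RInt_gen_to_point; [typeclasses eauto | |].
      + generalize (at_right_0_lt b Hb); apply filter_imp. intros x Hx t [H1 H2].
        rewrite Rmin_left in H1 by lra. rewrite Rmax_right in H2 by lra.
        apply mellin_itg_Ccont; [lra | apply Hkb; lra].
      (* For [Re l < 1] the choice [N = 0] is admissible, and [near_itg] is then the plain
         integral. *)
      + apply (Clim_ext (at_right 0) (near_itg k c b n 0 l)).
        * intros x; unfold near_itg; cbn [Csum]; ring.
        * apply HV. simpl. lra.
    - apply is_RInt_gen_from_point; [typeclasses eauto | | apply HT, Hl].
      generalize (at_end_inside a b Hba); apply filter_imp. intros y [H1 H2] t Ht.
      assert (Ht0 : 0 < t) by (destruct Ht as [Ht _]; rewrite Rmin_left in Ht; lra).
      apply mellin_itg_Ccont; [exact Ht0 | apply Hk; [exact Ht0 |]].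
      eapply Rbar_lt_between; [exact Hba | exact H2 | exact Ht]. }
  split.
  { exists W0; split; [exact Hana | exact Hmellin]. }
  intros W [HW1 HW2]. exists W0. split.
  - intros z0 Hz0. red in Hz0.
    (* A real point [p] of the strip to the left of [z0]: near it both continuations equal the
       Mellin integral, and the segment from [p] to [z0] stays in the half plane. *)
    destruct (Rbar_lt_real_between d (Re z0) 1 Hz0 (proj1 Hstrip)) as [p [Hp1 [Hp2 Hp3]]].
    assert (Heq : vanishes_around (fun z => W z - W0 z)%C z0).
    { apply (identity_theorem (right_half_plane d) _ (RtoC p)).
      - intros z Hz. destruct (HW1 z Hz) as [r1 [Hr1 H1]]. destruct (Hana z Hz) as [r2 [Hr2 H2]].
        exists (Rmin r1 r2); split; [apply Rmin_pos; assumption |]. intros z' [Hz'0 Hz'].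
        apply analytic_at_minus.
        + apply H1; split; [exact Hz'0 | apply Rlt_le_trans with (1 := Hz'), Rmin_l].
        + apply H2; split; [exact Hz'0 | apply Rlt_le_trans with (1 := Hz'), Rmin_r].
      - intros t Ht. red. apply Rbar_lt_le_trans with p; [exact Hp1 |].
        unfold segment, Re in *; simpl in *. nra.
      - destruct (Rbar_lt_nearby d p Hp1) as [r [Hr Hd]].
        exists (Rmin r (1 - p)); split; [apply Rmin_pos; lra |]. intros z [_ Hz].
        assert (H1 := Re_diff_lt _ _ _ (Rlt_le_trans _ _ _ Hz (Rmin_l _ _))).
        assert (H2 := Re_diff_lt _ _ _ (Rlt_le_trans _ _ _ Hz (Rmin_r _ _))).
        change (Re (RtoC p)) with p in H1, H2.
        assert (Hz1 : Rbar_lt d (Re z)) by (apply Hd, H1).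
        assert (Hz2 : Re z < 1) by (apply Rabs_def2 in H2; lra).
        assert (E : W z = W0 z).
        { assert (G1 := is_RInt_gen_CRInt _ _ _ _ (HW2 z Hz1 Hz2)).
          assert (G2 := is_RInt_gen_CRInt _ _ _ _ (Hmellin z Hz1 Hz2)).
          apply (Clim_unique (filter_prod (at_right 0) (at_end a)) _ _ _ G1 G2). }
        rewrite E; ring. }
    destruct Heq as [r1 [Hr1 Heq]]. destruct (Hana z0 Hz0) as [r2 [Hr2 H2]].
    destruct (Hloc z0 Hz0) as [A [h [r3 [Hr3 Hh]]]].
    set (r := Rmin r1 (Rmin r2 r3)).
    assert (Hr : 0 < r) by (repeat apply Rmin_pos; assumption).
    assert (Hle1 : r <= r1) by apply Rmin_l.
    assert (Hle2 : r <= r2) by (eapply Rle_trans; [apply Rmin_r | apply Rmin_l]).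
    assert (Hle3 : r <= r3) by (eapply Rle_trans; [apply Rmin_r | apply Rmin_r]).
    assert (EW : forall z, 0 < Cmod (z - z0)%C < r -> W z = W0 z).
    { intros z Hz. replace (W z) with (W z - W0 z + W0 z)%C by ring.
      rewrite (Heq z) by lra. ring. }
    assert (Hz00 : Cmod (z0 - z0)%C = 0).
    { replace (z0 - z0)%C with (RtoC 0) by ring. apply Cmod_0. }
    destruct (Hh z0) as [Hhan Eh]; [lra |].
    (* The pole term of [W0] is 0 at [z0], so [W0] takes the regularized value there. *)
    replace (W0 z0) with (h z0).
    2: { rewrite Eh. replace (z0 - z0)%C with (RtoC 0) by ring.
         cbn [Cpow]. rewrite Cmult_0_l, Cinv_0. ring. }
    apply (is_reglim_single_pole W h A z0 n r Hr); [| exact Hhan].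
    intros z Hz. split.
    + set (q := Rmin (Cmod (z - z0)%C) (r - Cmod (z - z0)%C)).
      apply (analytic_at_ext W0 W z q); [apply Rmin_pos; lra | | apply H2; lra].
      intros l Hl. symmetry; apply EW.
      assert (G1 := Rlt_le_trans _ _ _ Hl (Rmin_l _ _)).
      assert (G2 := Rlt_le_trans _ _ _ Hl (Rmin_r _ _)).
      assert (G3 := Cmod_minus_triangle l z z0).
      assert (G4 := Cmod_minus_triangle z l z0). rewrite (Cmod_minus_sym z l) in G4. lra.
    + rewrite (EW z Hz). apply Hh; lra.
  - intros l Hl.
    replace (fun t => (times_ln_pow k n t / cpower t l)%C) with (mellin_itg k n l).
    2: { apply functional_extensionality; intros t. unfold mellin_itg, times_ln_pow, Cdiv.
         rewrite cpower_opp. ring. }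
    destruct (INR_above (Re l)) as [N HN].
    apply (fp_int_of_parts a k c b n N); try assumption.
    + apply HV, HN.
    + apply HT, Hl.
Qed.
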